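(* Let $\omega$ be a non-principal ultrafilter on $\mathbb{N}$, $\{A_i\}$ compact abelian groups and $\mathbf{A}=\prod_\omega A_i$. A function $f\in L^\infty(\mathbf{A})$ is measurable with respect to the Fourier $\sigma$-algebra $\mathcal{F}(\mathbf{A})$ if and only if there exist a second countable compact abelian group $A$, a continuous surjective measure preserving homomorphism $\phi:\mathbf{A}\to A$ and a function $h\in L^\infty(A)$ such that $f=h\circ\phi$ almost everywhere. Furthermore, in this case the Fourier transform $\hat h\in l^2(\hat A)$ is isomorphic to the Fourier transform $\hat f\in l^2(\hat{\mathbf{A}})$ (equivalently $d(h,\mathcal{Q}(f))=0$).
   Context: Compact abelian groups carry normalized Haar measure. $\mathbf{A}=\prod_\omega A_i$ is the ultraproduct group (sequences $(x_i)$, $x_i\in A_i$, modulo agreement on a set in $\omega$). For compact Hausdorff $T$ and $f_i:A_i\to T$, $\lim_\omega f_i$ is the function on $\mathbf{A}$ with value $\lim_\omega f_i(x_i)$ at the class of $(x_i)$. Strongly open sets are ultraproducts of open sets $S_i\subseteq A_i$; open sets are countable unions of strongly open sets; continuity of a map from $\mathbf{A}$ means preimages of open sets are open. The ultralimit measure $\mu$ on the $\sigma$-algebra generated by strongly open sets satisfies $\mu(\prod_\omega S_i)=\lim_\omega\mu_{A_i}(S_i)$; ''measure preserving'' for $\phi$ means $\mu(\phi^{-1}(S))$ equals the Haar measure of $S$ for Borel $S\subseteq A$. A linear character of $\mathbf{A}$ is a continuous homomorphism $\mathbf{A}\to\{|z|=1\}$; they form a group $\hat{\mathbf{A}}$.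 $\mathcal{F}(\mathbf{A})$ is the $\sigma$-algebra generated by linear characters. For $f\in L^2(\mathbf{A})$, $\hat f\in l^2(\hat{\mathbf{A}})$ is $\hat f(\chi)=\int f\overline{\chi}\,d\mu$. For a group $G$ and $f\in l^2(G)$, $\langle f\rangle$ is the subgroup generated by $\{g:f(g)\neq0\}$; $f_1\in l^2(G_1)$, $f_2\in l^2(G_2)$ are isomorphic if there is a group isomorphism $\alpha:\langle f_1\rangle\to\langle f_2\rangle$ with $f_1=f_2\circ\alpha$ on $\langle f_1\rangle$. $\mathcal{Q}(f)$ denotes the isomorphism class of functions on compact abelian groups whose Fourier transform is isomorphic to $\hat f$, and $d(f_1,f_2)=\hat d(\hat f_1,\hat f_2)$ where $\hat d(u,v)=0$ iff $u,v$ are isomorphic. *)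

(* Defs.v *)
From HB Require Import structures.
From mathcomp Require Import all_boot all_order all_algebra complex lra.
From mathcomp Require Import all_classical all_reals all_analysis.

Set Implicit Arguments.
Unset Strict Implicit.
Unset Printing Implicit Defensive.

Import Order.TTheory GRing.Theory Num.Theory.
Import numFieldNormedType.Exports.

Local Open Scope classical_set_scope.
Local Open Scope quotient_scope.
Local Open Scope ring_scope.

HB.mixin Record isCompactHausdorff A & Topological A := {
  compact_setT : compact [set: A];
  hausdorff_setT : hausdorff_space A
}.

#[short(type="compactAbGroupType")]
HB.structure Definition CompactAbGroup :=
  {A of TopologicalZmodule A & isCompactHausdorff A}.

(* The library generates sigma-algebras on pointed types only; the point plays
   no role. *)
Definition pointed_at0 (G : zmodType) : Type := G.
HB.instance Definition _ (G : zmodType) := Choice.on (pointed_at0 G).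
HB.instance Definition _ (G : zmodType) :=
  isPointed.Build (pointed_at0 G) (0 : G).

Notation generated G E := (@g_sigma_algebraType (pointed_at0 G) E).

Notation borel A := (generated A (@open A)).

(* Regularity is part of the definition of Haar measure; without it the measure
   need not be unique when A is not second countable. *)
Record is_haar (R : realType) (A : compactAbGroupType)
    (m : probability (borel A) R) : Prop := {
  haar_translation : forall (a : A) (S : set (borel A)), measurable S ->
    m [set a + x | x in (S : set A)] = m S;
  haar_outer_regular : forall S : set (borel A), measurable S ->
    m S = ereal_inf [set m U | U in [set U : set A | open U /\ S `<=` U]];
  haar_inner_regular : forall U : set A, open U ->
    m U = ereal_sup [set m K | K in [set K : set A | compact K /\ K `<=` U]]
}.

(* The open sets of an ultraproduct are only closed under countable unions. *)
Record sigma_topology (T : Type) := SigmaTopology {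
  sopen : set (set T);
  sopen0 : sopen set0;
  sopenT : sopen setT;
  sopenI : forall U V, sopen U -> sopen V -> sopen (U `&` V);
  sopen_bigcup : forall F : nat -> set T,
    (forall n, sopen (F n)) -> sopen (\bigcup_n F n)
}.

Definition scontinuous (T : Type) (X : sigma_topology T) (U : topologicalType)
    (f : T -> U) :=
  forall V : set U, open V -> sopen X (f @^-1` V).

Lemma open_bigcup_nat (T : topologicalType) (F : nat -> set T) :
  (forall n, open (F n)) -> open (\bigcup_n F n).
Proof. by move=> oF; apply: bigcup_open => n _; exact: oF. Qed.

Definition top_sigma (T : topologicalType) : sigma_topology T :=
  SigmaTopology open0 openT (@openI T) (@open_bigcup_nat T).

Record linear_character (R : realType) (G : zmodType) (X : sigma_topology G) :=
  LinearCharacter {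
    char_fun :> G -> R[i];
    charD : forall x y, char_fun (x + y) = char_fun x * char_fun y;
    char_norm : forall x, `|char_fun x| = 1;
    char_cont : scontinuous X (char_fun : G -> R[i]^o)
  }.

Section CharacterGroup.
Variables (R : realType) (G : zmodType) (X : sigma_topology G).
Implicit Types a b c : linear_character R X.

Lemma char_eqP a b : char_fun a =1 char_fun b -> a = b.
Proof.
case: a b => [a aD aN aC] [b bD bN bC] /= /funext ab; subst b.
by congr LinearCharacter; exact: Prop_irrelevance.
Qed.

HB.instance Definition _ := gen_eqMixin (linear_character R X).
HB.instance Definition _ := gen_choiceMixin (linear_character R X).

Lemma scontinuous_comp (T U : topologicalType) (f : G -> T) (g : T -> U) :
  scontinuous X f -> continuous g -> scontinuous X (g \o f).
Proof.
move=> fc /continuousP gc V oV; rewrite comp_preimage.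
by apply: fc; exact: gc.
Qed.

Lemma rat_dense_complex (z e : R[i]) : 0 < e ->
  exists p : rat * rat, `|z - Complex (ratr p.1) (ratr p.2)| < e.
Proof.
case: z => x y; case: e => e ei; rewrite ltcE /= => /andP[/eqP-> e0].
have e20 : 0 < e / 2 by rewrite divr_gt0.
have [p] : exists p : rat, ratr p \in `]x - e / 2, x + e / 2[.
  by apply: rat_in_itvoo; rewrite ltrD2l gtrN.
have [q] : exists p : rat, ratr p \in `]y - e / 2, y + e / 2[.
  by apply: rat_in_itvoo; rewrite ltrD2l gtrN.
rewrite !in_itv /= => /andP[q1 q2] /andP[p1 p2].
exists (p, q) => /=.
set u := x - ratr p; set v := y - ratr q.
have -> : Complex x y - Complex (ratr p) (ratr q) =
    Complex u 0 + Complex 0 v :> R[i].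
  by rewrite /u /v; simpc.
apply: le_lt_trans (ler_normD _ _) _.
have hu : `|u| < e / 2 by rewrite ltr_norml /u; apply/andP; split; lra.
have hv : `|v| < e / 2 by rewrite ltr_norml /v; apply/andP; split; lra.
rewrite !normc_def /= !expr0n /= addr0 add0r !sqrtr_sqr.
rewrite -rmorphD ltcR; lra.
Qed.

Let rball (p : rat * rat) (k : nat) : set R[i]^o :=
  ball (Complex (ratr p.1) (ratr p.2) : R[i]^o) (k.+1%:R^-1)%:C%C.

Lemma scontinuousM (f g : G -> R[i]) :
  scontinuous X (f : G -> R[i]^o) -> scontinuous X (g : G -> R[i]^o) ->
  scontinuous X ((fun x => f x * g x) : G -> R[i]^o).
Proof.
move=> fc gc V oV.
pose good (t : (rat * rat) * (rat * rat) * nat) :=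
  forall u v : R[i], rball t.1.1 t.2 u -> rball t.1.2 t.2 v -> V (u * v).
pose F n : set G := if unpickle n is Some t then
  if `[< good t >] then f @^-1` rball t.1.1 t.2 `&` g @^-1` rball t.1.2 t.2
  else set0 else set0.
have k0 k : 0 < (k.+1%:R^-1)%:C%C :> R[i] by rewrite ltcR invr_gt0.
have oball p k : open (rball p k) by exact: ball_open.
suff -> : (fun x => f x * g x) @^-1` V = \bigcup_n F n.
  apply: sopen_bigcup => n; rewrite /F.
  case: unpickle => [t|]; last exact: sopen0.
  case: ifP => _; last exact: sopen0.
  by apply: sopenI; [exact: fc|exact: gc].
apply/seteqP; split=> [x /= Vx|x [n _]]; last first.
  rewrite /F; case: unpickle => [t|] //.
  by case: ifP => // /asboolP gt [] /= fx gx; exact: gt.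
have nV : nbhs (f x * g x : R[i]^o) V by exact: open_nbhs_nbhs.
have [[U1 U2] /= [nU1 nU2] UV] := @mul_continuous R[i] (f x, g x) V nV.
move: nU1 nU2 => /nbhs_ballP[e1 /= e10 eU1] /nbhs_ballP[e2 /= e20 eU2].
have small (e : R[i]) : 0 < e -> exists k0, forall k, (k0 <= k)%N ->
    (k.+1%:R^-1)%:C%C *+ 2 < e.
  case: e => e ei; rewrite ltcE /= => /andP[/eqP-> e0].
  have [m] := ltr_add_invr (divr_gt0 e0 (ltr0Sn R 1)).
  rewrite add0r => me; exists m => k mk.
  rewrite -[X in X *+ 2]/(real_complex R _) -rmorphMn ltcR.
  have : k.+1%:R^-1 <= m.+1%:R^-1 :> R by rewrite lef_pV2 ?posrE// ler_nat.
  rewrite ltr_pdivlMr ?ltr0n// mulr_natr in me.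
  by rewrite -(ler_pMn2r (ltn0Sn 1)) => /le_lt_trans; apply.
have [k1 sk1] := small _ e10; have [k2 sk2] := small _ e20.
pose k := maxn k1 k2.
have [p pf] := rat_dense_complex (f x) (k0 k).
have [q qg] := rat_dense_complex (g x) (k0 k).
have near (r : rat * rat) (y e : R[i]) (U : set R[i]^o) :
    (k.+1%:R^-1)%:C%C *+ 2 < e -> ball (y : R[i]^o) e `<=` U ->
    `|y - Complex (ratr r.1) (ratr r.2)| < (k.+1%:R^-1)%:C%C ->
    rball r k `<=` U.
  move=> ke yU yr u ru; apply: yU; move: ru; rewrite /rball -!ball_normE /= => ru.
  apply: lt_trans ke; rewrite mulr2n.
  exact: le_lt_trans (ler_distD _ _ _) (ltrD yr ru).
have gk : good (p, q, k).
  move=> u v /= pu qv; apply: (UV (u, v)); split => /=.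
    exact: (near p (f x) e1 U1 (sk1 k (leq_maxl _ _)) eU1 pf _ pu).
  exact: (near q (g x) e2 U2 (sk2 k (leq_maxr _ _)) eU2 qg _ qv).
have Fx : (f @^-1` rball p k `&` g @^-1` rball q k) x.
  by split; rewrite /= /rball -ball_normE /= distrC.
have [n Fn] : exists n, unpickle n = Some (p, q, k).
  by exists (pickle (p, q, k)); exact: pickleK.
by exists n; [exact: I|rewrite /F Fn asboolT].
Qed.

Lemma char_one_cont : scontinuous X ((fun=> 1) : G -> R[i]^o).
Proof.
move=> V oV; rewrite preimage_cst.
by case: ifP => _; [exact: sopenT|exact: sopen0].
Qed.

Definition char_one : linear_character R X :=
  LinearCharacter (fun _ _ => esym (mulr1 1)) (fun=> normr1 _) char_one_cont.

Lemma char_mulD a b x y :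
  a (x + y) * b (x + y) = (a x * b x) * (a y * b y).
Proof. by rewrite !charD mulrACA. Qed.

Lemma char_mul_norm a b x : `|a x * b x| = 1.
Proof. by rewrite normrM !char_norm mulr1. Qed.

Definition char_mul a b : linear_character R X :=
  LinearCharacter (char_mulD a b) (char_mul_norm a b)
    (scontinuousM (@char_cont _ _ _ a) (@char_cont _ _ _ b)).

Lemma char_convD a x y : (a (x + y))^* = (a x)^* * (a y)^*.
Proof. by rewrite charD rmorphM. Qed.

Lemma char_conj_norm a x : `|(a x)^*| = 1.
Proof. by rewrite norm_conjC char_norm. Qed.

Lemma char_conj_cont a : scontinuous X ((fun x => (a x)^*) : G -> R[i]^o).
Proof.
apply: (@scontinuous_comp R[i]^o R[i]^o a (fun z => z^* : R[i]^o)).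
  exact: char_cont.
move=> z U /nbhs_ballP[e /= e0 eU]; apply/nbhs_ballP; exists e => //= w.
rewrite -ball_normE /= => zw; apply: eU.
by rewrite -ball_normE /= -rmorphB norm_conjC.
Qed.

Definition char_conj a : linear_character R X :=
  LinearCharacter (char_convD a) (char_conj_norm a) (@char_conj_cont a).

Lemma char_mulA : associative char_mul.
Proof. by move=> a b c; apply: char_eqP => x /=; rewrite mulrA. Qed.
Lemma char_mulC : commutative char_mul.
Proof. by move=> a b; apply: char_eqP => x /=; rewrite mulrC. Qed.
Lemma char_mul1 : left_id char_one char_mul.
Proof. by move=> a; apply: char_eqP => x /=; rewrite mul1r. Qed.
Lemma char_mulV : left_inverse char_one char_conj char_mul.
Proof.
move=> a; apply: char_eqP => x /=.
by rewrite mulrC -normCK char_norm expr1n.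
Qed.

(* The dual group, written additively. *)
HB.instance Definition _ := GRing.isZmodule.Build (linear_character R X)
  char_mulA char_mulC char_mul1 char_mulV.

End CharacterGroup.

(* The ultraproduct is the quotient of the group of all sequences by those vanishing on a set
   in omega. *)
Definition seqs (A : nat -> compactAbGroupType) : Type := forall i, A i.

Section Ultraproduct.
Variables (omega : set_system nat) (Uomega : UltraFilter omega).

Variable A : nat -> compactAbGroupType.

HB.instance Definition _ := gen_eqMixin (seqs A).
HB.instance Definition _ := gen_choiceMixin (seqs A).

Lemma seqs_addA : associative (fun (x y : seqs A) i => x i + y i).
Proof. by move=> x y z; apply: functional_extensionality_dep => i; exact: addrA. Qed.
Lemma seqs_addC : commutative (fun (x y : seqs A) i => x i + y i).
Proof. by move=> x y; apply: functional_extensionality_dep => i; exact: addrC. Qed.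
Lemma seqs_add0 : left_id (fun i => 0) (fun (x y : seqs A) i => x i + y i).
Proof. by move=> x; apply: functional_extensionality_dep => i; exact: add0r. Qed.
Lemma seqs_addN :
  left_inverse (fun i => 0) (fun (x : seqs A) i => - x i)
    (fun (x y : seqs A) i => x i + y i).
Proof. by move=> x; apply: functional_extensionality_dep => i; exact: addNr. Qed.

HB.instance Definition _ := GRing.isZmodule.Build (seqs A)
  seqs_addA seqs_addC seqs_add0 seqs_addN.

Definition eventually0 : {pred seqs A} :=
  fun x => `[< omega [set i | x i = 0] >].

Lemma eventually0_zmod : zmod_closed eventually0.
Proof.
split=> [|x y /asboolP x0 /asboolP y0]; apply/asboolP.
  by apply: filterS (@filterT _ omega _) => i _.
apply: filterS2 x0 y0 => i /= {}x0 {}y0.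
by have -> : (x - y) i = x i - y i by []; rewrite x0 y0 subr0.
Qed.

HB.instance Definition _ :=
  GRing.isZmodClosed.Build (seqs A) eventually0 eventually0_zmod.

Definition ultraprod : Type := Quotient.quot eventually0.
HB.instance Definition _ := GRing.Zmodule.on ultraprod.

Definition uclass (x : seqs A) : ultraprod := \pi_(Quotient.quot eventually0) x.

Lemma uclassE (x y : seqs A) :
  uclass x = uclass y <-> omega [set i | x i = y i].
Proof.
have -> : uclass x = uclass y <-> eventually0 (x - y).
  split=> [/eqP|xy]; first by rewrite -Quotient.idealrBE.
  by apply/eqP; rewrite -Quotient.idealrBE.
rewrite /eventually0; split=> [/asboolP|] h; last apply/asboolP.
  by apply: filterS h => i /= /subr0_eq.
by apply: filterS h => i /= xy; have -> : (x - y) i = x i - y i by [];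
  rewrite xy subrr.
Qed.

(* Membership is only required on a set in omega, so that finitely many empty
   factors do not empty the ultraproduct. *)
Definition uprod (S : forall i, set (A i)) : set ultraprod :=
  uclass @` [set x | omega [set i | S i (x i)]].

Definition strongly_open : set (set ultraprod) :=
  [set U | exists2 S : forall i, set (A i),
    (forall i, open (S i)) & U = uprod S].

Definition uopen : set (set ultraprod) :=
  [set U | exists2 F : nat -> set ultraprod,
    (forall n, strongly_open (F n)) & U = \bigcup_n F n].

Lemma uprodP S x : uprod S (uclass x) <-> omega [set i | S i (x i)].
Proof.
split=> [[y yS /uclassE yx]|xS]; last by exists x.
by apply: filterS2 yS yx => i /= ? <-.
Qed.

Lemma uclass_surj z : exists x, z = uclass x.
Proof. by exists (repr z); rewrite /uclass reprK. Qed.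

Lemma strongly_openI U V :
  strongly_open U -> strongly_open V -> strongly_open (U `&` V).
Proof.
move=> [S oS ->] [T oT ->]; exists (fun i => S i `&` T i).
  by move=> i; exact: openI.
apply/seteqP; split=> z; have [x ->] := uclass_surj z.
  by move=> [/uprodP xS /uprodP xT]; apply/uprodP; apply: filterS2 xS xT.
by move=> /uprodP xST; split; apply/uprodP; apply: filterS xST => i [].
Qed.

Lemma strongly_open_uopen U : strongly_open U -> uopen U.
Proof. by move=> sU; exists (fun=> U); rewrite ?bigcup_const//; exists 0. Qed.

Lemma uopen_bigcup (F : nat -> set ultraprod) :
  (forall n, uopen (F n)) -> uopen (\bigcup_n F n).
Proof.
move=> uF.
have /choice[G GF] n : exists G : nat -> set ultraprod,
    (forall m, strongly_open (G m)) /\ F n = \bigcup_m G m.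
  by have [G sG ->] := uF n; exists G.
have s0 : strongly_open set0.
  exists (fun=> set0); first by move=> i; exact: open0.
  apply/seteqP; split=> // z; have [x ->] := uclass_surj z.
  by move=> /uprodP /=; exact: filter_not_empty.
exists (fun k => if unpickle k is Some p then G p.1 p.2 else set0).
  by move=> k; case: unpickle => // p; exact: (GF _).1.
apply/seteqP; split=> [z [n _]|z [k _]].
  rewrite (GF n).2 => -[m _ Gz]; exists (pickle (n, m)) => //.
  by rewrite pickleK.
case: unpickle => [[n m] /= Gz|//]; exists n => //.
by rewrite (GF n).2; exists m.
Qed.

Lemma uopen0 : uopen set0.
Proof.
apply: strongly_open_uopen; exists (fun=> set0); first by move=> i; exact: open0.
apply/seteqP; split=> // z; have [x ->] := uclass_surj z.
by move=> /uprodP /=; exact: filter_not_empty.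
Qed.

Lemma uopenT : uopen setT.
Proof.
apply: strongly_open_uopen; exists (fun=> setT); first by move=> i; exact: openT.
apply/seteqP; split=> // z _; have [x ->] := uclass_surj z.
by apply/uprodP; exact: filterT.
Qed.

Lemma uopenI U V : uopen U -> uopen V -> uopen (U `&` V).
Proof.
move=> [F sF ->] [F' sF' ->]; rewrite setI_bigcupl; apply: uopen_bigcup => n.
rewrite setI_bigcupr; exists (fun m => F n `&` F' m) => // m.
exact: strongly_openI.
Qed.

Definition ultra_sigma : sigma_topology ultraprod :=
  SigmaTopology uopen0 uopenT uopenI uopen_bigcup.

(* This determines mu, since the strongly open sets are closed under finite
   intersections. *)
Definition is_ultralimit_measure (R : realType)
    (m : forall i, probability (borel (A i)) R)
    (mu : {measure set (generated ultraprod strongly_open) -> \bar R}) :=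
  forall S : forall i, set (A i), (forall i, open (S i)) ->
    (fun i => m i (S i)) @ omega --> mu (uprod S).

End Ultraproduct.

Section ComplexFunctions.
Variables (R : realType) (d : measure_display) (T : measurableType d).

Definition cmeasurable (f : T -> R[i]) :=
  measurable_fun [set: T] (fun x => complex.Re (f x)) /\
  measurable_fun [set: T] (fun x => complex.Im (f x)).

Variable mu : {measure set T -> \bar R}.

Definition cLfun (p : \bar R) (f : T -> R[i]) :=
  cmeasurable f /\ finite_norm mu p (fun x => Normc.normc (f x)).

Definition cintegral (f : T -> R[i]) : R[i] :=
  Complex (\int[mu]_x complex.Re (f x)) (\int[mu]_x complex.Im (f x)).

End ComplexFunctions.

Definition fourier (R : realType) (G : zmodType) (X : sigma_topology G)
    (E : set (set G)) (mu : {measure set (generated G E) -> \bar R})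
    (f : G -> R[i]) (chi : linear_character R X) : R[i] :=
  cintegral mu (fun x => f x * (chi x)^*).

Definition fourier_generators (R : realType) (G : zmodType)
    (X : sigma_topology G) : set (set G) :=
  [set U | exists (chi : linear_character R X) (V : set R[i]^o),
    open V /\ U = chi @^-1` V].

(* Elements of L^oo are classes modulo null sets, so measurability asks for a
   measurable representative. *)
Definition fourier_measurable (R : realType) (G : zmodType)
    (X : sigma_topology G) (E : set (set G))
    (mu : {measure set (generated G E) -> \bar R}) (f : G -> R[i]) :=
  exists2 g : G -> R[i],
    @cmeasurable R _ (generated G (fourier_generators R X)) g &
    {ae mu, forall x, f x = g x}.

Definition square_summable (R : realType) (G : choiceType) (u : G -> R[i]) :=
  (\esum_(g in [set: G]) (Normc.normc (u g) ^+ 2)%:E < +oo)%E.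

Definition is_subgroup (G : zmodType) (H : set G) :=
  H 0 /\ forall x y, H x -> H y -> H (x - y).

Definition support_group (R : realType) (G : zmodType) (u : G -> R[i]) : set G :=
  smallest (@is_subgroup G) [set g | u g != 0].

Definition isomorphic (R : realType) (G1 G2 : zmodType)
    (u : G1 -> R[i]) (v : G2 -> R[i]) :=
  exists alpha : G1 -> G2,
    [/\ set_bij (support_group u) (support_group v) alpha,
        forall x y, support_group u x -> support_group u y ->
          alpha (x + y) = alpha x + alpha y &
        forall x, support_group u x -> u x = v (alpha x)].

(* dhat stands for a metric on l^2 functions on abelian groups, used only through
   its zero set: distance 0 means isomorphic. *)
Definition detects_isomorphism (R : realType)
    (dhat : forall G1 G2 : zmodType, (G1 -> R[i]) -> (G2 -> R[i]) -> R) :=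
  forall (G1 G2 : zmodType) (u : G1 -> R[i]) (v : G2 -> R[i]),
    square_summable u -> square_summable v ->
    dhat G1 G2 u v = 0 <-> isomorphic u v.

Definition haar_fourier (R : realType) (B : compactAbGroupType)
    (m : probability (borel B) R) (h : B -> R[i]) :
    linear_character R (top_sigma B) -> R[i] :=
  fourier m h.

Definition in_isomorphism_class (R : realType) (G : zmodType) (u : G -> R[i])
    (B : compactAbGroupType) (m : probability (borel B) R) (g : B -> R[i]) :=
  [/\ is_haar m, cLfun m 2%:E g & isomorphic (haar_fourier m g) u].

(* r is the common distance from h to all members of the (nonempty) class of
   functions whose Fourier transform is isomorphic to u. *)
Definition distance_to_class (R : realType)
    (dhat : forall G1 G2 : zmodType, (G1 -> R[i]) -> (G2 -> R[i]) -> R)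
    (G : zmodType) (u : G -> R[i])
    (B : compactAbGroupType) (m : probability (borel B) R) (h : B -> R[i])
    (r : R) :=
  [set s | exists (C : compactAbGroupType) (n : probability (borel C) R)
      (g : C -> R[i]), in_isomorphism_class u n g /\
      s = dhat _ _ (haar_fourier m h) (haar_fourier n g)] = [set r].

Record factorization (R : realType) (omega : set_system nat)
    (Uomega : UltraFilter omega) (A : nat -> compactAbGroupType)
    (mu : {measure set (generated (ultraprod Uomega A)
                          (@strongly_open omega Uomega A)) -> \bar R})
    (f : ultraprod Uomega A -> R[i])
    (B : compactAbGroupType) (m : probability (borel B) R)
    (phi : ultraprod Uomega A -> B) (h : B -> R[i]) : Prop := {
  fact_second_countable : @second_countable B;
  fact_haar : is_haar m;
  fact_morphism : forall x y, phi (x + y) = phi x + phi y;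
  fact_continuous : scontinuous (ultra_sigma Uomega A) phi;
  fact_surjective : forall b, exists x, phi x = b;
  fact_measure_preserving : forall S : set (borel B), measurable S ->
    mu (phi @^-1` S) = m S;
  fact_Linfty : cLfun m +oo%E h;
  fact_ae : {ae mu, forall x, f x = h (phi x)}
}.

(* Main.v *)
Require Import Defs.
From HB Require Import structures.
From mathcomp Require Import all_boot all_order all_algebra complex ring lra zify.
From mathcomp Require Import all_classical all_reals all_analysis.
From mathcomp Require Import measurable_realfun ess_sup_inf.

(** Write [G] for the ultraproduct. A function measurable for the Fourier
sigma-algebra depends, up to a null set, on countably many characters [chi_n].
Countable saturation of the ultraproduct makes the range of [(chi_n)_n] closed
in the product of circles, so the quotient of [G] by the common kernel is a
second countable compact group, and the image of [mu] is its Haar measure; the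
function then factors by Doob-Dynkin.

Conversely, one needs that the characters of a second countable compact group
[B] separate points. Given [b != 0], take [v] continuous and even with
[v b != v 0] and convolve with [u = v(. - b) + v(. + b) - 2v]. The normalized
even convolution powers of [u] converge to an idempotent kernel [g] with
[u * u * g = l g] and [l > 0]. A minimal idempotent [e] below [g] satisfies
[e(x - a) + e(x + a) = s(a) e(x)], so [e / e 0] solves d'Alembert's equation
and is the real part of a character [chi]; since [u * e != 0], [chi b != 1].
Everything here involves real functions only.

Finally [chi |-> chi o phi] identifies the dual of [B] with the characters of
[G] that are trivial on the kernel of [phi] (continuity again by saturation), and
the other Fourier coefficients of [f] vanish since [f] is [ker phi]-invariant. *)

Set Implicit Arguments.
Unset Strict Implicit.
Unset Printing Implicit Defensive.

Import Order.TTheory GRing.Theory Num.Theory.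
Import numFieldNormedType.Exports.
Import Normc.

Local Open Scope classical_set_scope.
Local Open Scope ring_scope.

(** Saturation takes its place, and it handles countably many conditions at a time. Second
    countability of [B] enters in three ways: open sets of [B * B] belong to the product
    sigma-algebra, which Fubini needs; regularity of a Borel probability becomes automatic; points
    are pinned down by countably many basic sets.

    The converse needs separating characters because [h] is merely Borel: its pullback is Fourier
    measurable once the characters of [B] generate the Borel sets. Power iteration stands in for the
    spectral theorem of compact symmetric operators; an invariant mean on continuous functions,
    Cauchy-Schwarz and uniform limits suffice for it. Even kernels have real eigenvalues but cannot
    tell [chi] from its conjugate: a minimal even idempotent is [chi + chi^*], or [chi] itself if
    real. Hence the construction delivers a cosine, and the sine has to be recovered from it. *)

Section GroupContinuity.
Variables (B : compactAbGroupType) (T : topologicalType).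
Implicit Types u v : T -> B.

Lemma continuous_addg u v :
  continuous u -> continuous v -> continuous (fun t => u t + v t).
Proof.
move=> cu cv t.
apply: (@cvg_comp _ _ _ (fun t => (u t, v t)) (fun p : B * B => p.1 + p.2)
  _ (nbhs (u t, v t))); last exact: (@add_continuous B (u t, v t)).
by apply: cvg_pair; [exact: cu|exact: cv].
Qed.

Lemma continuous_oppg u : continuous u -> continuous (fun t => - u t).
Proof.
move=> cu t; apply: (@cvg_comp _ _ _ u (fun p : B => - p) _ (nbhs (u t))).
  exact: cu.
exact: (@opp_continuous B (u t)).
Qed.

Lemma continuous_subg u v :
  continuous u -> continuous v -> continuous (fun t => u t - v t).
Proof. by move=> cu cv; apply: continuous_addg => //; exact: continuous_oppg. Qed.

Lemma continuous_compT (U V : topologicalType) (f : T -> U) (g : U -> V) :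
  continuous f -> continuous g -> continuous (fun t => g (f t)).
Proof. by move=> cf cg t; apply: continuous_comp; [exact: cf|exact: cg]. Qed.

End GroupContinuity.

Lemma continuous_dist_le (R : realType) (T : topologicalType) (f : T -> R) x :
  (forall e : R, 0 < e -> \forall z \near x, `|f x - f z| <= e) ->
  {for x, continuous f}.
Proof. by move=> fx; apply/cvgrPdist_le. Qed.

(** The Haar integral reduced to what the convolution algebra uses: [mean_gt0] is full support and
    [mean_exchange] is Fubini. Measurability is met only when the mean is instantiated. *)
Record invariant_mean (R : realType) (B : compactAbGroupType)
    (I : (B -> R) -> R) : Prop := {
  mean_linear : forall (a : R) (f g : B -> R), continuous f -> continuous g ->
    I (fun x => a * f x + g x) = a * I f + I g;
  mean_ge0 : forall f : B -> R, continuous f -> (forall x, 0 <= f x) -> 0 <= I f;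
  mean_gt0 : forall (f : B -> R) x, continuous f -> (forall x, 0 <= f x) ->
    0 < f x -> 0 < I f;
  mean_1 : I (fun=> 1) = 1;
  mean_translate : forall (a : B) (f : B -> R), continuous f ->
    I (fun x => f (a + x)) = I f;
  mean_exchange : forall F : B -> B -> R,
    continuous (fun p : B * B => F p.1 p.2) ->
    I (fun x => I (fun y => F x y)) = I (fun y => I (fun x => F x y))
}.

(** * Convolution of continuous functions under an invariant mean *)

Section Convolution.
Variables (R : realType) (B : compactAbGroupType) (I : (B -> R) -> R).
Hypothesis I_mean : invariant_mean I.

Record cfun := CFun { cfun_fun :> B -> R; cfun_cont : continuous cfun_fun }.

Lemma cfunP (f g : cfun) : f =1 g -> f = g.
Proof.
case: f g => f cf [g cg] /= /funext fg; subst g.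
by congr CFun; exact: Prop_irrelevance.
Qed.

Implicit Types (f g h k : cfun) (x y z : B) (a : R).

Let cst_cont a : continuous (fun _ : B => a).
Proof. by move=> x; exact: cvg_cst. Qed.

Let mul_cont (T : topologicalType) (f g : T -> R) :
  continuous f -> continuous g -> continuous (fun t => f t * g t).
Proof. by move=> cf cg t; apply: cvgM; [exact: cf|exact: cg]. Qed.

Let lin_cont a (f g : B -> R) :
  continuous f -> continuous g -> continuous (fun x => a * f x + g x).
Proof.
move=> cf cg x; apply: (@cvgD _ R^o); last exact: cg.
by apply: cvgM; [exact: cvg_cst|exact: cf].
Qed.

Definition clin a f g : cfun :=
  CFun (@lin_cont a f g (@cfun_cont f) (@cfun_cont g)).
Definition czero : cfun := CFun (@cst_cont 0).

Let id_cont : continuous (fun x : B => x). Proof. by move=> x; exact: cvg_id. Qed.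

Let refl_cont f x : continuous (fun y => f (x - y)).
Proof.
apply: (@continuous_compT _ _ _ (fun y => x - y) f); last exact: cfun_cont.
by apply: continuous_subg => // y; exact: cvg_cst.
Qed.

Definition creflect x f : cfun := CFun (@refl_cont f x).

Let cmul_cont f g : continuous (fun y => f y * g y).
Proof. by apply: mul_cont; exact: cfun_cont. Qed.
Definition cmul f g : cfun := CFun (@cmul_cont f g).

Let cabs_cont f : continuous (fun y => `|f y|).
Proof.
move=> x; apply: (@cvg_norm _ R^o); exact: cfun_cont.
Qed.
Definition cabs f : cfun := CFun (@cabs_cont f).

Lemma meanZ a f : I (fun x => a * f x) = a * I f.
Proof.
have I0 : I (fun=> 0) = 0.
  transitivity (-1 * I (fun=> 1) + I (fun=> 1)); last by rewrite mulN1r addNr.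
  rewrite -(mean_linear I_mean (-1) (@cst_cont 1) (@cst_cont 1)).
  by congr I; apply/funext => x; rewrite mulN1r addNr.
rewrite -[RHS]addr0 -I0 -(mean_linear I_mean a (@cfun_cont f) (@cst_cont 0)).
by congr I; apply/funext => x; rewrite addr0.
Qed.

Lemma meanD f g : I (fun x => f x + g x) = I f + I g.
Proof.
rewrite -[I f in RHS]mul1r -(mean_linear I_mean 1 (@cfun_cont f) (@cfun_cont g)).
by congr I; apply/funext => x; rewrite mul1r.
Qed.

Lemma le_mean f g : (forall x, f x <= g x) -> I f <= I g.
Proof.
move=> fg; have : 0 <= I (clin (-1) f g).
  by apply: (mean_ge0 I_mean) => [|x /=]; [exact: cfun_cont|rewrite mulN1r addrC subr_ge0].
by rewrite (mean_linear I_mean) ?mulN1r 1?addrC ?subr_ge0//; exact: cfun_cont.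
Qed.

Lemma mean_cst a : I (fun=> a) = a.
Proof.
transitivity (a * I (fun=> 1)); last by rewrite (mean_1 I_mean) mulr1.
by rewrite -(meanZ a (CFun (@cst_cont 1))); congr I; apply/funext => x; rewrite mulr1.
Qed.

(** Average [f (x - y)] over both variables: one order of integration yields the mean of the
    reflected function, the other the mean of [f]. *)
Lemma mean_opp f : I (fun x => f (- x)) = I f.
Proof.
pose f' := creflect 0 f.
have f'E : f' =1 (fun x => f (- x)) by move=> x /=; rewrite sub0r.
have cF : continuous (fun p : B * B => f (p.1 - p.2)).
  apply: (@continuous_compT _ _ _ (fun p : B * B => p.1 - p.2) f).
    exact: sub_continuous.
  exact: cfun_cont.
have := @mean_exchange _ _ _ I_mean (fun x y => f (x - y)) cF.
have -> : (fun x => I (fun y => f (x - y))) = fun=> I f'.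
  apply/funext => x; rewrite -(mean_translate I_mean (- x) (@cfun_cont f')).
  by congr I; apply/funext => y; rewrite f'E opprD opprK.
have -> : (fun y => I (fun x => f (x - y))) = fun=> I f.
  apply/funext => y; rewrite -(mean_translate I_mean (- y) (@cfun_cont f)).
  by congr I; apply/funext => x; rewrite addrC.
by rewrite !mean_cst => <-; congr I; apply/funext => x; rewrite f'E.
Qed.

Lemma mean_reflect x f : I (fun y => f (x - y)) = I f.
Proof.
rewrite -[RHS]mean_opp.
rewrite -(mean_translate I_mean (- x) (f := fun y => f (- y))); last first.
  by have := @cfun_cont (creflect 0 f); rewrite /= (_ : (fun y => f (0 - y)) = fun y => f (- y))//;
    apply/funext => y; rewrite sub0r.
by congr I; apply/funext => y; rewrite opprD opprK.
Qed.

(** Compactness in its near-covering form makes continuity at [w = 0] uniform in [y]. *)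
Lemma unif_continuous_translate f (e : R) : 0 < e ->
  \forall w \near (0 : B), forall y, `|f (w + y) - f y| < e.
Proof.
move=> e0.
have := @compact_setT B => /compact_near_coveringP.
move=> /(_ _ (nbhs (0 : B)) (fun w y => `|f (w + y) - f y| < e) _) H.
suff : \forall w \near (0 : B), [set: B] `<=` (fun y => `|f (w + y) - f y| < e).
  by apply: filterS => w h y; exact: h.
apply: H => y _.
have cD : {for (y, 0 : B), continuous (fun p : B * B => f (p.2 + p.1) - f p.1)}.
  apply: (@cvgB _ R^o).
    apply: (@continuous_compT _ _ _ (fun p : B * B => p.2 + p.1) f); last exact: cfun_cont.
    by apply: continuous_addg => p; [exact: cvg_snd|exact: cvg_fst].
  by apply: (@continuous_compT _ _ _ (fun p : B * B => p.1) f) => [p|];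
    [exact: cvg_fst|exact: cfun_cont].
have h : filter_prod (nbhs y) (nbhs (0 : B)) ((fun p : B * B => f (p.2 + p.1) - f p.1) @^-1`
    (ball (f (0 + y) - f y : R^o) e)) := cD _ (nbhsx_ballx _ _ e0).
apply: (@filterS _ (filter_prod (nbhs y) (nbhs (0 : B))) _ _ _ _ h) => -[z w] /=.
by rewrite /ball/= add0r subrr sub0r normrN.
Qed.

Definition conv_fun f g : B -> R := fun x => I (fun y => f y * g (x - y)).

Lemma conv_cont f g : continuous (conv_fun f g).
Proof.
move=> x; apply: continuous_dist_le => e e0.
pose M := I (cabs f).
have M0 : 0 <= M by apply: (mean_ge0 I_mean); [exact: cfun_cont|move=> z /=].
(* [M + 1] rather than [M], which is 0 when [f] vanishes. *)
pose d := e / (M + 1).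
have d0 : 0 < d by rewrite divr_gt0// ltr_wpDl.
have nx : (fun z : B => z - x) @ x --> (0 : B).
  rewrite -[X in _ --> X](subrr x).
  exact: (@continuous_subg B B (fun z => z) (fun=> x) id_cont (fun z => cvg_cst _) x).
have := nx _ (unif_continuous_translate g d0); rewrite /nbhs/=.
move=> h; apply: (@filterS _ (nbhs x) _ _ _ _ h) => z /= gz.
have -> : conv_fun f g x - conv_fun f g z =
    I (clin (-1) (cmul f (creflect z g)) (cmul f (creflect x g))).
  by rewrite (mean_linear I_mean) ?mulN1r 1?addrC//; exact: cfun_cont.
apply: (@le_trans _ _ (d * M)); last first.
  rewrite /d mulrAC -mulrA ler_piMr// ?(ltW e0)//.
  by rewrite ler_pdivrMr ?mul1r ?lerDl// ltr_wpDl.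
rewrite -(meanZ d (cabs f)).
have bnd y : `|- 1 * (f y * g (z - y)) + f y * g (x - y)| <= d * `|f y|.
  rewrite mulN1r addrC -mulrBr normrM mulrC ler_wpM2r// distrC.
  by have := gz (x - y); rewrite addrA subrK => /ltW.
rewrite ler_norml -(mulN1r (I (fun x => d * _))).
have E : -1 * I (fun x => d * cabs f x) = I (clin (- d) (cabs f) czero).
  rewrite (mean_linear I_mean); [|exact: cfun_cont..].
  by rewrite (mean_cst 0) addr0 meanZ mulN1r mulNr.
rewrite E; apply/andP; split.
  apply: le_mean => y /=; have := bnd y; rewrite ler_norml => /andP[b1 b2].
  lra.
have E' : I (fun x => d * cabs f x) = I (clin d (cabs f) czero).
  by congr I; apply/funext => y /=; rewrite addr0.
rewrite E'; apply: le_mean => y /=; have := bnd y; rewrite ler_norml => /andP[b1 b2].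
lra.
Qed.

Definition conv f g : cfun := CFun (@conv_cont f g).

Lemma convC f g : conv f g = conv g f.
Proof.
apply: cfunP => x /=; rewrite /conv_fun.
rewrite -(mean_reflect x (cmul f (creflect x g))) /=.
by congr I; apply/funext => y; rewrite mulrC subKr.
Qed.

Lemma conv_linl a f g h : conv (clin a f g) h = clin a (conv f h) (conv g h).
Proof.
apply: cfunP => x /=; rewrite /conv_fun.
rewrite -(mean_linear I_mean a (@cfun_cont (cmul f (creflect x h)))
  (@cfun_cont (cmul g (creflect x h)))).
by congr I; apply/funext => y /=; rewrite mulrDl mulrA.
Qed.

Lemma conv_linr a f g h : conv h (clin a f g) = clin a (conv h f) (conv h g).
Proof. by rewrite convC conv_linl !(convC _ h). Qed.

Lemma convA f g h : conv (conv f g) h = conv f (conv g h).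
Proof.
apply: cfunP => x /=; rewrite /conv_fun.
have cF : continuous (fun p : B * B => f p.2 * g (p.1 - p.2) * h (x - p.1)).
  have c1 : continuous (fun p : B * B => p.1) by move=> p; exact: cvg_fst.
  have c2 : continuous (fun p : B * B => p.2) by move=> p; exact: cvg_snd.
  apply: mul_cont; first apply: mul_cont.
  - exact: (@continuous_compT _ _ _ _ f c2 (@cfun_cont f)).
  - by apply: (@continuous_compT _ _ _ _ g _ (@cfun_cont g)); exact: sub_continuous.
  - apply: (@continuous_compT _ _ _ _ h _ (@cfun_cont h)).
    by apply: continuous_subg => // p; exact: cvg_cst.
have := @mean_exchange _ _ _ I_mean (fun y z => f z * g (y - z) * h (x - y)) cF.
have -> : (fun y => I (fun z => f z * g (y - z) * h (x - y))) =
    (fun y => conv_fun f g y * h (x - y)).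
  apply/funext => y; rewrite mulrC -(meanZ _ (cmul f (creflect y g))).
  by congr I; apply/funext => z /=; rewrite mulrC.
move=> ->; congr I; apply/funext => z.
rewrite -(meanZ _ (cmul g (creflect (x - z) h))) /=.
have ct : continuous (fun y => f z * (g y * h (x - z - y))).
  apply: mul_cont; first exact: cst_cont.
  exact: (@cfun_cont (cmul g (creflect (x - z) h))).
rewrite -(mean_translate I_mean (- z) ct).
congr I; apply/funext => y; rewrite mulrA [- z + y]addrC; congr (_ * h _).
by rewrite opprB addrA addrNK.
Qed.

Definition ip f g := I (fun x => f x * g x).

Lemma ip_ge0 f : 0 <= ip f f.
Proof.
apply: (mean_ge0 I_mean); first exact: cmul_cont.
by move=> x; rewrite -expr2 sqr_ge0.
Qed.

Lemma ip_gt0 f x : f x != 0 -> 0 < ip f f.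
Proof.
move=> fx; apply: (mean_gt0 I_mean (x := x)); first exact: cmul_cont.
  by move=> y; rewrite -expr2 sqr_ge0.
by rewrite lt_def mulf_neq0//= -expr2 sqr_ge0.
Qed.

Lemma ip_lin a f g : ip (clin a f g) (clin a f g) =
  a ^+ 2 * ip f f + 2 * a * ip f g + ip g g.
Proof.
transitivity (I (clin (a ^+ 2) (cmul f f) (clin (2 * a) (cmul f g) (cmul g g)))).
  by congr I; apply/funext => x /=; ring.
rewrite (mean_linear I_mean); [|exact: cfun_cont..].
rewrite (mean_linear I_mean); [|exact: cfun_cont..].
by rewrite addrA.
Qed.

Lemma cauchy_schwarz f g : ip f g ^+ 2 <= ip f f * ip g g.
Proof.
have H t : 0 <= t ^+ 2 * ip f f + 2 * t * ip f g + ip g g.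
  by rewrite -ip_lin ip_ge0.
have := ip_ge0 f; rewrite le_eqVlt => /orP[/eqP f0|f0].
  rewrite -f0 mul0r; have [->|fg0] := eqVneq (ip f g) 0; first by rewrite expr0n.
  (* With [ip f f = 0] the quadratic is affine in [t], and this [t] would give it the value -1. *)
  have := H (- (ip g g + 1) / (2 * ip f g)).
  rewrite -f0 mulr0 add0r (_ : 2 * _ * _ = - (ip g g + 1)); last by field.
  by rewrite opprD addrAC addNr add0r oppr_ge0 ler10.
have := H (- ip f g / ip f f).
rewrite (_ : _ + ip g g = (ip f f * ip g g - ip f g ^+ 2) / ip f f); last first.
  by field; exact: lt0r_neq0.
by rewrite pmulr_lge0 ?invr_gt0// subr_ge0.
Qed.

Definition even f := forall x, f (- x) = f x.

Lemma even_lin a f g : even f -> even g -> even (clin a f g).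
Proof. by move=> ef eg x /=; rewrite ef eg. Qed.

Lemma even_conv f g : even f -> even g -> even (conv f g).
Proof.
move=> ef eg x /=; rewrite /conv_fun -(mean_opp (cmul f (creflect (- x) g))) /=.
by congr I; apply/funext => y /=; rewrite ef -[in LHS]eg opprB opprK addrC.
Qed.

(** Inner products become values at 0, so identities of the convolution algebra turn into identities
    between inner products. *)
Lemma conv0 f g : even g -> conv f g 0 = ip f g.
Proof.
by move=> eg /=; congr I; apply/funext => x /=; rewrite sub0r eg.
Qed.

(** The passage from mean-square to uniform estimates: a convolution is bounded everywhere by the
    two L^2 norms. *)
Lemma conv_sqr_le f g x : conv f g x ^+ 2 <= ip f f * ip g g.
Proof.
have := cauchy_schwarz f (creflect x g); rewrite /ip /=.
by rewrite (mean_reflect x (cmul g g)).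
Qed.

End Convolution.

(** * Idempotent kernels *)

Section Idempotents.
Variables (R : realType) (B : compactAbGroupType) (I : (B -> R) -> R).
Hypothesis I_mean : invariant_mean I.

Local Notation cfun := (cfun R B).
Local Notation "f * g" := (conv I_mean f g) : conv_scope.
Local Notation ip := (ip I).
Delimit Scope conv_scope with cv.

Implicit Types (f g h k u e : cfun) (x y z a : B).

Definition uniform_limit (F : nat -> cfun) f := forall e : R, 0 < e ->
  exists N, forall n, (N <= n)%N -> forall x, `|F n x - f x| <= e.

Lemma uniform_limit_unique F f g :
  uniform_limit F f -> uniform_limit F g -> f = g.
Proof.
move=> Ff Fg; apply: cfunP => x; apply/eqP/negPn/negP => fg.
have e0 : 0 < `|f x - g x| / 3 by rewrite divr_gt0// normr_gt0 subr_eq0.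
have [N1 h1] := Ff _ e0; have [N2 h2] := Fg _ e0.
have := h1 _ (leq_maxl N1 N2) x; have := h2 _ (leq_maxr N1 N2) x.
set v := F _ x => v2 v1.
have : `|f x - g x| <= `|v - f x| + `|v - g x|.
  by rewrite (distrC v (f x)); apply: ler_distD.
lra.
Qed.

Lemma uniform_limit_lin c F G f g : uniform_limit F f -> uniform_limit G g ->
  uniform_limit (fun n => clin c (F n) (G n)) (clin c f g).
Proof.
move=> Ff Gg e e0.
have d0 : 0 < e / (2 * (`|c| + 1)).
  by rewrite divr_gt0// mulr_gt0// ltr_wpDl.
have [N1 h1] := Ff _ d0; have [N2 h2] := Gg _ (divr_gt0 e0 (ltr0n R 2)).
exists (maxn N1 N2) => n; rewrite geq_max => /andP[n1 n2] x /=.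
rewrite (_ : _ - _ = c * (F n x - f x) + (G n x - g x)); last by ring.
apply: (le_trans (ler_normD _ _)); rewrite normrM.
have a1 : `|c| * `|F n x - f x| <= `|c| * (e / (2 * (`|c| + 1))).
  by rewrite ler_wpM2l// h1.
have a2 : `|c| * (e / (2 * (`|c| + 1))) <= e / 2.
  rewrite mulrA ler_pdivrMr; last by rewrite mulr_gt0// ltr_wpDl.
  have := normr_ge0 c; nra.
have := h2 _ n2 x; lra.
Qed.

Lemma uniform_limit_conv k F f : uniform_limit F f ->
  uniform_limit (fun n => (k * F n)%cv) (k * f)%cv.
Proof.
move=> Ff e e0; pose M := I (cabs k).
have M0 : 0 <= M by apply: (mean_ge0 I_mean); [exact: cfun_cont|move=> z /=].
have d0 : 0 < e / (M + 1) by rewrite divr_gt0// ltr_wpDl.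
have [N h] := Ff _ d0; exists N => n Nn x.
have -> : (k * F n)%cv x - (k * f)%cv x = (k * clin (-1) f (F n))%cv x.
  by rewrite conv_linr /= mulN1r addrC.
have : `|(k * clin (-1) f (F n))%cv x| <= M * (e / (M + 1)).
  rewrite mulrC -(meanZ I_mean _ (cabs k)).
  have E d : I (fun x => d * cabs k x) = I (clin d (cabs k) (czero R B)).
    by congr I; apply/funext => y /=; rewrite addr0.
  have bnd y : `|k y * clin (-1) f (F n) (x - y)| <= e / (M + 1) * `|k y|.
    rewrite normrM mulrC ler_wpM2r//=.
    by have := h _ Nn (x - y); rewrite mulN1r addrC.
  rewrite ler_norml; apply/andP; split.
    rewrite -(mulN1r (I _)) E (mean_linear I_mean); [|exact: cfun_cont..].
    rewrite (mean_cst I_mean) addr0 mulN1r -mulNr -(meanZ I_mean _ (cabs k)) E.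
    apply: (le_mean I_mean (g := cmul k (creflect x (clin (-1) f (F n))))) => y.
    by have := bnd y; rewrite ler_norml /= => /andP[b1 b2]; lra.
  rewrite E.
  apply: (le_mean I_mean (f := cmul k (creflect x (clin (-1) f (F n))))) => y.
  by have := bnd y; rewrite ler_norml /= => /andP[b1 b2]; lra.
move=> /le_trans; apply.
rewrite mulrA ler_pdivrMr ?ltr_wpDl//; nra.
Qed.

Lemma uniform_limit_shift m F f :
  uniform_limit F f -> uniform_limit (fun n => F (n + m)%N) f.
Proof.
move=> Ff e e0; have [N h] := Ff _ e0; exists N => n Nn.
by apply: h; rewrite (leq_trans Nn)// leq_addr.
Qed.

Lemma uniform_cauchy_limit (F : nat -> cfun) :
  (forall e : R, 0 < e -> exists N, forall n m, (N <= n)%N -> (N <= m)%N ->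
     forall x, `|F n x - F m x| <= e) ->
  exists f, uniform_limit F f.
Proof.
move=> FC.
have cv x : cvgn (fun n => F n x).
  apply/cauchy_cvgP; apply/cauchy_ballP => e e0.
  have [N h] := FC _ (divr_gt0 e0 (ltr0n R 2)).
  exists ([set F n x | n in [set n | (N <= n)%N]],
          [set F n x | n in [set n | (N <= n)%N]]).
    by split; exists N => // n /= Nn; exists n.
  move=> [p q] /= [[n Nn <-] [m Nm <-]]; rewrite /ball/=.
  by apply: le_lt_trans (h _ _ Nn Nm x) _; lra.
pose f x := limn (fun n => F n x).
have Ff (e : R) : 0 < e -> exists N, forall n, (N <= n)%N -> forall x, `|F n x - f x| <= e.
  move=> e0; have [N h] := FC _ e0; exists N => n Nn x.
  have c1 : `|F n x - F m x| @[m --> \oo] --> `|F n x - f x|.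
    apply: (@cvg_norm _ R^o); apply: (@cvgB _ R^o); first exact: cvg_cst.
    exact: cv.
  by apply: (cvgr_to_le c1); exists N => // m /= Nm; exact: h.
have cf : continuous f.
  move=> x; apply: continuous_dist_le => e e0.
  have e3 : 0 < e / 3 by rewrite divr_gt0.
  have [N h] := Ff _ e3.
  have := @cfun_cont _ _ (F N) x; move=> /cvgrPdist_le/(_ _ e3).
  apply: filterS => z hz.
  have hx := h N (leqnn N) x; have hz' := h N (leqnn N) z.
  rewrite (_ : f x - f z = (f x - F N x) + (F N x - F N z) + (F N z - f z)); last by ring.
  apply: (le_trans (ler_normD _ _)).
  have := ler_normD (f x - F N x) (F N x - F N z).
  rewrite (distrC (f x)); lra.
by exists (CFun cf).
Qed.

Lemma uniform_limit_even F f :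
  uniform_limit F f -> (forall n, even (F n)) -> even f.
Proof.
move=> Ff eF x; apply/eqP/negPn/negP => fg.
have e0 : 0 < `|f (- x) - f x| / 3 by rewrite divr_gt0// normr_gt0 subr_eq0.
have [N h] := Ff _ e0; have := h N (leqnn N) x; have := h N (leqnn N) (- x).
rewrite eF; set v := F _ x => v2 v1.
have : `|f (- x) - f x| <= `|v - f (- x)| + `|v - f x|.
  by rewrite (distrC v (f (- x))); apply: ler_distD.
lra.
Qed.

Section PowerIteration.
Variable u : cfun.
Hypothesis u_even : even u.
Variable x0 : B.
Hypothesis u_neq0 : u x0 != 0.

(** Continuous kernels have in general no convolution unit, so [cpow n] is the power of exponent
    [n + 1]. *)
Fixpoint cpow n : cfun := if n is n'.+1 then (u * cpow n')%cv else u.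

Lemma cpowD n m : (cpow n * cpow m)%cv = cpow (n + m).+1.
Proof. by elim: n => [//|n IH]; rewrite [cpow n.+1]/= convA IH. Qed.

Lemma even_cpow n : even (cpow n).
Proof. by elim: n => [//|n IH]; exact: even_conv. Qed.

(** Spectrally, the sum of the powers of exponent [2 n + 2] of the eigenvalues of convolution by
    [u]. *)
Definition gram n : R := ip (cpow n) (cpow n).

Lemma ip_cpow n m : ip (cpow n) (cpow m) = cpow (n + m).+1 0.
Proof. by rewrite -(conv0 I_mean)//; [rewrite cpowD|exact: even_cpow]. Qed.

(** Cauchy-Schwarz for [cpow n] and [cpow n.+2], whose inner product depends only on the sum of the
    indices and so equals [gram n.+1]. *)
Lemma gram_log_convex n : gram n.+1 ^+ 2 <= gram n * gram n.+2.
Proof.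
have := cauchy_schwarz I_mean (cpow n) (cpow n.+2).
by rewrite /gram !ip_cpow !addSn !addnS.
Qed.

Lemma gram_submul n m : gram (n + m).+1 <= gram n * gram m.
Proof.
rewrite [gram (n + m).+1]/gram /ip.
have -> : I (fun x => cpow (n + m).+1 x * cpow (n + m).+1 x)%R =
          I (cmul (cpow (n + m).+1) (cpow (n + m).+1)) by [].
rewrite -(mean_cst I_mean (gram n * gram m)).
apply: (le_mean I_mean (g := CFun (fun x => cvg_cst _))) => x.
suff : cpow (n + m).+1 x ^+ 2 <= gram n * gram m by rewrite expr2.
by rewrite -cpowD; exact: conv_sqr_le.
Qed.

(** Log-convexity propagates positivity from two consecutive terms; the second one is positive
    because [u * u] takes the value [gram 0] at 0. *)
Lemma gram_gt0 n : 0 < gram n.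
Proof.
have g0 : 0 < gram 0 by exact: (ip_gt0 I_mean u_neq0).
have g1 : 0 < gram 1.
  apply: (ip_gt0 I_mean (x := 0)).
  by rewrite -[cpow 1]/(cpow 0 * cpow 0)%cv (conv0 I_mean) ?lt0r_neq0.
suff : (0 < gram n) && (0 < gram n.+1) by case/andP.
elim: n => [|n /andP[h1 h2]]; first by rewrite g0 g1.
rewrite h2 /= -(pmulr_rgt0 _ h1).
by apply: lt_le_trans (gram_log_convex n); rewrite exprn_gt0.
Qed.

(** These ratios increase by log-convexity and are bounded by submultiplicativity. Their limit [lam]
    is the largest eigenvalue of convolution by [u * u]. *)
Let r n := gram n.+1 / gram n.

Let r_gt0 n : 0 < r n. Proof. by rewrite divr_gt0// gram_gt0. Qed.

Let r_nd : nondecreasing_seq r.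
Proof.
apply/nondecreasing_seqP => n; rewrite /r.
rewrite ler_pdivrMr ?gram_gt0// mulrAC ler_pdivlMr ?gram_gt0// mulrC [leRHS]mulrC.
by rewrite -expr2 gram_log_convex.
Qed.

Let r_ub : has_ubound (range r).
Proof.
exists (gram 0) => _ [n _ <-]; rewrite /r ler_pdivrMr ?gram_gt0//.
exact: (gram_submul 0 n).
Qed.

Let lam := sup (range r).

Let r_cvg : r @ \oo --> lam. Proof. exact: nondecreasing_cvgn. Qed.

Let r_le n : r n <= lam.
Proof. by apply: ub_le_sup => //; exists n. Qed.

Let lam_gt0 : 0 < lam. Proof. exact: lt_le_trans (r_gt0 0) (r_le 0). Qed.

Let gramS n : gram n.+1 = r n * gram n.
Proof. by rewrite /r divfK// lt0r_neq0// gram_gt0. Qed.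

(** Compounding the increasing ratios from [m] on bounds [r m ^+ n.+1 * gram m] by
    [gram (n.+1 + m)], which is at most [gram n * gram m]. Cancel [gram m] and let [m] grow. *)
Let gram_ge n : lam ^+ n.+1 <= gram n.
Proof.
have H m : r m ^+ n.+1 <= gram n.
  have H1 j : r m ^+ j * gram m <= gram (j + m).
    elim: j => [|j IH]; first by rewrite expr0 mul1r add0n.
    rewrite addSn gramS exprS -mulrA ler_pM//.
    - exact: ltW.
    - by rewrite mulr_ge0 ?exprn_ge0 ?ltW ?gram_gt0.
    - by apply: r_nd; exact: leq_addl.
  rewrite -(ler_pM2r (gram_gt0 m)); apply: le_trans (H1 _) _.
  exact: gram_submul.
have cX (i : nat) : (fun m => r m ^+ i) @ \oo --> lam ^+ i.
  elim: i => [|i IH]; first by under eq_cvg do rewrite expr0; exact: cvg_cst.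
  by under eq_cvg do rewrite exprS; rewrite exprS; apply: cvgM.
by apply: (cvgr_to_le (cX n.+1)); exact: nearW.
Qed.

(** Decreasing and at least 1; spectrally its limit is the dimension of the top eigenspace. The
    lower bound is what keeps the limit kernel from vanishing. *)
Let t n := gram n / lam ^+ n.+1.

Let lamX n : 0 < lam ^+ n. Proof. exact: exprn_gt0. Qed.

Let t_ge1 n : 1 <= t n. Proof. by rewrite ler_pdivlMr// mul1r. Qed.

Let t_ni : nonincreasing_seq t.
Proof.
apply/nonincreasing_seqP => n; rewrite /t gramS exprS.
rewrite ler_pdivrMr ?mulr_gt0// mulrCA.
by rewrite (divfK (lt0r_neq0 (lamX n.+1))) ler_pM2r ?gram_gt0.
Qed.

Let t_cauchy (e : R) : 0 < e ->
  exists N, forall n m, (N <= n)%N -> (N <= m)%N -> `|t n - t m| <= e.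
Proof.
move=> e0.
have cv : cvgn t.
  by apply: nonincreasing_is_cvgn => //; exists 1 => _ [n _ <-].
have /cvgrPdist_le/(_ _ (divr_gt0 e0 (ltr0n R 2)))[N _ h] := cv.
exists N => n m Nn Nm; have /= := h n Nn; have /= := h m Nm.
have := ler_distD (limn t) (t n) (t m); rewrite (distrC (t n) (limn t)); lra.
Qed.

(** The power of [u * u] of exponent [n + 1], scaled so that the top eigenvalue becomes 1. *)
Let G n : cfun := clin (lam ^- n.+1) (cpow n.*2.+1) (czero R B).

Let GE n x : G n x = lam ^- n.+1 * cpow n.*2.+1 x.
Proof. by rewrite /= addr0. Qed.

Let even_G n : even (G n).
Proof. by move=> x; rewrite !GE even_cpow. Qed.

Let conv_scale c f g : (clin c f (czero R B) * g)%cv = clin c (f * g)%cv (czero R B).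
Proof.
rewrite conv_linl; congr clin; apply: cfunP => x /=.
by rewrite -[RHS](mean_cst I_mean 0); congr I; apply/funext => y /=; rewrite mul0r.
Qed.

Let conv_scaler c f g : (f * clin c g (czero R B))%cv = clin c (f * g)%cv (czero R B).
Proof. by rewrite convC conv_scale convC. Qed.

Let scaleA (c d : R) f : clin c (clin d f (czero R B)) (czero R B) = clin (c * d) f (czero R B).
Proof. by apply: cfunP => x /=; rewrite !addr0 mulrA. Qed.

Let conv_G n m : (G n * G m)%cv = G (n + m).+1.
Proof.
rewrite /G conv_scale conv_scaler cpowD scaleA.
congr (clin _ (cpow _) _); last by rewrite -!addnn; lia.
by rewrite -invfM -exprD; congr (_ ^- _); lia.
Qed.

Let ip_G n m : ip (G n) (G m) = t (n + m).+1.
Proof.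
rewrite -(conv0 I_mean (G n) (@even_G m)) conv_G.
by rewrite GE /t /gram ip_cpow mulrC -addnn.
Qed.

Let conv_uG n : (cpow 1 * G n)%cv = clin lam (G n.+1) (czero R B).
Proof.
rewrite /G conv_scaler cpowD scaleA; congr (clin _ (cpow _) _).
rewrite [in RHS]exprS invfM mulrA divff ?mul1r//; exact: lt0r_neq0.
Qed.

(** Inner products of the [G n] are values of [t], so the sequence is Cauchy in mean square. One
    more convolution with [u * u] multiplies by [lam], shifts the index, and makes the estimate
    uniform. *)
Let G_cauchy (e : R) : 0 < e -> exists N, forall n m, (N <= n)%N -> (N <= m)%N ->
  forall x, `|G n x - G m x| <= e.
Proof.
move=> e0; pose K := ip (cpow 1) (cpow 1) + 1.
have K0 : 0 < K by rewrite ltr_wpDl//; exact: (ip_ge0 I_mean).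
(* This makes [K * (2 * d)] equal to [(lam * e) ^+ 2], the bound wanted after Cauchy-Schwarz. *)
pose d := (lam * e) ^+ 2 / (2 * K).
have d0 : 0 < d by rewrite divr_gt0// ?mulr_gt0// exprn_gt0// mulr_gt0.
have [N h] := t_cauchy d0.
exists N.+1 => -[//|n] [//|m] Nn Nm x.
pose D := clin (-1) (G m) (G n).
have DE : (cpow 1 * D)%cv x = lam * (G n.+1 x - G m.+1 x).
  by rewrite conv_linr !conv_uG [LHS]/= -!GE; rewrite !addr0; ring.
have ipD : ip D D <= 2 * d.
  rewrite (ip_lin I_mean) !ip_G.
  have h1 := h (n + n).+1 (m + n).+1.
  have h2 := h (m + m).+1 (m + n).+1.
  have := h1 ltac:(lia) ltac:(lia); have := h2 ltac:(lia) ltac:(lia).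
  rewrite !ler_norml => /andP[a1 a2] /andP[a3 a4]; lra.
have h1 : (lam * (G n.+1 x - G m.+1 x)) ^+ 2 <= (lam * e) ^+ 2.
  rewrite -DE; apply: (le_trans (conv_sqr_le I_mean _ _ _)).
  apply: (@le_trans _ _ (K * (2 * d))).
    apply: ler_pM => //; [exact: (ip_ge0 I_mean)..|].
    by rewrite lerDl.
  by rewrite /d le_eqVlt; apply/orP; left; apply/eqP; field; exact: lt0r_neq0.
have := h1; rewrite -[leLHS]real_normK ?num_real// normrM (gtr0_norm lam_gt0).
rewrite ler_pXn2r//; [|by rewrite nnegrE mulr_ge0// ltW..].
by rewrite ler_pM2l.
Qed.

(* The normalized even convolution powers of [u] converge to the projector onto
   the eigenspace of the largest eigenvalue of convolution by [u * u]. *)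
Lemma top_idempotent : exists (l : R) g, [/\ 0 < l /\ 1 <= g 0, even g, (g * g)%cv = g,
  (u * u * g)%cv = clin l g (czero R B) &
  forall e, (u * e)%cv = u -> (g * e)%cv = g].
Proof.
have [g Gg] := uniform_cauchy_limit G_cauchy.
have GgE m : (G m * g)%cv = g.
  apply: (uniform_limit_unique (uniform_limit_conv (G m) Gg)).
  have -> : (fun n => G m * G n)%cv = (fun n => G (n + m.+1)%N).
    by apply/funext => n; rewrite conv_G addnS addnC.
  exact: uniform_limit_shift.
exists lam, g; split => //.
- split=> //; rewrite leNgt; apply/negP => g1.
  have e0 : 0 < (1 - g 0) / 2 by rewrite divr_gt0// subr_gt0.
  have [N h] := Gg _ e0; have := h N (leqnn N) 0.
  have -> : G N 0 = t N by rewrite GE /t /gram ip_cpow mulrC -addnn.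
  have := t_ge1 N; rewrite ler_norml => t1 /andP[]; lra.
- exact: (uniform_limit_even Gg).
- apply: (uniform_limit_unique (uniform_limit_conv g Gg)).
  have -> : (fun n => g * G n)%cv = fun=> g by apply/funext => n; rewrite convC.
  by move=> e e0; exists 0%N => n _ x; rewrite subrr normr0 ltW.
- apply: (uniform_limit_unique (uniform_limit_conv _ Gg)).
  have -> : (fun n => u * u * G n)%cv =
      (fun n => clin lam (G (n + 1)%N) (czero R B)).
    by apply/funext => n; rewrite addn1 -conv_uG.
  apply: uniform_limit_lin; first exact: uniform_limit_shift.
  by move=> e e0; exists 0%N => n _ x; rewrite subrr normr0 ltW.
- move=> e ue.
  have pe n : (cpow n * e)%cv = cpow n.
    by elim: n => [//|n IH]; rewrite [cpow n.+1]/= convA IH.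
  rewrite convC; apply: (uniform_limit_unique (uniform_limit_conv e Gg)).
  have -> : (fun n => e * G n)%cv = G.
    by apply/funext => n; rewrite convC /G conv_scale pe.
  exact: Gg.
Qed.

End PowerIteration.

End Idempotents.

(** * Minimal idempotents and the cosine equation *)

Section MinimalIdempotents.
Variables (R : realType) (B : compactAbGroupType) (I : (B -> R) -> R).
Hypothesis I_mean : invariant_mean I.

Local Notation cfun := (cfun R B).
Local Notation "f * g" := (conv I_mean f g) : conv_scope.
Local Notation ip := (ip I).
Delimit Scope conv_scope with cv.

Implicit Types (f g h k u e : cfun) (x y z a b : B).

Definition idempotent_kernel g := even g /\ (g * g)%cv = g.

Lemma idempotent_sqr_le g x : idempotent_kernel g -> g x ^+ 2 <= g 0 ^+ 2.
Proof.
move=> [eg gg]; have := conv_sqr_le I_mean g g x.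
by rewrite gg -(conv0 I_mean g eg) gg.
Qed.

(* [g 0] is the dimension of the range of the projector [g]. *)
Lemma idempotent_ge1 g x : idempotent_kernel g -> g x != 0 -> 1 <= g 0.
Proof.
move=> ig gx; have [eg gg] := ig.
have g0E : g 0 = ip g g by rewrite -(conv0 I_mean g eg) gg.
have g0 : 0 < g 0 by rewrite g0E; exact: (ip_gt0 I_mean gx).
have : g 0 <= g 0 ^+ 2.
  rewrite {1}g0E -(mean_cst I_mean (g 0 ^+ 2)).
  apply: (le_mean I_mean (f := cmul g g) (g := CFun (fun x => cvg_cst _))) => y.
  by rewrite /= -expr2 idempotent_sqr_le.
by rewrite expr2 ler_pMr.
Qed.

(** [h * e = h] says that the range of the projector [h] lies in that of [e]. *)
Definition minimal_idempotent e := [/\ idempotent_kernel e, exists x, e x != 0 &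
  forall h, idempotent_kernel h -> (exists x, h x != 0) -> (h * e)%cv = h -> h = e].

(** If [g] is not minimal, some proper [h] lies below it, and [g - h] is again a nonzero idempotent.
    Its value at 0 is at least 1, so passing to [h] lowers the integer bound. *)
Lemma minimal_idempotent_below n g : idempotent_kernel g ->
  (exists x, g x != 0) -> g 0 <= n%:R ->
  exists2 e, minimal_idempotent e & (e * g)%cv = e.
Proof.
elim: n g => [|n IH] g ig [x gx] gn.
  by have := le_trans (idempotent_ge1 ig gx) gn; rewrite ler10.
have [gmin|] := pselect (forall h, idempotent_kernel h -> (exists x, h x != 0) ->
    (h * g)%cv = h -> h = g).
  by exists g; [split=> //; exists x|case: ig].
move=> /existsNP[h /not_implyP[ih /not_implyP[nh /not_implyP[hg hNg]]]].
pose d := clin (-1) h g.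
have id : idempotent_kernel d.
  split; first by apply: even_lin; [case: ih|case: ig].
  rewrite conv_linl !conv_linr hg (convC I_mean g h) hg.
  rewrite ih.2 ig.2; apply: cfunP => y /=; ring.
have [y dy] : exists y, d y != 0.
  apply: contra_notP hNg => /forallNP d0; apply: cfunP => y.
  have /negP/negPn/eqP/= := d0 y; rewrite mulN1r addrC => /eqP.
  by rewrite subr_eq0 => /eqP.
have d1 := idempotent_ge1 id dy.
have [|e me eh] := IH h ih nh.
  by move: d1 gn; rewrite /= -natr1; lra.
by exists e => //; rewrite -eh convA hg.
Qed.

(** The top idempotent [g] of [u] satisfies [g * e = g], so minimality forces [g = e]. Then
    [u * u = u * u * e] is the top eigenvalue times [e]. *)
Lemma minimal_idempotent_square e u : minimal_idempotent e -> even u ->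
  (u * e)%cv = u -> exists l, (u * u)%cv = clin l e (czero R B).
Proof.
move=> [ie _ emin] eu ue; have [[x ux]|] := pselect (exists x, u x != 0).
  have [l [g [[_ g1] eg gg ug ge]]] := top_idempotent I_mean eu ux.
  have gE : g = e.
    apply: emin => //; last exact: ge.
    by exists 0; rewrite lt0r_neq0// (lt_le_trans _ g1).
  by exists l; rewrite -gE -ug convA gE ue.
move=> /forallNP u0; exists 0; apply: cfunP => x /=.
rewrite mul0r add0r -[RHS](mean_cst I_mean 0); congr I; apply/funext => y.
by have /negP/negPn/eqP -> := u0 y; rewrite mul0r.
Qed.

Let csym_cont a f : continuous (fun x => f (x - a) + f (x + a)).
Proof.
have ci : continuous (fun x : B => x) by move=> x; exact: cvg_id.
have cc (c : B) : continuous (fun _ : B => c) by move=> x; exact: cvg_cst.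
move=> x; apply: (@cvgD _ R^o).
  by apply: (@continuous_compT _ _ _ (fun x => x - a) f);
    [exact: (continuous_subg ci (cc a))|exact: cfun_cont].
by apply: (@continuous_compT _ _ _ (fun x => x + a) f);
  [exact: (continuous_addg ci (cc a))|exact: cfun_cont].
Qed.

(** Convolution with the even measure formed by the point masses at [a] and [- a]: it preserves
    evenness and commutes with convolution. *)
Definition csym a f : cfun := CFun (@csym_cont a f).

Lemma even_csym a f : even f -> even (csym a f).
Proof.
move=> ef x /=; rewrite addrC; congr (_ + _); rewrite -[LHS]ef.
  by congr (f _); rewrite opprD opprK.
by congr (f _); rewrite opprB opprK addrC.
Qed.

Lemma conv_csym a f g : (f * csym a g)%cv = csym a (f * g)%cv.
Proof.
apply: cfunP => x /=.
rewrite -(meanD I_mean (cmul f (creflect (x - a) g)) (cmul f (creflect (x + a) g))).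
congr I; apply/funext => y /=; rewrite mulrDr.
by congr (_ * g _ + _ * g _); rewrite addrAC.
Qed.

(** Polarization: with [w = csym a e], both [w * w] and [(w + e) * (w + e) = w * w + 2 w + e] are
    multiples of [e], hence so is [w]. *)
Lemma minimal_idempotent_csym e a : minimal_idempotent e ->
  exists l, csym a e = clin l e (czero R B).
Proof.
move=> me; have [[ee eE] _ _] := me.
have ue : (csym a e * e)%cv = csym a e by rewrite convC conv_csym eE.
have eue : even (csym a e) by exact: even_csym.
have [l1 h1] := minimal_idempotent_square me eue ue.
pose v := clin 1 (csym a e) e.
have [|l2 h2] := minimal_idempotent_square me (u := v) (even_lin 1 eue ee).
  by rewrite conv_linl ue eE.
exists ((l2 - l1 - 1) / 2); apply: cfunP => x.
have := congr1 (fun f : cfun => f x) h2.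
rewrite conv_linl !conv_linr (convC I_mean e (csym a e)) h1 ue eE.
move=> /=; rewrite !mul1r !addr0 => h.
have {}h : 2 * (e (x - a) + e (x + a)) = (l2 - l1 - 1) * e x by lra.
by apply: (mulfI (x := 2%:R)); rewrite ?pnatr_eq0// h; field.
Qed.

(** The projector [g] onto the top eigenspace of [u * u] has finite rank [g 0], so a minimal [e]
    lies below it and inherits the eigenvalue [l]. *)
Lemma cosine_exists u x : even u -> u x != 0 ->
  exists e (l : R), [/\ 0 < l, 0 < e 0, (u * u * e)%cv = clin l e (czero R B),
    forall x, e x ^+ 2 <= e 0 ^+ 2 &
    forall a y, e 0 * (e (y - a) + e (y + a)) = 2 * e a * e y].
Proof.
move=> eu ux; have [l [g [[l0 g1] eg gg ug _]]] := top_idempotent I_mean eu ux.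
have [n gn] : exists n : nat, g 0 <= n%:R.
  by exists (Num.truncn (g 0)).+1; rewrite ltW// Num.Theory.truncnS_gt.
have [|e me eg'] := minimal_idempotent_below (n := n) (conj eg gg) _ gn.
  by exists 0; rewrite lt0r_neq0// (lt_le_trans _ g1).
have [ie [y ey] _] := me.
have e1 := idempotent_ge1 ie ey.
exists e, l; split=> //.
- exact: lt_le_trans e1.
- rewrite -eg' (convC I_mean e) -convA ug conv_linl; congr clin.
  apply: cfunP => z /=; rewrite -[RHS](mean_cst I_mean 0); congr I.
  by apply/funext => w; rewrite mul0r.
- by move=> z; exact: idempotent_sqr_le.
move=> a z; have [s sE] := minimal_idempotent_csym a me.
have E t : e (t - a) + e (t + a) = s * e t.
  by have := congr1 (fun f : cfun => f t) sE; rewrite /= addr0.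
(* The factor [s] is read off at 0, where evenness gives [2 * e a = s * e 0]. *)
have := E 0; rewrite sub0r add0r (ie.1 a) => E0.
rewrite E; have -> : 2 * e a = s * e 0 by lra.
ring.
Qed.

(** If [e b = e 0], the cosine equation gives [csym b e = 2 e], so [u * e = v * (csym b e - 2 e)]
    vanishes. This contradicts [u * u * e = l e] with [l] and [e 0] positive. *)
Lemma cosine_separates b (v : cfun) : even v -> v b != v 0 ->
  exists e, [/\ 0 < e 0, e b != e 0, forall x, e x ^+ 2 <= e 0 ^+ 2 &
    forall a y, e 0 * (e (y - a) + e (y + a)) = 2 * e a * e y].
Proof.
move=> ev vb; pose u := clin (-2) v (csym b v).
have eu : even u by apply: even_lin => //; exact: even_csym.
have u0 : u 0 != 0.
  rewrite /= sub0r add0r ev; apply: contra_neq vb => h; lra.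
have [e [l [l0 e0 ue e2 eE]]] := cosine_exists eu u0.
exists e; split=> //; apply/negP => /eqP eb.
have uez : (u * e)%cv = czero R B.
  have -> : (u * e)%cv = clin (-2) (v * e)%cv (v * csym b e)%cv.
    by rewrite convC conv_linr !conv_csym (convC I_mean e v).
  have -> : csym b e = clin 2 e (czero R B).
    apply: cfunP => y /=; rewrite addr0.
    by apply: (mulfI (lt0r_neq0 e0)); rewrite eE eb; ring.
  rewrite conv_linr; apply: cfunP => x /=.
  have -> : conv_fun I v (czero R B) x = 0.
    by rewrite -[RHS](mean_cst I_mean 0); congr I; apply/funext => y /=; rewrite mulr0.
  ring.
have := congr1 (fun f : cfun => f 0) ue.
rewrite convA uez /= => /eqP; apply/negP; rewrite addr0.
rewrite /conv_fun (_ : (fun y => _) = fun=> 0); last first.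
  by apply/funext => y; rewrite mulr0.
by rewrite (mean_cst I_mean) eq_sym mulf_neq0// lt0r_neq0.
Qed.

End MinimalIdempotents.

(** * Bounded solutions of d'Alembert's equation *)

Section DAlembert.
Variables (R : realType) (G : zmodType) (c : G -> R).
Hypotheses (c0 : c 0 = 1) (c1 : forall x, c x ^+ 2 <= 1).
Hypothesis cE : forall x y, c (x + y) + c (x - y) = 2 * c x * c y.

Let cN x : c (- x) = c x.
Proof. by have := cE 0 x; rewrite c0 add0r sub0r; lra. Qed.

(* The sine is a multiple of [c (x - a) - c (x + a)] for any [a] with
   [c a ^ 2 < 1]. *)
Lemma dalembert_sine : exists (k : R) (a : G), let s x := k * (c (x - a) - c (x + a)) in
  [/\ forall x y, c (x + y) = c x * c y - s x * s y,
      forall x y, s (x + y) = s x * c y + c x * s y &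
      forall x, c x ^+ 2 + s x ^+ 2 = 1].
Proof.
suff [k [a [h1 h2]]] : exists (k : R) (a : G), let s x := k * (c (x - a) - c (x + a)) in
  (forall x y, c (x + y) = c x * c y - s x * s y) /\
  (forall x y, s (x + y) = s x * c y + c x * s y).
  exists k, a; split=> // x; rewrite -c0 -(subrr x) h1 cN.
  have -> : - x - a = - (x + a) by rewrite opprD.
  have -> : - x + a = - (x - a) by rewrite opprB addrC.
  by rewrite !cN; ring.
have [c2|/existsNP[a ca]] := pselect (forall x, c x ^+ 2 = 1).
  (* Here [c] takes only the values 1 and -1. The sine is 0 and the claim is multiplicativity:
     [c (x + y)] and [c (x - y)] add up to twice the sign [c x * c y], so both equal it. *)
  exists 0, 0; split=> x y; rewrite !mul0r ?mulr0 ?subr0 ?addr0//.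
  have := c2 (x + y); have := c2 (x - y); have := cE x y.
  have := c2 x; have := c2 y.
  set p := c (x + y); set q := c (x - y); set a := c x; set b := c y.
  move=> b2 a2 h q2 p2.
  have : (a * b) ^+ 2 = 1 by rewrite exprMn a2 b2 mulr1.
  rewrite -mulrA in h; move: h; set w := a * b => h w2.
  have q2' : (2 * w - p) ^+ 2 = 1 by have -> : 2 * w - p = q by lra.
  have : (p - w) ^+ 2 = 0 by nra.
  by move/eqP; rewrite sqrf_eq0 subr_eq0 => /eqP.
have ca1 : 0 < 1 - c a ^+ 2 by rewrite subr_gt0 lt_neqAle c1 andbT; apply/eqP.
(* For a cosine, [c (x - a) - c (x + a)] is [2 sin x sin a], and the root is [sin a] up to sign. *)
pose k := (2 * Num.sqrt (1 - c a ^+ 2))^-1.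
have k2 : 4 * k ^+ 2 * (1 - c a ^+ 2) = 1.
  rewrite /k exprVn exprMn sqr_sqrtr ?ltW//; field; exact: lt0r_neq0.
exists k, a => s.
have caa : c (a + a) = 2 * c a ^+ 2 - 1.
  by have := cE a a; rewrite subrr c0; lra.
split=> x y.
  (* Product-to-sum formulas for the four terms of [(c (x - a) - c (x + a)) * (c (y - a) - c (y +
     a))]; [e5] and [e6] then eliminate the shifts by [a + a]. *)
  have e1 := cE (x - a) (y - a); have e2 := cE (x + a) (y + a).
  have e3 := cE (x - a) (y + a); have e4 := cE (x + a) (y - a).
  have e5 := cE (x + y) (a + a); have e6 := cE (x - y) (a + a).
  have e7 := cE x y.
  have i1 : x - a + (y - a) = x + y - (a + a) by rewrite addrACA -opprD.
  have i2 : x - a - (y - a) = x - y by rewrite opprB addrA subrK.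
  have i3 : x + a + (y + a) = x + y + (a + a) by rewrite addrACA.
  have i4 : x + a - (y + a) = x - y by rewrite opprD addrA addrAC addrK.
  have i5 : x - a + (y + a) = x + y by rewrite addrACA addNr addr0.
  have i6 : x - a - (y + a) = x - y - (a + a) by rewrite !opprD addrACA.
  have i7 : x + a + (y - a) = x + y by rewrite addrACA subrr addr0.
  have i8 : x + a - (y - a) = x - y + (a + a) by rewrite opprB (addrC a) addrACA.
  rewrite i1 i2 in e1; rewrite i3 i4 in e2; rewrite i5 i6 in e3.
  rewrite i7 i8 in e4.
  have H : 4 * ((c (x - a) - c (x + a)) * (c (y - a) - c (y + a))) =
      4 * (c (x - y) - c (x + y)) * (2 * (1 - c a ^+ 2)).
    rewrite caa in e5 e6; lra.
  have -> : s x * s y = k ^+ 2 * ((c (x - a) - c (x + a)) * (c (y - a) - c (y + a))).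
    by rewrite /s; ring.
  have -> : (c (x - a) - c (x + a)) * (c (y - a) - c (y + a)) =
      (c (x - y) - c (x + y)) * (2 * (1 - c a ^+ 2)) by lra.
  have -> : k ^+ 2 * ((c (x - y) - c (x + y)) * (2 * (1 - c a ^+ 2))) =
     (c (x - y) - c (x + y)) / 2 * (4 * k ^+ 2 * (1 - c a ^+ 2)) by field.
  rewrite k2; lra.
have e1 := cE (x - a) y; have e2 := cE (x + a) y.
have e3 := cE (y - a) x; have e4 := cE (y + a) x.
have i1 : x - a + y = x + y - a by rewrite addrAC.
have i2 : x + a + y = x + y + a by rewrite addrAC.
have i3 : y - a + x = x + y - a by rewrite addrAC (addrC y).
have i4 : y + a + x = x + y + a by rewrite addrAC (addrC y).
have i5 : c (y - a - x) = c (x + a - y).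
  by rewrite -cN; congr c; rewrite opprB opprB addrA.
have i6 : c (y + a - x) = c (x - a - y).
  by rewrite -cN; congr c; rewrite opprB opprD addrA addrAC.
rewrite i1 in e1; rewrite i2 in e2; rewrite i3 i5 in e3; rewrite i4 i6 in e4.
rewrite /s; have : 4 * (c (x + y - a) - c (x + y + a)) =
  4 * ((c (x - a) - c (x + a)) * c y + c x * (c (y - a) - c (y + a))) by lra.
move=> h; have {}h : c (x + y - a) - c (x + y + a) =
  (c (x - a) - c (x + a)) * c y + c x * (c (y - a) - c (y + a)) by lra.
by rewrite h; ring.
Qed.

End DAlembert.

(** * Change of variables and measurability *)

Section Transfer.
Variables (d1 d2 : measure_display) (X : measurableType d1) (Y : measurableType d2).
Variables (R : realType) (mu : {measure set X -> \bar R}) (nu : {measure set Y -> \bar R}).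
Variable phi : X -> Y.
Hypotheses (mphi : measurable_fun setT phi)
  (phi_nu : forall S, measurable S -> mu (phi @^-1` S) = nu S).

Lemma transfer_ge0_integral (f : Y -> \bar R) : measurable_fun setT f ->
  (forall y, 0 <= f y)%E -> (\int[nu]_y f y = \int[mu]_x f (phi x))%E.
Proof.
move=> mf f0; transitivity (\int[pushforward mu phi]_y f y)%E.
  by apply: eq_measure_integral => S mS _; rewrite /pushforward -phi_nu.
by rewrite ge0_integral_pushforward//= preimage_setT.
Qed.

Lemma transfer_integrable (f : Y -> \bar R) : nu.-integrable setT f ->
  mu.-integrable setT (f \o phi).
Proof.
move=> /integrableP[mf foo]; apply/integrableP; split; first exact: measurableT_comp.
apply: le_lt_trans foo.
by rewrite (transfer_ge0_integral (f := fun y => `|f y|%E))//; exact: measurableT_comp.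
Qed.

Lemma transfer_integral (f : Y -> \bar R) : nu.-integrable setT f ->
  (\int[nu]_y f y = \int[mu]_x f (phi x))%E.
Proof.
move=> fi; transitivity (\int[pushforward mu phi]_y f y)%E.
  by apply: eq_measure_integral => S mS _; rewrite /pushforward -phi_nu.
rewrite integral_pushforward ?preimage_setT//.
  by case/integrableP: fi.
exact: transfer_integrable.
Qed.

End Transfer.

Lemma measurable_fun_preimage_open (R : realType) (d : measure_display)
    (T : measurableType d) (f : T -> R) :
  (forall U : set R, open U -> measurable (f @^-1` U)) -> measurable_fun setT f.
Proof.
move=> fU; apply: (measurability _ (RGenOpens.measurableE R)).
by move=> _ [_ [a [b ->]] <-]; rewrite setTI; apply: fU; exact: interval_open.
Qed.

Lemma measurable_fun_generated (G H : zmodType) (E : set (set G)) (E' : set (set H))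
    (f : G -> H) : (forall S, E' S -> (@measurable _ (generated G E)) (f @^-1` S)) ->
  measurable_fun setT (f : generated G E -> generated H E').
Proof.
move=> fE.
apply: (@measurability _ _ (generated G E) (generated H E') _ _ E') => //.
move=> _ [S E'S <-].
by rewrite setTI; exact: fE.
Qed.

(** Shared by Haar measures and the ultralimit measure; stated with preimages so that a translation
    is a change of variables. *)
Definition translation_invariant (R : realType) (G : zmodType) (E : set (set G))
    (mu : {measure set (generated G E) -> \bar R}) := forall a : G,
  measurable_fun setT ((fun x : G => a + x) : generated G E -> generated G E) /\
  forall S : set G, (@measurable _ (generated G E)) S ->
    mu ((fun x : G => a + x) @^-1` S) = mu S.

Lemma compact_cover_compact (T : topologicalType) (t : T) (K : set T) :
  compact K -> cover_compact K.
Proof.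
pose pM := isPointed.Build T t.
pose pT : ptopologicalType := HB.pack T pM.
have -> : compact K = @compact pT K by [].
by rewrite compact_cover.
Qed.

(** * The Haar integral as an invariant mean *)

Section HaarMean.
Variables (R : realType) (B : compactAbGroupType) (m : probability (borel B) R).

Lemma open_borel (U : set B) : open U -> (@measurable _ (borel B)) U.
Proof. exact: sub_sigma_algebra. Qed.

Lemma continuous_translate (a : B) : continuous (fun x : B => a + x).
Proof. by apply: continuous_addg => x; [exact: cvg_cst|exact: cvg_id]. Qed.

Lemma haar_translation_invariant : is_haar m -> translation_invariant m.
Proof.
move=> mh a; have ma := @measurable_fun_generated B B open open (fun x => a + x).
have {}ma : measurable_fun setT ((fun x : B => a + x) : borel B -> borel B).
  apply: ma => S oS; apply: open_borel.
  by move/continuousP: (@continuous_translate a); apply.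
split=> // S mS; refine (etrans _ (haar_translation mh (- a) mS)); congr (m _).
apply/seteqP; split=> [x /= Sx|_ [y Sy <-]] /=; last by rewrite addrA subrr add0r.
by exists (a + x) => //; rewrite addrA addNr add0r.
Qed.

Lemma continuous_bounded (T : topologicalType) (f : T -> R) :
  compact [set: T] -> continuous f -> exists M, forall x, `|f x| <= M.
Proof.
move=> cT cf; have [[x _]|T0] := pselect ([set: T] !=set0); last first.
  by exists 0 => x; exfalso; apply: T0; exists x.
have cn : continuous (fun x => `|f x|).
  by move=> y; apply: (@cvg_norm _ R^o); exact: cf.
have [|c _ cM] := compact_EVT_max (ex_intro _ x I) cT (f := fun x => `|f x|).
  exact: continuous_subspaceT.
by exists `|f c| => y; apply: cM; rewrite inE.
Qed.

Lemma bounded_integrable_fin (d : measure_display) (T : measurableType d)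
    (mu : {measure set T -> \bar R}) (f : T -> R) (M : R) : (mu setT < +oo)%E ->
  measurable_fun setT f -> (forall x, `|f x| <= M) ->
  mu.-integrable setT (EFin \o f).
Proof.
move=> muT mf fM; apply: measurable_bounded_integrable => //.
exists M; split; first exact: num_real.
by move=> x Mx y _; apply: le_trans (fM y) (ltW Mx).
Qed.

Lemma continuous_borel_measurable (f : B -> R) : continuous f ->
  measurable_fun setT (f : borel B -> R).
Proof.
move=> /continuousP cf; apply: measurable_fun_preimage_open => U oU.
by apply: open_borel; exact: cf.
Qed.

Lemma continuous_integrable (f : B -> R) : continuous f ->
  m.-integrable setT (EFin \o f).
Proof.
move=> cf; have [M fM] := continuous_bounded (@compact_setT B) cf.
apply: (bounded_integrable_fin (M := M)) => //.
  by rewrite (@le_lt_trans _ _ 1%E) ?ltry// probability_le1.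
exact: continuous_borel_measurable.
Qed.

Hypotheses (B2 : @second_countable B) (mh : is_haar m).

Lemma second_countable_seq (T : topologicalType) : @second_countable T ->
  exists b : nat -> set T, (forall n, open (b n)) /\
    forall x U, nbhs x U -> exists n, b n x /\ b n `<=` U.
Proof.
move=> [BB /countable_injP[f finj] [oB bB]].
(* Injectivity of [f] leaves at most one set in the union, and an index that is not hit yields the
   empty set. *)
exists (fun n => \bigcup_(U in [set U | BB U /\ f U = n]) U); split.
  by move=> n; apply: bigcup_open => U [BU _]; exact: oB.
move=> x U /(bB x)[V [BV Vx] VU].
have E : \bigcup_(W in [set W | BB W /\ f W = f V]) W = V.
  apply/seteqP; split=> [y [W [BW /finj WV] Wy]|y Vy].
    by rewrite -WV// inE.
  by exists V.
by exists (f V); rewrite E.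
Qed.

(** A countable base makes every open set of the square a countable union of open boxes, so
    continuous functions of two variables fall under Fubini. *)
Lemma open_prod_measurable (O : set (B * B)) : open O ->
  (@measurable _ (borel B * borel B)%type) O.
Proof.
move=> oO; have [b [ob bb]] := second_countable_seq B2.
pose S i j : set (B * B) := if `[< b i `*` b j `<=` O >] then b i `*` b j else set0.
have -> : O = \bigcup_i \bigcup_j S i j.
  apply/seteqP; split=> [[x y] Oxy|p [i _ [j _]]]; last first.
    by rewrite /S; case: asboolP => // h; exact: h.
  have [[U V] /= [nU nV] UV] : nbhs (x, y) O by exact: open_nbhs_nbhs.
  have [i [bx bU]] := bb _ _ nU; have [j [by_ bV]] := bb _ _ nV.
  exists i => //; exists j => //; rewrite /S asboolT//.
  by move=> p [p1 p2]; apply: UV; split; [exact: bU|exact: bV].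
apply: (@bigcupT_measurable _ (borel B * borel B)%type) => i.
apply: (@bigcupT_measurable _ (borel B * borel B)%type) => j.
rewrite /S; case: asboolP => _ //.
by apply: measurableX; exact: open_borel.
Qed.

Let I (f : B -> R) : R := \int[m]_x (f x).

Let I_linear (a : R) (f g : B -> R) : continuous f -> continuous g ->
  I (fun x => a * f x + g x) = a * I f + I g.
Proof.
move=> cf cg; have fi := continuous_integrable cf; have gi := continuous_integrable cg.
rewrite /I RintegralD//; first by rewrite RintegralZl.
have : continuous (fun x => a * f x).
  by move=> x; apply: cvgM; [exact: cvg_cst|exact: cf].
exact: continuous_integrable.
Qed.

Let I_cst a : I (fun=> a) = a.
Proof.
have h : fine (m setT) = 1 by rewrite (probability_setT m).
refine (etrans (Rintegral_cst m measurableT a) _).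
by rewrite [fine _]h mulr1.
Qed.

Let I_1 : I (fun=> 1) = 1. Proof. exact: I_cst. Qed.

Let I_translate (a : B) (f : B -> R) : continuous f -> I (fun x => f (a + x)) = I f.
Proof.
move=> cf; have [ma pa] := haar_translation_invariant mh a.
by rewrite /I /Rintegral (transfer_integral ma pa (continuous_integrable cf)).
Qed.

Let I_ge0 (f : B -> R) : (forall x, 0 <= f x) -> 0 <= I f.
Proof. by move=> f0; apply: Rintegral_ge0. Qed.

(** Finitely many translates of the open set where [f] exceeds [f x / 2] cover [B]. The sum of the
    corresponding translates of [f] is at least [f x / 2] everywhere, while its mean is a multiple
    of [I f]. *)
Let I_gt0 (f : B -> R) (x : B) : continuous f -> (forall x, 0 <= f x) -> 0 < f x -> 0 < I f.
Proof.
move=> cf f0 fx.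
pose F (s : seq B) y := \sum_(a <- s) f (a + y).
have cF s : continuous (F s) /\ I (F s) = (size s)%:R * I f.
  have ca a : continuous (fun y => f (a + y)).
    by apply: continuous_compT cf; exact: continuous_translate.
  elim: s => [|a s [c1 IH]].
    have -> : F [::] = fun=> 0 by apply/funext => y; rewrite /F big_nil.
    split; first by move=> y; exact: cvg_cst.
    by rewrite mul0r I_cst.
  have -> : F (a :: s) = fun y => 1 * f (a + y) + F s y.
    by apply/funext => y; rewrite /F big_cons mul1r.
  split; last by rewrite I_linear// IH I_translate//= -natr1 mulrDl !mul1r addrC.
  move=> y; apply: (@cvgD _ R^o); last exact: c1.
  by apply: cvgM; [exact: cvg_cst|exact: ca].
have fx2 : 0 < f x / 2 by rewrite divr_gt0.
have cB : cover_compact [set: B] by apply: (compact_cover_compact 0); exact: compact_setT.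
move: cB => /(_ B setT (fun a => (fun y => a + y) @^-1` [set y | f x / 2 < f y])) [].
- move=> a _; have /continuousP : continuous (fun y => f (a + y)).
    by apply: continuous_compT cf; exact: continuous_translate.
  by move=> /(_ [set r | f x / 2 < r]); apply; exact: open_gt.
- move=> y _; exists (x - y) => //=; rewrite subrK; lra.
move=> D' _; pose D := finmap.enum_fset D'; move=> cov; have [cD ID] := cF D.
have : I (fun=> f x / 2) <= I (F D).
  have := @I_ge0 (fun y => -1 * (f x / 2) + F D y).
  have cc : continuous (fun _ : B => f x / 2) by move=> y; exact: cvg_cst.
  rewrite I_linear// => h; rewrite -subr_ge0 addrC -mulN1r; apply: h => y.
  have [a /= aD fa] := cov y Logic.I.
  rewrite mulN1r addrC subr_ge0 /F (bigD1_seq a)//= ?finmap.fset_uniq//.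
  by apply: le_trans (ltW fa) _; rewrite lerDl sumr_ge0.
rewrite ID I_cst.
move=> h; have {h} : 0 < (size D)%:R * I f by exact: lt_le_trans h.
have [s0|s0] := posnP (size D); first by rewrite s0 mul0r ltxx.
by rewrite pmulr_rgt0// ltr0n.
Qed.

Let I_exchange (F : B -> B -> R) : continuous (fun p : B * B => F p.1 p.2) ->
  I (fun x => I (fun y => F x y)) = I (fun y => I (fun x => F x y)).
Proof.
move=> cF; have cT : compact [set: B * B].
  by rewrite -setXTT; apply: compact_setX; exact: compact_setT.
have [M FM] := continuous_bounded cT cF.
have mF : measurable_fun [set: borel B * borel B] (fun p => F p.1 p.2).
  apply: measurable_fun_preimage_open => U oU; apply: open_prod_measurable.
  by move/continuousP: cF; apply.
have Fi : (m \x m)%E.-integrable setT (EFin \o (fun p : borel B * borel B => F p.1 p.2)).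
  apply: (bounded_integrable_fin (M := M)) => //.
  have h : ((m \x m) (setT `*` setT) = 1)%E.
    rewrite (product_measure1E m m measurableT measurableT).
    transitivity (1 * 1 : \bar R)%E; last by rewrite mule1.
    by congr (_ * _)%E; exact: (probability_setT m).
  by rewrite -setXTT [ltLHS]h ltry.
have cst1 (x : B) : continuous (fun _ : B => x) by move=> z; exact: cvg_cst.
have cid : continuous (fun x : B => x) by move=> z; exact: cvg_id.
have cpair (f g : B -> B) : continuous f -> continuous g -> continuous (fun z => F (f z) (g z)).
  move=> cf cg; apply: (@continuous_compT _ _ _ (fun z => (f z, g z)) _ _ cF).
  by move=> z; apply: cvg_pair; [exact: cf|exact: cg].
have E1 x : (I (fun y => F x y))%:E = (\int[m]_y (F x y)%:E)%E.
  rewrite /I /Rintegral fineK//; apply: integrable_fin_num => //.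
  by apply: (@continuous_integrable (fun y => F x y)); apply: (cpair (fun=> x) id).
have E2 y : (I (fun x => F x y))%:E = (\int[m]_x (F x y)%:E)%E.
  rewrite /I /Rintegral fineK//; apply: integrable_fin_num => //.
  by apply: (@continuous_integrable (fun x => F x y)); apply: (cpair id (fun=> y)).
rewrite {1}/I /Rintegral; under eq_integral do rewrite E1.
rewrite [RHS]/I /Rintegral; under [in RHS]eq_integral do rewrite E2.
by rewrite (Fubini Fi).
Qed.

Lemma haar_invariant_mean : invariant_mean (fun f : B -> R => \int[m]_x f x).
Proof.
by split=> [a f g|f _|f x| | |];
  [exact: I_linear|exact: I_ge0|exact: I_gt0|exact: I_1|exact: I_translate|
   exact: I_exchange].
Qed.

End HaarMean.

(** * Characters of second countable compact groups *)

Section ComplexContinuity.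
Variable R : realType.

Lemma normc_leD (a b : R) : `|Complex a b| <= (`|a| + `|b|)%:C%C.
Proof.
have -> : Complex a b = Complex a 0 + Complex 0 b by simpc.
apply: le_trans (ler_normD _ _) _.
by rewrite !normc_def /= !expr0n /= addr0 add0r !sqrtr_sqr rmorphD.
Qed.

Lemma continuous_complex (T : topologicalType) (f g : T -> R) :
  continuous f -> continuous g ->
  continuous (fun x => Complex (f x) (g x) : R[i]^o).
Proof.
move=> cf cg x V /nbhs_ballP[[e ei] /=]; rewrite ltcE /= => /andP[/eqP-> e0] eV.
have e2 : 0 < e / 2 by rewrite divr_gt0.
have /cvgrPdist_lt/(_ _ e2) h1 := cf x; have /cvgrPdist_lt/(_ _ e2) h2 := cg x.
apply: (@filterS2 _ (nbhs x) _ _ _ _ _ h1 h2) => z /= hf hg.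
apply: eV; rewrite -ball_normE /=.
have -> : Complex (f x) (g x) - Complex (f z) (g z) = Complex (f x - f z) (g x - g z).
  by simpc.
apply: le_lt_trans (normc_leD _ _) _; rewrite ltcR; lra.
Qed.

End ComplexContinuity.

Section Characters.
Variables (R : realType) (B : compactAbGroupType) (m : probability (borel B) R).
Hypotheses (B2 : @second_countable B) (mh : is_haar m).

Local Notation character := (linear_character R (top_sigma B)).

Let im := haar_invariant_mean B2 mh.

Lemma normal_group : normal_space B.
Proof.
by apply: compact_normal; [exact: hausdorff_setT|exact: compact_setT].
Qed.

Lemma closed_point (x : B) : closed [set x].
Proof. by apply: accessible_closed_set1; apply: hausdorff_accessible; exact: hausdorff_setT. Qed.

Lemma characters_separate (b : B) : b != 0 -> exists chi : character, chi b != 1.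
Proof.
move=> b0.
(* Urysohn's lemma separates 0 from both [b] and [- b], so the symmetrized function is 0 at 0 and 2
   at [b]. *)
have AB : [set (0 : B)] `&` ([set b] `|` [set - b]) = set0.
  apply/seteqP; split=> // x [-> [|]] /=.
    by move=> h; move: b0; rewrite -h eqxx.
  by move=> /eqP; rewrite eq_sym oppr_eq0 (negbTE b0).
have := normal_group; move/normal_separatorP => /(_ R _ _ (@closed_point 0)
  (closedU (@closed_point b) (@closed_point (- b))) AB).
move/(@uniform_separatorP _ R) => [f [cf _ f0 f1]].
have {}f0 : f 0 = 0 by apply: f0; exists 0.
have fb : f b = 1 by apply: f1; exists b => //; left.
have fNb : f (- b) = 1 by apply: f1; exists (- b) => //; right.
have cN : continuous (fun x : B => - x) by apply: continuous_oppg => x; exact: cvg_id.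
have cv : continuous (fun x => f x + f (- x)).
  move=> x; apply: (@cvgD _ R^o); first exact: cf.
  exact: (continuous_compT cN cf).
pose v := CFun cv.
have ev : even v by move=> x /=; rewrite opprK addrC.
have [|e [e0 eb e1 eE]] := cosine_separates (b := b) im ev.
  by rewrite /= oppr0 f0 fb fNb addr0 -[_ + _]/(2 : R) pnatr_eq0.
pose c x := e x / e 0.
have en0 : e 0 != 0 by exact: lt0r_neq0.
have c0 : c 0 = 1 by rewrite /c divff.
have c1 x : c x ^+ 2 <= 1.
  by rewrite /c expr_div_n ler_pdivrMr ?exprn_gt0// mul1r.
have cE x y : c (x + y) + c (x - y) = 2 * c x * c y.
  apply: (mulfI en0); have -> : c (x + y) + c (x - y) = (e (x - y) + e (x + y)) / e 0.
    by rewrite /c; field.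
  by rewrite [LHS]mulrA eE /c; field.
have cc : continuous c.
  by move=> x; apply: cvgM; [exact: cfun_cont|exact: cvg_cst].
have [k [a [h1 h2 h3]]] := dalembert_sine c0 c1 cE.
pose s x := k * (c (x - a) - c (x + a)).
have ct (d : B) : continuous (fun x => c (x + d)).
  apply: continuous_compT cc; apply: continuous_addg => x; first exact: cvg_id.
  exact: cvg_cst.
have cs : continuous s.
  move=> x; apply: cvgM; first exact: cvg_cst.
  by apply: (@cvgB _ R^o); exact: ct.
pose chi x : R[i] := Complex (c x) (s x).
have chiD x y : chi (x + y) = chi x * chi y.
  by rewrite /chi h1 {1}/s h2 -/(s x) -/(s y); simpc; congr Complex; rewrite addrC.
have chiN x : `|chi x| = 1.
  by rewrite normc_def /= h3 sqrtr1.
have chiC : scontinuous (top_sigma B) (chi : B -> R[i]^o).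
  by move=> V oV; have /continuousP := continuous_complex cc cs; apply.
exists (LinearCharacter chiD chiN chiC) => /=.
apply: contra_neq eb => /(congr1 (@complex.Re R)) /= cb.
by move: cb; rewrite /c => /(congr1 (fun t => t * e 0)); rewrite divfK ?mul1r.
Qed.

Let F := <<s @fourier_generators R B (top_sigma B) >>.

Let F_preimage (chi : character) (V : set R[i]^o) : open V -> F (chi @^-1` V).
Proof. by move=> oV; apply: sub_sigma_algebra; exists chi, V. Qed.

Let F_meas (S : set B) :
  F S = (@measurable _ (generated B (@fourier_generators R B (top_sigma B)))) S.
Proof. by []. Qed.

(** For each [y] outside [U] a character splits a measurable neighbourhood of [x] from a
    neighbourhood of [y]; compactness of the complement of [U] leaves finitely many of them to
    intersect. *)
Lemma open_fourier_nbhs (U : set B) (x : B) : open U -> U x ->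
  exists N, [/\ F N, nbhs x N & N `<=` U].
Proof.
move=> oU Ux.
pose NN (N : set B) := F N /\ nbhs x N.
(* The filter expresses: for all sufficiently small measurable neighbourhoods of [x]. The finite
   intersection is hidden in its being a filter. *)
have fN : Filter (filter_from NN (fun N0 => [set N | NN N /\ N `<=` N0])).
  apply: filter_from_filter; first by exists setT; split; [rewrite F_meas; exact: measurableT|exact: filterT].
  move=> N1 N2 [F1 n1] [F2 n2]; exists (N1 `&` N2).
    split; last exact: filterI.
    exact: (@measurableI _ (generated B (@fourier_generators R B (top_sigma B)))).
  by move=> N [NNN sN]; split; split=> //; apply: subset_trans sN _ => y [].
have cU : compact (~` U).
  by apply: (subclosed_compact _ (@compact_setT B)) => //; exact: open_closedC.
move/compact_near_coveringP : cU => /(_ _ _ (fun N y => ~ N y) fN) [].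
  move=> y nUy; have xy : x - y != 0.
    by apply: contra_notN nUy; rewrite subr_eq0 => /eqP <-.
  have [chi chi1] := characters_separate xy.
  have chixy : chi x != chi y.
    apply: contra_neq chi1 => h; have := charD chi (x - y) y.
    rewrite subrK h => /(congr1 (fun t => t / chi y)).
    by rewrite mulfK ?divff// -normr_eq0 char_norm oner_eq0.
  pose r := `|chi x - chi y| / 2.
  have r0 : 0 < r by rewrite divr_gt0// normr_gt0 subr_eq0.
  pose Vx := @ball _ R[i]^o (chi x) r; pose Vy := @ball _ R[i]^o (chi y) r.
  have oVx : open Vx by exact: ball_open.
  have oVy : open Vy by exact: ball_open.
  have oc (V : set R[i]^o) : open V -> open (chi @^-1` V).
    by move=> oV; exact: (@char_cont _ _ _ chi V oV).
  have bx : Vx (chi x) by exact: (@ballxx R[i] R[i]^o (chi x) r r0).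
  have by_ : Vy (chi y) by exact: (@ballxx R[i] R[i]^o (chi y) r r0).
  have nx : nbhs x (chi @^-1` Vx) by exact: open_nbhs_nbhs (conj (oc _ oVx) bx).
  have ny : nbhs y (chi @^-1` Vy) by exact: open_nbhs_nbhs (conj (oc _ oVy) by_).
  exists (chi @^-1` Vy, [set N | NN N /\ N `<=` chi @^-1` Vx]); first split.
  - exact: ny.
  - exists (chi @^-1` Vx); last exact: subset_refl.
    exact: (conj (F_preimage chi oVx) nx).
  move=> [z N] /= [Vyz [_ NV]] /NV; move: Vyz.
  rewrite /= /Vx /Vy -!ball_normE /= => h1 h2.
  have := ler_distD (chi z) (chi x) (chi y); rewrite (distrC (chi z) (chi y)).
  move=> /le_lt_trans /(_ (ltrD h2 h1)); rewrite /r -mulr2n.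
  by rewrite -[ltRHS]mulr_natr divfK ?pnatr_eq0// ltxx.
move=> N0 [FN0 nN0] h; exists N0; split=> // y N0y; apply: contrapT => nUy.
exact: (h N0 (conj (conj FN0 nN0) (@subset_refl _ N0)) y nUy N0y).
Qed.

(** The neighbourhoods just found are indexed by points. Choosing one for each basic set that fits
    into such a neighbourhood leaves a countable union. *)
Lemma open_fourier_measurable (U : set B) : open U -> F U.
Proof.
move=> oU; have [b [ob bb]] := second_countable_seq B2.
have /choice[N HN] n : exists N, [/\ F N, N `<=` U &
    (exists N', [/\ F N', N' `<=` U & b n `<=` N']) -> b n `<=` N].
  have [[N' [h1 h2 h3]]|h] := pselect (exists N', [/\ F N', N' `<=` U & b n `<=` N']).
    by exists N'.
  by exists set0; split=> //; rewrite F_meas; exact: measurable0.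
have -> : U = \bigcup_n N n.
  apply/seteqP; split=> [x Ux|x [n _]]; last by have [_ h _] := HN n; exact: h.
  have [N' [h1 h2 h3]] := open_fourier_nbhs oU Ux.
  have [n [bx bN]] := bb _ _ h2; exists n => //.
  by have [_ _ h] := HN n; apply: h => //; exists N'.
by rewrite F_meas; apply: bigcupT_measurable => n; have [] := HN n.
Qed.

End Characters.

(** * Saturation and the ultralimit measure *)

Section Saturation.
Variables (omega : set_system nat) (Uomega : UltraFilter omega).
Hypothesis omega_free : forall n : nat, omega <> principal_filter n.
Variable A : nat -> compactAbGroupType.

Local Notation G := (ultraprod Uomega A).

Lemma free_ultrafilter_ge k : omega [set i | (k <= i)%N].
Proof.
have pt n : omega (~` [set n]).
  have [h|//] := in_ultra_setVsetC [set n] Uomega.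
  exfalso; apply: (omega_free (n := n)); apply/seteqP; split=> S; last first.
    by move=> Sn; apply: filterS h => _ ->; exact: Sn.
  move=> oS; have : omega (S `&` [set n]) by exact: filterI.
  by move=> /filter_ex[i [Si /= ein]] j ->; rewrite -ein.
elim: k => [|k IH]; first by apply: filterS (@filterT _ omega _) => i _.
by apply: filterS2 IH (pt k) => i /= ki ik; rewrite ltn_neqAle ki eq_sym andbT; apply/eqP.
Qed.

(** The step that needs an ultrafilter rather than a filter: internal sets are closed under
    complement. *)
Lemma uprodC (S : forall i, set (A i)) :
  ~` @uprod omega Uomega A S = @uprod omega Uomega A (fun i => ~` S i).
Proof.
apply/seteqP; split=> z; have [x ->] := uclass_surj z.
  move=> /uprodP nS; apply/uprodP.
  by have [//|h] := in_ultra_setVsetC [set i | S i (x i)] Uomega.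
move=> /uprodP nS /uprodP yS.
by have /filter_ex[i []] : omega ([set i | S i (x i)] `&` [set i | (~` S i) (x i)]) by exact: filterI.
Qed.

(** A diagonal choice: coordinate [i] satisfies the longest initial block of conditions, of index at
    most [i], that is satisfiable there. Condition [k] then holds wherever [k <= i] and the block up
    to [k] is satisfiable, a set in [omega] because tails belong to it. *)
Lemma internal_saturation (T : nat -> forall i, set (A i)) :
  (forall n, exists z : G, forall k, (k <= n)%N -> @uprod omega Uomega A (T k) z) ->
  exists z : G, forall k, @uprod omega Uomega A (T k) z.
Proof.
move=> fip.
pose P n i := exists a : A i, forall k, (k <= n)%N -> T k i a.
have oP n : omega (P n).
  have [z] := fip n; have [x ->] := uclass_surj z => xT.
  have : omega [set i | forall k, (k <= n)%N -> T k i (x i)].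
    elim: n xT {fip} => [|n IH] xT.
      have /uprodP h := xT 0%N (leqnn 0).
      by apply: filterS h => i /= Ti k; rewrite leqn0 => /eqP ->.
    have /uprodP h := xT n.+1 (leqnn _).
    apply: filterS2 h (IH (fun k kn => xT k (leqW kn))) => i /= h1 h2 k.
    by rewrite leq_eqVlt => /orP[/eqP -> //|]; exact: h2.
  by apply: filterS => i h; exists (x i).
have ch i : exists a : A i, forall n, (n <= i)%N -> P n i ->
    forall k, (k <= n)%N -> T k i a.
  suff : forall N, exists a : A i, forall n, (n <= N)%N -> P n i ->
    forall k, (k <= n)%N -> T k i a by apply.
  elim=> [|N [a aN]].
    have [[a aP]|nP] := pselect (P 0%N i); last first.
      by exists 0 => n; rewrite leqn0 => /eqP -> /nP.
    by exists a => n; rewrite leqn0 => /eqP -> _; exact: aP.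
  have [[b bP]|nP] := pselect (P N.+1 i); last first.
    by exists a => n; rewrite leq_eqVlt => /orP[/eqP -> /nP //|]; exact: aN.
  by exists b => n nN _ k kn; apply: bP; exact: leq_trans kn nN.
pose x i : A i := projT1 (cid (ch i)).
have xP i := projT2 (cid (ch i)).
exists (@uclass omega Uomega A x) => k; apply/uprodP.
apply: filterS2 (free_ultrafilter_ge k) (oP k) => i /= ki Pki.
exact: xP ki Pki k (leqnn k).
Qed.

(** The complement of each [F n] is a countable union of internal sets, so [F n] is a countable
    intersection of internal ones; all of them are listed in one sequence. *)
Lemma closed_saturation (F : nat -> set G) :
  (forall n, uopen (~` F n)) ->
  (forall n, exists z, forall k, (k <= n)%N -> F k z) ->
  exists z, forall n, F n z.
Proof.
move=> oF fip.
have /choice[S SF] n : exists S : nat -> forall i, set (A i),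
    ~` F n = \bigcup_p @uprod omega Uomega A (S p).
  have [H sH ->] := oF n.
  have /choice[S HS] p : exists S : forall i, set (A i), H p = @uprod omega Uomega A S.
    by have [S _ ->] := sH p; exists S.
  by exists S; apply: eq_bigcupr => p _; exact: HS.
(* [nm k] names the closed set from which the [k]-th internal set comes, so finitely many internal
   conditions involve finitely many of the [F n]. *)
pose nm k : nat := if unpickle k is Some (n, p) then (n + 0 * p)%N else 0%N.
pose T k : forall i, set (A i) := if unpickle k is Some (n, p)
  then fun i => ~` S n p i else fun i => setT.
have TE n p z : F n z -> @uprod omega Uomega A (fun i => ~` S n p i) z.
  move=> Fz; rewrite -uprodC => Sz.
  suff : (~` F n) z by exact.
  by rewrite SF; exists p.
have uT z : @uprod omega Uomega A (fun i => (setT : set (A i))) z.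
  by have [x ->] := uclass_surj z; apply/uprodP; exact: filterT.
have [|z zT] := @internal_saturation T.
  move=> K; have [z zF] := fip (\max_(k < K.+1) nm k)%N.
  exists z => k kK; have h := @leq_bigmax _ (fun k : 'I_K.+1 => nm k) (Ordinal (n := K.+1) (m := k) kK).
  move: h; rewrite /T /nm /=; case: unpickle => [[n p]|] h; last exact: uT.
  by apply: TE; apply: zF; rewrite addn0 in h.
exists z => n; apply: contrapT => nF.
have : (~` F n) z by [].
rewrite SF => -[p _ Sz].
have := zT (pickle (n, p)); rewrite /T pickleK => h.
have : (~` @uprod omega Uomega A (S n p)) z by rewrite uprodC.
exact.
Qed.

(** For [y] in the closure, the conditions [C x] and [phi x] in the closure of every basic set
    around [y] are finitely satisfiable. Saturation gives one [x] for all of them, and the Hausdorff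
    property forces [phi x = y]. *)
Lemma image_closed (B : compactAbGroupType) (phi : G -> B) (C : set G) :
  @second_countable B -> scontinuous (ultra_sigma Uomega A) phi ->
  uopen (~` C) -> closed (phi @` C).
Proof.
move=> B2 cphi oC y yC; have [b [ob bb]] := second_countable_seq B2.
pose F n : set G := if n is n'.+1 then
  (if `[< b n' y >] then phi @^-1` closure (b n') else setT) else C.
have [||x xF] := @closed_saturation F.
- case=> [//|n]; rewrite /F; case: asboolP => _.
    rewrite preimage_setC; apply: cphi; apply: closed_openC.
    exact: closed_closure.
  by rewrite setCT; exact: uopen0.
- move=> n.
  have : nbhs y [set z | forall k, (k < n)%N -> b k y -> b k z].
    elim: n => [|n IH]; first by apply: filterS (@filterT _ (nbhs y) _) => z _ k.
    have [by_|nby] := pselect (b n y); last first.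
      apply: filterS IH => z h k; rewrite ltnS leq_eqVlt => /orP[/eqP -> /nby //|].
      exact: h.
    have : nbhs y (b n) by exact: open_nbhs_nbhs.
    apply: filterS2 IH => z h bz k; rewrite ltnS leq_eqVlt => /orP[/eqP -> //|].
    exact: h.
  move=> /yC[_ [[x Cx <-] xb]]; exists x => -[//|k] kn /=.
  by case: asboolP => // /(xb k kn) h; apply: subset_closure.
exists x; first exact: (xF 0%N).
apply: contrapT => /eqP xy.
have [[U V] /= [Ux Vy] [oU oV /eqP UV0]] : exists2 AB, (phi x \in AB.1 /\ y \in AB.2) &
    [/\ open AB.1, open AB.2 & AB.1 `&` AB.2 == set0].
  by move: (@hausdorff_setT B); rewrite open_hausdorff; apply.
rewrite !inE in Ux Vy.
have [n [by_ bV]] := bb y V (open_nbhs_nbhs (conj oV Vy)).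
have := xF n.+1; rewrite /F asboolT// => /(_ U (open_nbhs_nbhs (conj oU Ux))).
by move=> [z [/bV Vz Uz]]; have : (U `&` V) z by []; rewrite UV0.
Qed.

End Saturation.

Section UltralimitMeasure.
Variables (R : realType) (omega : set_system nat) (Uomega : UltraFilter omega).
Variable A : nat -> compactAbGroupType.
Local Notation G := (ultraprod Uomega A).
Local Notation X := (ultra_sigma Uomega A).
Local Notation E := (@strongly_open omega Uomega A).

Lemma uopen_measurable (U : set G) : uopen U -> (@measurable _ (generated G E)) U.
Proof.
move=> [F sF ->]; apply: (@bigcupT_measurable _ (generated G E)) => n.
by apply: sub_sigma_algebra; exact: sF.
Qed.

Lemma scontinuous_measurable (B : compactAbGroupType) (phi : G -> B) :
  scontinuous X phi ->
  measurable_fun setT (phi : generated G E -> borel B).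
Proof.
move=> cphi; apply: (@measurable_fun_generated G B E open) => S oS.
by apply: uopen_measurable; exact: cphi.
Qed.

Lemma uclassD (x y : seqs A) :
  @uclass omega Uomega A x + @uclass omega Uomega A y = @uclass omega Uomega A (x + y).
Proof. by rewrite /uclass raddfD. Qed.

Lemma uprod_translate (S : forall i, set (A i)) (x : seqs A) :
  (fun z : G => @uclass omega Uomega A x + z) @^-1` @uprod omega Uomega A S =
  @uprod omega Uomega A (fun i => (fun a : A i => x i + a) @^-1` S i).
Proof.
apply/seteqP; split=> z; have [y ->] := uclass_surj z.
  by rewrite /= uclassD => /uprodP h; apply/uprodP; apply: filterS h.
by move=> /uprodP h; rewrite /= uclassD; apply/uprodP; apply: filterS h.
Qed.

Variables (m : forall i, probability (borel (A i)) R) (m_haar : forall i, is_haar (m i)).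
Variables (mu : {measure set (generated G E) -> \bar R}) (mu_lim : is_ultralimit_measure m mu).

Lemma strongly_openT : E setT.
Proof.
exists (fun i => setT) => [i|]; first exact: openT.
apply/seteqP; split=> // z _; have [y ->] := uclass_surj z.
by apply/uprodP; exact: filterT.
Qed.

Lemma ultralimit_setT : mu setT = 1%E.
Proof.
have -> : [set: G] = @uprod omega Uomega A (fun i => (setT : set (A i))).
  apply/seteqP; split=> // z _; have [x ->] := uclass_surj z.
  by apply/uprodP; exact: filterT.
have h := mu_lim (fun i => openT : open (setT : set (A i))).
apply: (cvg_unique (@ereal_hausdorff R) h).
have -> : (fun i => m i setT) = fun=> 1%E.
  by apply/funext => i; exact: probability_setT.
exact: cvg_cst.
Qed.

(** A translate of an ultraproduct of open sets is the ultraproduct of translates. The two measures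
    therefore agree on strongly open sets, which are stable under intersection and generate. *)
Lemma ultralimit_translation_invariant : translation_invariant mu.
Proof.
move=> a; have [x ->] := uclass_surj a.
have oS (S : forall i, set (A i)) : (forall i, open (S i)) ->
    forall i, open ((fun a : A i => x i + a) @^-1` S i).
  by move=> oS i; have /continuousP := @continuous_translate (A i) (x i); apply; exact: oS.
have ma : measurable_fun setT
    ((fun z : G => @uclass omega Uomega A x + z) : generated G E -> generated G E).
  apply: (@measurable_fun_generated G G E E) => _ [S oS' ->].
  rewrite uprod_translate; apply: sub_sigma_algebra.
  by exists (fun i => (fun a : A i => x i + a) @^-1` S i); [exact: (oS S oS')|].
split=> // S mS.
pose nu := pushforward mu
  ((fun z : G => @uclass omega Uomega A x + z) : generated G E -> generated G E).
apply: (@measure_unique _ R (generated G E) E (fun=> setT) _ _ _ _ nu mu) => //.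
- by move=> U V; exact: strongly_openI.
- by move=> _; exact: strongly_openT.
- by rewrite bigcup_const//; exists 0%N.
- move=> _ [T oT ->].
  transitivity (mu (@uprod omega Uomega A (fun i => (fun a : A i => x i + a) @^-1` T i))).
    by rewrite -uprod_translate.
  have h1 := mu_lim oT; have h2 := mu_lim (oS _ oT).
  apply: (cvg_unique (@ereal_hausdorff R) h2).
  suff -> : (fun i => m i ((fun a : A i => x i + a) @^-1` T i)) = (fun i => m i (T i)) by [].
  apply/funext => i; have [_] := haar_translation_invariant (m_haar i) (x i).
  by apply; exact: open_borel.
- by move=> _; have h : nu setT = 1%E := ultralimit_setT; rewrite [ltLHS]h ltry.
Qed.

End UltralimitMeasure.

(** * The group defined by a sequence of characters *)

Lemma normr_normc (R : rcfType) (z : R[i]) : `|z| = (normc z)%:C%C.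
Proof. by rewrite normc_def; case: z. Qed.

Lemma ltc_normc (R : rcfType) (z : R[i]) (r : R) : (`|z| < r%:C%C) = (normc z < r).
Proof. by rewrite normr_normc ltcR. Qed.

Lemma ball_normc (R : realType) (z w : R[i]) (r : R) :
  @ball _ R[i]^o z r%:C%C w <-> normc (w - z) < r.
Proof. by rewrite -ball_normE /= distrC ltc_normc. Qed.

Lemma nbhs_normc (R : realType) (z : R[i]) (V : set R[i]^o) :
  nbhs (z : R[i]^o) V -> exists2 r : R, 0 < r & forall w, normc (w - z) < r -> V w.
Proof.
move=> /nbhs_ballP[[r ri] /=]; rewrite ltcE /= => /andP[/eqP-> r0] rV.
by exists r => // w h; apply: rV; apply/ball_normc.
Qed.

Record separating_characters (R : realType) (Q : zmodType) := SeparatingCharacters {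
  sep_char :> nat -> Q -> R[i];
  sep_charD : forall n x y, sep_char n (x + y) = sep_char n x * sep_char n y;
  sep_char_norm : forall n x, normc (sep_char n x) = 1;
  sep_char_inj : forall x y, (forall n, sep_char n x = sep_char n y) -> x = y
}.

(** An alias of [Q] that remembers [c], to which the topology defined by [c] can be attached. *)
Definition char_group (R : realType) (Q : zmodType) (c : separating_characters R Q) : Type := Q.

Section CharGroup.
Variables (R : realType) (Q : zmodType) (c : separating_characters R Q).

HB.instance Definition _ := GRing.Zmodule.on (char_group c).
Local Notation B := (char_group c).

(** An invariant length: on the unit circle the distance to 1 is symmetric and subadditive. *)
Definition char_length n (x : B) : R := normc (c n x - 1).

Lemma sep_char0 n : c n 0 = 1.
Proof.
have h := sep_charD c n 0 0; rewrite addr0 in h.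
have c0 : c n 0 != 0.
  apply/negP => /eqP h0; have := sep_char_norm c n 0.
  by rewrite h0 normc0 => /eqP; rewrite eq_sym oner_eq0.
by apply: (mulfI c0); rewrite -h mulr1.
Qed.

Lemma char_lengthB n (x y : B) : char_length n (x - y) = normc (c n x - c n y).
Proof.
have <- : c n (x - y) * c n y = c n x by rewrite -sep_charD subrK.
have -> : c n (x - y) * c n y - c n y = (c n (x - y) - 1) * c n y.
  by rewrite mulrBl mul1r.
by rewrite normcM sep_char_norm mulr1.
Qed.

Lemma char_lengthN n (x : B) : char_length n (- x) = char_length n x.
Proof.
rewrite -sub0r char_lengthB -normcN opprB sep_char0.
by [].
Qed.

Lemma char_lengthD n (x y : B) :
  char_length n (x + y) <= char_length n x + char_length n y.
Proof.
have -> : x + y = x - (- y) by rewrite opprK.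
rewrite char_lengthB -(char_lengthN n y) /char_length.
have -> : c n x - c n (- y) = (c n x - 1) + - (c n (- y) - 1).
  by rewrite opprB addrA subrK.
by apply: le_trans (le_normcD _ _) _; rewrite normcN.
Qed.

Lemma char_length0 n : char_length n 0 = 0.
Proof. by rewrite /char_length sep_char0 subrr normc0. Qed.

(** A single index bounds both the number of characters and the radius, which gives a countable base
    at 0 of the topology induced by the characters. *)
Definition char_ball n (x : B) := forall k, (k <= n)%N -> char_length k x < n.+1%:R^-1.

Lemma char_ball0 n : char_ball n 0.
Proof. by move=> k _; rewrite char_length0 invr_gt0. Qed.

Lemma char_ballN n x : char_ball n x -> char_ball n (- x).
Proof. by move=> h k kn; rewrite char_lengthN h. Qed.

Lemma char_ball_le n m x : (n <= m)%N -> char_ball m x -> char_ball n x.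
Proof.
move=> nm h k kn; apply: lt_le_trans (h k (leq_trans kn nm)) _.
by rewrite lef_pV2 ?posrE// ler_nat.
Qed.

(** The radius at index [n.*2.+1] is exactly half of that at [n]. *)
Lemma char_ballD n x y : char_ball n.*2.+1 x -> char_ball n.*2.+1 y -> char_ball n (x + y).
Proof.
move=> hx hy k kn; apply: le_lt_trans (char_lengthD _ _ _) _.
have k2 : (k <= n.*2.+1)%N by rewrite (leq_trans kn)// -addnn -addnS leq_addr.
have := hx k k2; have := hy k k2.
have -> : n.*2.+2%:R^-1 = n.+1%:R^-1 / 2 :> R.
  by rewrite -invfM -natrM; congr (_%:R^-1); rewrite -addnn; lia.
set r := n.+1%:R^-1; lra.
Qed.

(** Finitely many strict inequalities leave a common margin [d]. *)
Lemma char_ball_open n x : char_ball n x ->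
  exists m, forall y, char_ball m y -> char_ball n (x + y).
Proof.
move=> hx.
have [d d0 hd] : exists2 d : R, 0 < d &
    forall k, (k <= n)%N -> char_length k x + d <= n.+1%:R^-1.
  rewrite /char_ball in hx; move: (n.+1%:R^-1 : R) hx => r.
  elim: n => [|n IH] h.
    exists (r - char_length 0 x); first by rewrite subr_gt0 h.
    by move=> k; rewrite leqn0 => /eqP ->; rewrite addrC subrK.
  have [d d0 hd] := IH (fun k kn => h k (leqW kn)).
  exists (Num.min d (r - char_length n.+1 x)).
    by rewrite lt_min d0 subr_gt0 h.
  move=> k; rewrite leq_eqVlt => /orP[/eqP ->|kn].
    by rewrite addrC -lerBrDr ge_min lexx orbT.
  by apply: le_trans (hd k kn); rewrite lerD2l ge_min lexx.
have [m] := ltr_add_invr d0; rewrite add0r => md.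
exists (maxn m n) => y hy k kn; apply: le_lt_trans (char_lengthD _ _ _) _.
apply: lt_le_trans (hd k kn); rewrite ltrD2l.
apply: lt_trans md; apply: lt_le_trans (hy k _) _; first by rewrite (leq_trans kn)// leq_maxr.
by rewrite lef_pV2 ?posrE// ler_nat ltnS leq_maxl.
Qed.

Definition char_nbhs (x : B) : set_system B :=
  [set U | exists n, forall y, char_ball n (y - x) -> U y].

HB.instance Definition _ := hasNbhs.Build B char_nbhs.

Lemma char_nbhs_filter (x : B) : ProperFilter (nbhs x).
Proof.
apply: Build_ProperFilter_ex => [U [n nU]|].
  by exists x; apply: nU; rewrite subrr; exact: char_ball0.
split; first by exists 0%N.
- move=> U V [n nU] [k kV]; exists (maxn n k) => y hy; split.
    by apply: nU; apply: char_ball_le hy; exact: leq_maxl.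
  by apply: kV; apply: char_ball_le hy; exact: leq_maxr.
- by move=> U V UV [n nU]; exists n => y /nU /UV.
Qed.

Lemma char_nbhs_singleton (x : B) (U : set B) : nbhs x U -> U x.
Proof. by move=> [n]; apply; rewrite subrr; exact: char_ball0. Qed.

Lemma char_nbhs_nbhs (x : B) (U : set B) : nbhs x U -> nbhs x (nbhs^~ U).
Proof.
move=> [n nU]; exists n.*2.+1 => y hy; exists n.*2.+1 => z hz.
by apply: nU; rewrite -(subrK y z) -addrA; exact: char_ballD.
Qed.

HB.instance Definition _ := Nbhs_isNbhsTopological.Build B
  char_nbhs_filter char_nbhs_singleton char_nbhs_nbhs.

Lemma char_sub_continuous : continuous (fun p : B * B => p.1 - p.2).
Proof.
move=> [x y] U [n nU] /=.
exists ([set z | char_ball n.*2.+1 (z - x)], [set z | char_ball n.*2.+1 (z - y)]).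
  by split; exists n.*2.+1.
move=> [z w] /= [hz hw]; apply: nU.
have -> : z - w - (x - y) = (z - x) - (w - y).
  by rewrite !opprB [y - x]addrC addrACA [- w + y]addrC.
by apply: char_ballD => //; exact: char_ballN.
Qed.

HB.instance Definition _ :=
  PreTopologicalNmodule_isTopologicalZmodule.Build B char_sub_continuous.

Lemma char_hausdorff : hausdorff_space B.
Proof.
move=> x y xy; apply: (sep_char_inj (s := c)) => k; apply/eqP.
rewrite -subr_eq0; apply/negPn/negP => h.
have l0 : 0 < char_length k (x - y).
  rewrite char_lengthB lt_neqAle eq_sym; apply/andP; split.
    by apply: contra_neq h; exact: eq0_normc.
  by case: (_ - _) => a b; exact: sqrtr_ge0.
have [n] := ltr_add_invr l0; rewrite add0r => nl.
pose p := maxn n k.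
have [z [zx zy]] := xy [set z | char_ball p.*2.+1 (z - x)] [set z | char_ball p.*2.+1 (z - y)]
  (ex_intro _ _ (fun _ h => h)) (ex_intro _ _ (fun _ h => h)).
have /(_ k (leq_maxr _ _)) : char_ball p (x - y).
  by rewrite -(subrK z x) -addrA; apply: char_ballD => //; rewrite -opprB; exact: char_ballN.
apply/negP; rewrite -leNgt; apply: ltW; apply: le_lt_trans nl.
by rewrite lef_pV2 ?posrE// ler_nat ltnS leq_maxl.
Qed.

Lemma open_char_ball n x : open [set y : B | char_ball n (y - x)].
Proof.
rewrite openE => y /char_ball_open[k hk]; exists k => z hz /=.
by have := hk _ hz; rewrite addrC addrA subrK.
Qed.

Lemma sep_char_continuous n : continuous (c n : B -> R[i]^o).
Proof.
move=> x V /nbhs_normc[r r0 rV].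
have [k] := ltr_add_invr r0; rewrite add0r => kr.
exists (maxn k n) => y /(_ n (leq_maxr _ _)); rewrite char_lengthB => h.
apply: rV; apply: lt_trans h (le_lt_trans _ kr).
by rewrite lef_pV2 ?posrE// ler_nat ltnS leq_maxl.
Qed.

Lemma ultra_limit (F : set_system B) (f : B -> R) : UltraFilter F ->
  (forall x, `|f x| <= 1) -> exists r : R, forall e : R, 0 < e -> F [set x | `|f x - r| < e].
Proof.
move=> UF f1.
have cI := @segment_compact R (-1) 1.
have PF : ProperFilter (f @ F) by exact: fmap_proper_filter.
have [|r [_ rc]] := cI (f @ F) PF.
  apply: (@filterS _ F _ setT _ _ filterT) => x _.
  by have := f1 x; rewrite ler_norml /= in_itv.
exists r => e e0; have [//|h] := in_ultra_setVsetC [set x | `|f x - r| < e] UF.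
have [z [zA]] := rc [set f x | x in ~` [set x | `|f x - r| < e]] (ball r e)
  (@filterS _ F _ _ _ (fun x h => ex_intro2 _ _ x h erefl) h) (nbhsx_ballx _ _ e0).
by case: zA => x /= nx <-; rewrite /ball /= distrC => /nx.
Qed.

Lemma ultra_limitC (F : set_system B) (f : B -> R[i]) : UltraFilter F ->
  (forall x, normc (f x) <= 1) ->
  exists z : R[i], forall e : R, 0 < e -> F [set x | normc (f x - z) < e].
Proof.
move=> UF f1.
have n1 (x y : R) : `|x| <= normc (Complex x y) /\ `|y| <= normc (Complex x y).
  by split; rewrite /= -[leLHS]sqrtr_sqr ler_sqrt ?addr_ge0 ?sqr_ge0// ?lerDl ?lerDr sqr_ge0.
have [|a ha] := @ultra_limit F (fun x => complex.Re (f x)) UF.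
  by move=> x; apply: le_trans (f1 x); case: (f x) => p q; have [] := n1 p q.
have [|b hb] := @ultra_limit F (fun x => complex.Im (f x)) UF.
  by move=> x; apply: le_trans (f1 x); case: (f x) => p q; have [] := n1 p q.
exists (Complex a b) => e e0; have e2 : 0 < e / 2 by rewrite divr_gt0.
apply: filterS2 (ha _ e2) (hb _ e2) => x h1 h2.
have {}h1 : `|complex.Re (f x) - a| < e / 2 := h1.
have {}h2 : `|complex.Im (f x) - b| < e / 2 := h2.
change (normc (f x - Complex a b) < e); rewrite -ltc_normc.
move: h1 h2; case: (f x) => p q /= h1 h2.
rewrite (_ : Complex p q - Complex a b = Complex (p - a) (q - b)); last by simpc.
by apply: le_lt_trans (normc_leD _ _) _; rewrite ltcR; lra.
Qed.

(** The image of [B] in the product of circles is closed; [n] measures both the number of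
    coordinates and the precision. Saturation supplies this for quotients of the ultraproduct. *)
Hypothesis range_closed : forall z : nat -> R[i],
  (forall n, exists x, forall k, (k <= n)%N -> normc (c k x - z k) <= n.+1%:R^-1) ->
  exists x, forall k, c k x = z k.

(** Along an ultrafilter every character has a limit, and [range_closed] provides a point at which
    the characters take these limit values. *)
Lemma char_compact : compact [set: B].
Proof.
rewrite compact_ultra => F UF _.
have /choice[z hz] k : exists z : R[i], forall e : R, 0 < e -> F [set x | normc (c k x - z) < e].
  by apply: ultra_limitC => x; rewrite sep_char_norm.
have Fk n (e : R) : 0 < e -> F [set x | forall k, (k <= n)%N -> normc (c k x - z k) < e].
  move=> e0; elim: n => [|n IH].
    by apply: filterS (hz 0%N _ e0) => x /= h k; rewrite leqn0 => /eqP ->.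
  apply: filterS2 IH (hz n.+1 _ e0) => x /= h h' k.
  by rewrite leq_eqVlt => /orP[/eqP -> //|]; exact: h.
have [|x hx] := @range_closed z.
  move=> n; have n0 : 0 < n.+1%:R^-1 :> R by rewrite invr_gt0.
  by have /filter_ex[x h] := Fk n _ n0; exists x => k kn; rewrite ltW// h.
exists x; split=> // U [n nU].
have n0 : 0 < n.+1%:R^-1 :> R by rewrite invr_gt0.
apply: filterS (Fk n _ n0) => y h; apply: nU => k kn.
by rewrite char_lengthB hx h.
Qed.

Lemma char_finite_net n : exists D : seq B, forall x, exists2 d, d \in D & char_ball n (x - d).
Proof.
have := compact_cover_compact (0 : B) char_compact.
move=> /(_ B setT (fun d => [set y : B | char_ball n (y - d)])) [].
- by move=> d _; exact: open_char_ball.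
- by move=> x _; exists x => //=; rewrite subrr; exact: char_ball0.
move=> D _ cov; exists (finmap.enum_fset D) => x.
by have [d /= dD h] := cov x I; exists d.
Qed.

Lemma char_second_countable : @second_countable B.
Proof.
have /choice[D HD] := char_finite_net.
exists (\bigcup_n [set [set y : B | char_ball n (y - d)] | d in [set` D n]]).
  apply: bigcup_countable => // n _; apply: finite_set_countable.
  by apply: finite_image; exact: finite_seq.
split=> [U [n _ [d _ <-]]|x U [n nU]]; first exact: open_char_ball.
have [d dD hd] := HD n.*2.+1 x.
exists [set y : B | char_ball n.*2.+1 (y - d)].
  by split=> //; exists n.*2.+1 => //; exists d.
move=> y /= hy; apply: nU; rewrite -(subrK d y) -addrA.
by apply: char_ballD => //; rewrite -opprB; exact: char_ballN.
Qed.

(** An explicit countable union is wanted because only such unions stay open when pulled back to the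
    ultraproduct. [None] marks the balls left out. *)
Lemma open_char_bigcup (V : set B) : open V ->
  exists d : nat -> nat -> option B,
    V = \bigcup_n \bigcup_j (if d n j is Some b then [set y : B | char_ball n (y - b)] else set0).
Proof.
have /choice[D HD] := char_finite_net => oV.
exists (fun n j => if `[< (j < size (D n))%N /\
  [set y : B | char_ball n (y - nth 0 (D n) j)] `<=` V >] then Some (nth 0 (D n) j) else None).
apply/seteqP; split=> [x Vx|x [n _ [j _]]]; last first.
  by case: asboolP => // -[_ h]; exact: h.
have [n nU] : nbhs x V by exact: open_nbhs_nbhs.
have [d dD hd] := HD n.*2.+1 x.
exists n.*2.+1 => //; exists (index d (D n.*2.+1)) => //.
rewrite asboolT; rewrite nth_index//; split; first by rewrite index_mem.
move=> y /= hy; apply: nU; rewrite -(subrK d y) -addrA.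
by apply: char_ballD => //; rewrite -opprB; exact: char_ballN.
Qed.

End CharGroup.

(** * Regularity of Borel probabilities *)

Section Regularity.
Variables (R : realType) (B : compactAbGroupType) (m : probability (borel B) R).
Hypothesis B2 : @second_countable B.

Lemma open_bigcup_closed (U : set B) : open U ->
  exists K : nat -> set B, (forall n, closed (K n)) /\ U = \bigcup_n K n.
Proof.
move=> oU; have [b [ob bb]] := second_countable_seq B2.
exists (fun n => if `[< closure (b n) `<=` U >] then closure (b n) else set0).
split; first by move=> n; case: asboolP => _; [exact: closed_closure|exact: closed0].
apply/seteqP; split=> [x Ux|x [n _]]; last by case: asboolP => // h /h.
have := compact_regular (@hausdorff_setT B) (@compact_setT B) (@filterT _ (nbhs x) (nbhs_filter x)).
move=> /(_ U (open_nbhs_nbhs (conj oU Ux)))[W nW WU].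
have [n [bx bW]] := bb _ _ nW; exists n => //; rewrite asboolT.
  exact: subset_closure.
by apply: subset_trans WU; exact: closure_subset.
Qed.

(* [S] is squeezed between the closed set [~` V] and the open set [U]. *)
Let squeezed (S : set B) := forall e : R, 0 < e -> exists U V : set B,
  [/\ open U, open V, S `<=` U, ~` S `<=` V & (m (U `&` V) <= e%:E)%E].

Let mfin (S : set (borel B)) : measurable S -> (m S < +oo)%E.
Proof. by move=> mS; rewrite (@le_lt_trans _ _ 1%E) ?ltry// probability_le1. Qed.

Let mopen (U : set B) : open U -> (@measurable _ (borel B)) U.
Proof. exact: open_borel. Qed.

Let open_bigcap_ord (V : nat -> set B) : (forall n, open (V n)) ->
  forall N, open (\bigcap_(n < N) V n).
Proof.
move=> oV; elim=> [|N IH]; first by rewrite bigcap_mkord big_ord0; exact: openT.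
by rewrite bigcap_mkord big_ord_recr /= -bigcap_mkord; exact: openI.
Qed.

(** The intersection of all [V n] need not be open. Continuity from above allows a finite
    intersection instead, at the cost of the other half of [e]. *)
Let squeeze_bigcup (S U V : nat -> set B) (e : R) : 0 < e ->
  (forall n, [/\ open (U n), open (V n), S n `<=` U n & ~` S n `<=` V n]) ->
  (m (\bigcup_n U n `&` \bigcap_n V n) <= (e / 2)%:E)%E ->
  exists U' V', [/\ open U', open V', \bigcup_n S n `<=` U', ~` (\bigcup_n S n) `<=` V' &
    (m (U' `&` V') <= e%:E)%E].
Proof.
move=> e0 UV he.
have oU : open (\bigcup_n U n) by apply: bigcup_open => n _; have [] := UV n.
have oV n : open (V n) by have [] := UV n.
pose F N : set (borel B) := \bigcup_n U n `&` \bigcap_(n < N) V n.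
have oF N : open (F N : set B) by apply: openI => //; exact: open_bigcap_ord.
have mFN N : measurable (F N) by exact: mopen (oF N).
have FE : \bigcap_N F N = \bigcup_n U n `&` \bigcap_n V n.
  apply/seteqP; split=> [x h|x [Ux Vx] N _].
    by split=> [|n _]; [have [] := h 0%N I|have [_] := h n.+1 I; apply => /=].
  by split=> // n _; exact: Vx.
have mF : measurable (\bigcap_N F N).
  by apply: bigcap_measurableType => N _; exact: mFN.
have cF : (m \o F) @ \oo --> m (\bigcap_N F N).
  apply: nonincreasing_cvg_mu => //; [exact: mfin (mFN 0%N)|].
  move=> n k nk; apply/subsetPset; apply: setIS => x h i /= ik.
  by apply: h => /=; exact: leq_trans nk.
have [N hN] : exists N, (m (F N) <= e%:E)%E.
  have ffin N : m (F N) \is a fin_num.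
    by rewrite ge0_fin_numE//; exact: mfin (mFN N).
  have ifin : m (\bigcap_N F N) \is a fin_num by rewrite ge0_fin_numE// mfin.
  have e2 : 0 < e / 2 by rewrite divr_gt0.
  have /fine_cvgP[_ /cvgrPdist_lt/(_ _ e2)[N _ hN]] : (m \o F) @ \oo --> (fine (m (\bigcap_N F N)))%:E.
    by rewrite fineK.
  exists N; have /= := hN N (leqnn N).
  rewrite -FE -(fineK ifin) lee_fin in he.
  rewrite -(fineK (ffin N)) lee_fin ltr_norml => /andP[h1 h2]; lra.
exists (\bigcup_n U n), (\bigcap_(n < N) V n); split=> //.
- exact: open_bigcap_ord.
- by move=> x [n _ Sx]; exists n => //; have [_ _ h _] := UV n; exact: h.
- move=> x nS n _; have [_ _ _ h] := UV n; apply: h => Sx; apply: nS.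
  by exists n.
Qed.

(** Complements swap [U] and [V], and countable unions are handled by summable errors. An open set
    is a countable union of closed [K n], for which itself and the complements of the [K n] leave no
    gap. *)
Lemma borel_squeezed (S : set (borel B)) : measurable S -> squeezed S.
Proof.
move: S; apply: smallest_sub; first split.
- move=> e e0; exists set0, setT; split=> //; [exact: open0|exact: openT|].
  by rewrite set0I measure0 lee_fin ltW.
- move=> S hS e /hS[U [V [oU oV SU SV h]]]; exists V, U; split=> //.
  + by rewrite setTD.
  + by rewrite setTD setCK.
  + by rewrite setIC.
- move=> S hS e e0; have e2 : 0 < e / 2 by rewrite divr_gt0.
  have /choice[UV HUV] n : exists UV : set B * set B, [/\ open UV.1, open UV.2,
      S n `<=` UV.1, ~` S n `<=` UV.2 & (m (UV.1 `&` UV.2) <= (e / 2 / (2 ^ n.+1)%:R)%:E)%E].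
    have [|U [V h]] := hS n (e / 2 / (2 ^ n.+1)%:R); last by exists (U, V).
    by rewrite divr_gt0// ltr0n expn_gt0.
  apply: (squeeze_bigcup (U := fun n => (UV n).1) (V := fun n => (UV n).2) e0).
    by move=> n; case: (HUV n).
  have mUV n : (@measurable _ (borel B)) ((UV n).1 `&` (UV n).2).
    by case: (HUV n) => o1 o2 _ _ _; apply: mopen; exact: openI.
  apply: (@le_trans _ _ (\sum_(n <oo) m ((UV n).1 `&` (UV n).2))%E).
    apply: measure_sigma_subadditive => //.
      apply: (@measurableI _ (borel B)).
        apply: (@bigcupT_measurable _ (borel B)) => n; apply: mopen.
        by case: (HUV n).
      apply: (@bigcap_measurableType _ (borel B)) => n _; apply: mopen.
      by case: (HUV n).
    by move=> x [[n _ Ux] Vx]; exists n => //; split=> //; exact: Vx.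
  apply: (@le_trans _ _ (\sum_(n <oo) (e / 2 / (2 ^ n.+1)%:R)%:E)%E).
    apply: lee_nneseries => n _; first by move=> _; exact: measure_ge0.
    by case: (HUV n).
  by apply: (epsilon_trick0 xpredT); exact: ltW.
- move=> S /= oS; have [K [cK SE]] := open_bigcup_closed oS; rewrite SE in oS *.
  move=> e e0.
  apply: (squeeze_bigcup (U := fun n => \bigcup_n K n) (V := fun n => ~` K n) e0).
    move=> n; split=> //; [exact: closed_openC|by move=> x Kx; exists n].
  rewrite (_ : _ `&` _ = set0) ?measure0 ?lee_fin ?divr_ge0 ?ltW//.
  apply/seteqP; split=> // x [[_ _ [n _ Kx]] h]; exact: (h n I).
Qed.

End Regularity.

(** * Haar measures as images of invariant measures *)

Section Haar.
Variables (R : realType) (B : compactAbGroupType) (m : probability (borel B) R).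
Hypothesis B2 : @second_countable B.

(** Both regularity conditions come from the squeeze: [U] approximates from outside, and the
    complement of [V] is a compact set approximating from inside. *)
Lemma translation_invariant_haar :
  (forall (a : B) (S : set (borel B)), measurable S -> m [set a + x | x in (S : set B)] = m S) ->
  is_haar m.
Proof.
move=> mt; split=> //.
- move=> S mS; apply/eqP; rewrite eq_le; apply/andP; split.
    apply: le_ereal_inf_tmp => _ [U [oU SU] <-].
    by apply: le_measure => //; rewrite inE//; exact: open_borel.
  apply/lee_addgt0Pr => e e0; have [U [V [oU oV SU SV h]]] := borel_squeezed m B2 mS e0.
  apply: ereal_inf_le; exists (m U); first by exists U.
  have mU := open_borel oU; have mV := open_borel oV.
  apply: (@le_trans _ _ (m (S `|` (U `&` V)))%E).
    apply: le_measure; rewrite ?inE//.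
      by apply: (@measurableU _ (borel B)) => //; exact: (@measurableI _ (borel B)).
    by move=> x Ux; have [Sx|/SV Vx] := pselect (S x); [left|right].
  apply: (le_trans (measureU2 _ _ _)) => //; first exact: (@measurableI _ (borel B)).
  exact: leeD2l.
- move=> U oU; have mU := open_borel oU; apply/eqP; rewrite eq_le; apply/andP; split; last first.
    apply: ge_ereal_sup => _ [K [cK KU] <-]; apply: le_measure; rewrite ?inE//.
    rewrite -[K]setCK; apply: (@measurableC _ (borel B)); apply: open_borel.
    by apply: closed_openC; apply: compact_closed => //; exact: hausdorff_setT.
  apply/lee_addgt0Pr => e e0; have [U' [V [oU' oV SU SV h]]] := borel_squeezed m B2 mU e0.
  have mV := open_borel oV; have mU' := open_borel oU'.
  have mVC : (@measurable _ (borel B)) (~` V) by exact: (@measurableC _ (borel B)).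
  apply: (@le_trans _ _ (m (~` V `|` (U' `&` V)))%E).
    apply: le_measure; rewrite ?inE//.
      by apply: (@measurableU _ (borel B)) => //; exact: (@measurableI _ (borel B)).
    by move=> x Ux; have [Vx|Vx] := pselect (V x); [right; split=> //; exact: SU|left].
  apply: (le_trans (measureU2 _ _ _)) => //; first exact: (@measurableI _ (borel B)).
  apply: leeD => //; apply: ereal_sup_ubound; exists (~` V) => //; split.
    apply: (subclosed_compact _ (@compact_setT B)) => //; exact: open_closedC.
  by move=> x Vx; apply: contrapT => /SV.
Qed.

End Haar.

Section UnitMass.
Variables (d : measure_display) (T : measurableType d) (R : realType).
Variables (nu : {measure set T -> \bar R}) (nuT : nu setT = 1%E).

(** The proof of total mass 1 is an argument, so that the probability instance can depend on it. *)
Definition unit_mass of nu setT = 1%E := fun S : set T => nu S.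

HB.instance Definition _ := isMeasure.Build _ _ _ (unit_mass nuT)
  (measure0 nu) (measure_ge0 nu) (@measure_semi_sigma_additive _ _ _ nu).
HB.instance Definition _ := Measure_isProbability.Build _ _ _ (unit_mass nuT) nuT.

End UnitMass.

(** Surjectivity lifts a translation of [B] to a translation of [G], under which [mu] is
    invariant. *)
Lemma pushforward_haar (R : realType) (G : zmodType) (E : set (set G))
    (mu : {measure set (generated G E) -> \bar R})
    (B : compactAbGroupType) (phi : G -> B) : @second_countable B ->
  mu setT = 1%E -> translation_invariant mu ->
  measurable_fun setT (phi : generated G E -> borel B) ->
  (forall x y, phi (x + y) = phi x + phi y) -> (forall b, exists x, phi x = b) ->
  exists m : probability (borel B) R, is_haar m /\
    forall S : set (borel B), measurable S -> mu (phi @^-1` S) = m S.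
Proof.
move=> B2 muT mut mphi phiD phis.
have [nu nuE] : exists nu : {measure set (borel B) -> \bar R},
    forall S, nu S = mu (phi @^-1` S).
  by unshelve (exists (pushforward mu (phi : generated G E -> borel B))).
have nuT : nu setT = 1%E by rewrite nuE.
pose m : probability (borel B) R := unit_mass nuT.
exists m; split; last by move=> S _; rewrite -nuE.
apply: translation_invariant_haar => // a S mS.
have phi0 : phi 0 = 0 by apply: (addrI (phi 0)); rewrite -phiD !addr0.
have phiN x : phi (- x) = - phi x.
  by apply/eqP; rewrite -addr_eq0 -phiD addNr phi0.
have [x xa] := phis a.
transitivity (nu [set a + x | x in (S : set B)]); first by [].
transitivity (nu S); last by [].
have mpS : (@measurable _ (generated G E)) (phi @^-1` S).
  by have := mphi measurableT S mS; rewrite setTI.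
have [_ hx] := mut (- x); rewrite !nuE; refine (etrans _ (hx _ mpS)).
congr (mu _); apply/seteqP; split=> z /=.
  by move=> [b Sb bz]; rewrite phiD phiN xa -bz addrA addNr add0r.
rewrite phiD phiN xa => h; exists (- a + phi z) => //.
by rewrite addrA subrr add0r.
Qed.

(** * The quotient by the common kernel of countably many characters *)

Section CharacterQuotient.
Local Open Scope quotient_scope.
Variables (R : realType) (omega : set_system nat) (Uomega : UltraFilter omega).
Variable A : nat -> compactAbGroupType.
Local Notation G := (ultraprod Uomega A).
Local Notation X := (ultra_sigma Uomega A).
Variable chi : nat -> linear_character R X.

Definition common_kernel : {pred G} := fun x => `[< forall n, chi n x = 1 >].

Lemma char_neq0 (c : linear_character R X) x : c x != 0.
Proof. by rewrite -normr_eq0 char_norm oner_eq0. Qed.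

Lemma char0 (c : linear_character R X) : c 0 = 1.
Proof. by apply: (mulfI (char_neq0 c 0)); rewrite -charD addr0 mulr1. Qed.

Lemma charN (c : linear_character R X) x : c (- x) = (c x)^-1.
Proof.
apply: (mulIf (char_neq0 c x)); rewrite -charD addNr char0 mulVf//.
exact: char_neq0.
Qed.

Lemma common_kernel_zmod : zmod_closed common_kernel.
Proof.
split=> [|x y /asboolP x1 /asboolP y1]; apply/asboolP => n; first exact: char0.
by rewrite charD charN x1 y1 invr1 mulr1.
Qed.

HB.instance Definition _ := GRing.isZmodClosed.Build G common_kernel common_kernel_zmod.

Definition char_quot : Type := Quotient.quot common_kernel.
HB.instance Definition _ := GRing.Zmodule.on char_quot.

Definition char_proj (x : G) : char_quot := \pi_(Quotient.quot common_kernel) x.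

Lemma char_projE x y : char_proj x = char_proj y <-> forall n, chi n x = chi n y.
Proof.
have -> : char_proj x = char_proj y <-> common_kernel (x - y).
  split=> [/eqP|xy]; first by rewrite -Quotient.idealrBE.
  by apply/eqP; rewrite -Quotient.idealrBE.
split=> [/asboolP h n|h].
  have := h n; rewrite charD charN => /(congr1 (fun t => t * chi n y)).
  by rewrite divfK ?mul1r// char_neq0.
by apply/asboolP => n; rewrite charD charN h divff// char_neq0.
Qed.

Lemma char_proj_surj b : exists x, char_proj x = b.
Proof. by exists (repr b); rewrite /char_proj reprK. Qed.

Lemma char_projD x y : char_proj (x + y) = char_proj x + char_proj y.
Proof. by rewrite /char_proj raddfD. Qed.

Definition quot_char n (b : char_quot) : R[i] := chi n (repr b).

Lemma quot_charE n x : quot_char n (char_proj x) = chi n x.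
Proof.
have [y yx] : exists y, y = repr (char_proj x) by exists (repr (char_proj x)).
rewrite /quot_char -yx; apply/char_projE: n.
by rewrite yx /char_proj reprK.
Qed.

Lemma quot_charD n (b c : char_quot) : quot_char n (b + c) = quot_char n b * quot_char n c.
Proof.
have [x <-] := char_proj_surj b; have [y <-] := char_proj_surj c.
by rewrite -char_projD !quot_charE charD.
Qed.

Lemma quot_char_norm n (b : char_quot) : normc (quot_char n b) = 1.
Proof.
have := char_norm (chi n) (repr b); rewrite normr_normc -/(quot_char n b).
by move=> /(congr1 (@complex.Re R)).
Qed.

Lemma quot_char_inj (b c : char_quot) : (forall n, quot_char n b = quot_char n c) -> b = c.
Proof.
have [x <-] := char_proj_surj b; have [y <-] := char_proj_surj c.
by move=> h; apply/char_projE => n; have := h n; rewrite !quot_charE.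
Qed.

Definition quot_chars := SeparatingCharacters quot_charD quot_char_norm quot_char_inj.

Hypothesis omega_free : forall n : nat, omega <> principal_filter n.

Let open_normc_gt (z : R[i]) (r : R) : open [set w : R[i]^o | r < normc (w - z)].
Proof.
rewrite openE => w /= rw; apply/nbhs_ballP.
exists (normc (w - z) - r)%:C%C; first by rewrite /= ltcR subr_gt0.
move=> v /ball_normc vw /=.
have := le_normcD (w - v) (v - z); rewrite addrA subrK.
by rewrite -(normcN (w - v)) opprB; lra.
Qed.

(** Saturation for the closed conditions that [chi k x] is within [j.+1%:R^-1] of [z k], coded by
    pairs [(k, j)]. *)
Lemma quot_chars_range_closed (z : nat -> R[i]) :
  (forall n, exists x, forall k, (k <= n)%N -> normc (quot_chars k x - z k) <= n.+1%:R^-1) ->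
  exists x, forall k, quot_chars k x = z k.
Proof.
move=> hz.
pose F n : set G := if unpickle n is Some (k, j)
  then [set x | normc (chi k x - z k) <= j.+1%:R^-1] else setT.
have [||x xF] := closed_saturation omega_free (F := F).
- move=> n; rewrite /F; case: unpickle => [[k j]|]; last first.
    by rewrite setCT; exact: uopen0.
  have -> : ~` [set x | normc (chi k x - z k) <= j.+1%:R^-1] =
      chi k @^-1` [set w : R[i]^o | j.+1%:R^-1 < normc (w - z k)].
    by apply/seteqP; split=> x /=; rewrite ltNge => /negP.
  by have h := @char_cont _ _ _ (chi k) _ (@open_normc_gt (z k) j.+1%:R^-1).
- move=> n.
  (* [k + j] dominates both the index and the precision, so one approximation at level [N] serves
     the first [n + 1] conditions. *)
  pose b1 i : nat := if unpickle i is Some (k, j) then (k + j)%N else 0%N.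
  pose N := (\max_(i < n.+1) b1 i)%N.
  have [b bz] := hz N; have [x xb] := char_proj_surj b.
  exists x => i iN; rewrite /F.
  have : (b1 i <= N)%N.
    exact: (@leq_bigmax _ (fun i : 'I_n.+1 => b1 i) (Ordinal (n := n.+1) (m := i) iN)).
  rewrite /b1; case: unpickle => [[k j] kN|//] /=.
  have := bz k (leq_trans (leq_addr _ _) kN); rewrite /= -xb quot_charE.
  move=> /le_trans; apply; rewrite lef_pV2 ?posrE// ler_nat ltnS.
  exact: leq_trans (leq_addl _ _) kN.
exists (char_proj x) => k; rewrite /= quot_charE; apply/eqP.
rewrite -subr_eq0; apply/negPn/negP => h.
have l0 : 0 < normc (chi k x - z k).
  rewrite lt_neqAle eq_sym; apply/andP; split.
    by apply: contra_neq h; exact: eq0_normc.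
  by case: (_ - _) => a b; exact: sqrtr_ge0.
have [j] := ltr_add_invr l0; rewrite add0r.
have := xF (pickle (k, j)); rewrite /F pickleK /= => h1 h2.
by have := le_lt_trans h1 h2; rewrite ltxx.
Qed.

Lemma character_factor_group : exists (B : compactAbGroupType) (phi : G -> B)
    (cb : nat -> B -> R[i]), [/\ @second_countable B /\ scontinuous X phi,
  forall x y, phi (x + y) = phi x + phi y, forall b, exists x, phi x = b,
  forall n, continuous (cb n : B -> R[i]^o) & forall n x, cb n (phi x) = chi n x].
Proof.
pose c := quot_chars; have cc := char_compact quot_chars_range_closed.
pose B0 := char_group c.
pose BH := isCompactHausdorff.Build B0 cc (@char_hausdorff _ _ c).
pose B : compactAbGroupType := HB.pack B0 BH.
exists B, char_proj, quot_char; split.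
- split; first exact: (char_second_countable quot_chars_range_closed).
  move=> V oV; have [d ->] := open_char_bigcup quot_chars_range_closed (oV : open (V : set B0)).
  rewrite preimage_bigcup; apply: uopen_bigcup => n.
  rewrite preimage_bigcup; apply: uopen_bigcup => j.
  case: (d n j) => [b|]; last by rewrite preimage_set0; exact: uopen0.
  have [y yb] := char_proj_surj b.
  have -> : char_proj @^-1` [set y : B0 | char_ball n (y - b)] =
      [set x | forall k, (k <= n)%N -> normc (chi k x - chi k y) < n.+1%:R^-1].
    apply/seteqP; split=> x h k kn; have := h k kn;
      by rewrite (char_lengthB (c := c)) /= -yb !quot_charE.
  have ok k (r : R) : uopen [set x | normc (chi k x - chi k y) < r].
    have -> : [set x | normc (chi k x - chi k y) < r] =
        chi k @^-1` (@ball _ R[i]^o (chi k y) r%:C%C).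
      by apply/seteqP; split=> x /ball_normc.
    by apply: (@char_cont _ _ _ (chi k)); exact: ball_open.
  (* The radius is generalized first, so that the induction runs over the number of characters
     alone. *)
  move: (n.+1%:R^-1 : R) => r; elim: n => [|n IH].
    have -> : [set x | forall k, (k <= 0)%N -> normc (chi k x - chi k y) < r] =
        [set x | normc (chi 0%N x - chi 0%N y) < r].
      by apply/seteqP; split=> x h; [exact: h|move=> k; rewrite leqn0 => /eqP ->].
    exact: ok.
  have -> : [set x | forall k, (k <= n.+1)%N -> normc (chi k x - chi k y) < r] =
      [set x | forall k, (k <= n)%N -> normc (chi k x - chi k y) < r] `&`
      [set x | normc (chi n.+1 x - chi n.+1 y) < r].
    apply/seteqP; split=> x; first by move=> h; split; [move=> k /leqW|]; exact: h.
    by move=> [h1 h2] k; rewrite leq_eqVlt => /orP[/eqP -> //|]; exact: h1.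
  exact: uopenI.
- exact: char_projD.
- exact: char_proj_surj.
- exact: (sep_char_continuous (c := c)).
- exact: quot_charE.
Qed.

End CharacterQuotient.

(** * Factorization of measurable functions *)

Section CountableGeneration.
Variables (R : realType) (G : zmodType) (X : sigma_topology G).
Local Notation character := (linear_character R X).

Definition sequence_generators (chi : nat -> character) : set (set G) :=
  [set U | exists n (V : set R[i]^o), open V /\ U = chi n @^-1` V].

Lemma sequence_generators_merge (chi : nat -> nat -> character) :
  exists psi, forall k, <<s sequence_generators (chi k) >> `<=` <<s sequence_generators psi >>.
Proof.
exists (fun n => if unpickle n is Some (k, j) then chi k j else 0) => k.
apply: smallest_sub; first exact: smallest_sigma_algebra.
move=> U [j [V [oV ->]]]; apply: sub_sigma_algebra; exists (pickle (k, j)), V.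
by rewrite pickleK.
Qed.

(** The sets that depend on countably many characters form a sigma-algebra: countably many sequences
    merge into one through a pairing. *)
Lemma countable_generation (S : set G) : <<s fourier_generators R X >> S ->
  exists chi, <<s sequence_generators chi >> S.
Proof.
move: S; apply: smallest_sub; first split.
- by exists (fun=> 0); case: (smallest_sigma_algebra setT (sequence_generators (fun=> 0))).
- move=> S [chi hS]; exists chi.
  by case: (smallest_sigma_algebra setT (sequence_generators chi)) => _ h _; exact: h.
- move=> S /choice[chi hS]; have [psi hpsi] := sequence_generators_merge chi.
  exists psi; case: (smallest_sigma_algebra setT (sequence_generators psi)) => _ _; apply.
  by move=> n; exact: hpsi (hS n).
- move=> U [chi [V [oV UE]]]; exists (fun=> chi); apply: sub_sigma_algebra.
  by exists 0%N, V.
Qed.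

Lemma countable_generation_seq (S : nat -> set G) :
  (forall n, <<s fourier_generators R X >> (S n)) ->
  exists chi, forall n, <<s sequence_generators chi >> (S n).
Proof.
move=> hS; have /choice[chi hchi] n := countable_generation (hS n).
by have [psi hpsi] := sequence_generators_merge chi; exists psi => n; exact: hpsi (hchi n).
Qed.

Lemma sequence_generators_preimage (B : compactAbGroupType) (phi : G -> B)
    (chi : nat -> character) (cb : nat -> B -> R[i]) :
  (forall n, continuous (cb n : B -> R[i]^o)) -> (forall n x, cb n (phi x) = chi n x) ->
  forall S, <<s sequence_generators chi >> S ->
  exists2 T, (@measurable _ (borel B)) T & S = phi @^-1` T.
Proof.
move=> cc cE; apply: smallest_sub; first split.
- by exists set0; [exact: measurable0|rewrite preimage_set0].
- move=> S [T mT ->]; exists (~` T); first exact: (@measurableC _ (borel B)).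
  by rewrite setTD preimage_setC.
- move=> S hS; have /choice[T hT] n : exists T, (@measurable _ (borel B)) T /\ S n = phi @^-1` T.
    by have [T mT ->] := hS n; exists T.
  exists (\bigcup_n T n).
    by apply: (@bigcupT_measurable _ (borel B)) => n; have [] := hT n.
  by rewrite preimage_bigcup; apply: eq_bigcupr => n _; have [] := hT n.
- move=> _ [n [V [oV ->]]]; exists (cb n @^-1` V).
    by apply: open_borel; move/continuousP: (cc n); apply.
  by apply/seteqP; split=> x /=; rewrite cE.
Qed.

End CountableGeneration.

Lemma measurable_fun_lt_rat (R : realType) (d : measure_display) (T : measurableType d)
    (f : T -> R) :
  (forall q : rat, measurable [set x | f x < ratr q]) -> measurable_fun setT f.
Proof.
move=> mf; apply: (measurability _ (RGenInftyO.measurableE R)).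
move=> _ [_ [a ->] <-]; rewrite setTI.
have -> : f @^-1` `]-oo, a[ = \bigcup_(q : rat)
    (if ratr q <= a then [set x | f x < ratr q] else set0).
  apply/seteqP; split=> [x /=|x [q _]].
    rewrite in_itv /= => /rat_in_itvoo[q]; rewrite in_itv /= => /andP[fq qa].
    by exists q => //; rewrite ltW.
  by case: ifP => // qa /= fq; rewrite in_itv /= (lt_le_trans fq).
by apply: bigcupT_measurable_rat => q; case: ifP => // _; exact: measurable0.
Qed.

(* The Doob-Dynkin factorization; the fibres of [phi] are separated by the
   rational level sets of [g], so [g] factors pointwise. *)
Lemma factor_through (R : realType) (G : Type) (B : compactAbGroupType)
    (phi : G -> B) (g : G -> R) : (forall b, exists x, phi x = b) ->
  (forall q : rat, exists2 T, (@measurable _ (borel B)) T & [set x | g x < ratr q] = phi @^-1` T) ->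
  exists h : B -> R, measurable_fun setT (h : borel B -> R) /\ forall x, g x = h (phi x).
Proof.
move=> /choice[s sE] gT.
have gfib x y : phi x = phi y -> g x <= g y.
  move=> xy; rewrite leNgt; apply/negP => /rat_in_itvoo[q].
  rewrite in_itv /= => /andP[yq qx]; have [T _ TE] := gT q.
  have TEz z : (g z < ratr q) = T (phi z) :> Prop := congr1 (fun S => S z) TE.
  have h : g x < ratr q by rewrite TEz xy -TEz.
  by have := lt_trans h qx; rewrite ltxx.
have gE x : g x = g (s (phi x)).
  by apply/eqP; rewrite eq_le !gfib// sE.
exists (fun b => g (s b)); split=> //.
apply: measurable_fun_lt_rat => q; have [T mT TE] := gT q.
suff -> : [set b | g (s b) < ratr q] = T by [].
have TEz z : (g z < ratr q) = T (phi z) :> Prop := congr1 (fun S => S z) TE.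
by apply/funext => b; rewrite -[in RHS](sE b) -TEz.
Qed.

Lemma ae_imply2 (R : realType) (d : measure_display) (T : measurableType d)
    (mu : {measure set T -> \bar R}) (P Q S : T -> Prop) :
  (forall x, P x -> Q x -> S x) ->
  {ae mu, forall x, P x} -> {ae mu, forall x, Q x} -> {ae mu, forall x, S x}.
Proof. by move=> PQS; exact: filterS2. Qed.

(** * Bounded and square integrable complex functions *)

Section LNorms.
Variables (R : realType) (d : measure_display) (T : measurableType d).
Variable mu : {measure set T -> \bar R}.
Hypothesis muT : mu setT = 1%E.
Implicit Types f g : T -> R[i].

(** The squared modulus without its root, so that its measurability is that of a polynomial. *)
Definition normsq f x : R := complex.Re (f x) ^+ 2 + complex.Im (f x) ^+ 2.

Lemma normsq_ge0 f x : 0 <= normsq f x.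
Proof. by rewrite addr_ge0// sqr_ge0. Qed.

Lemma normsqE f x : normsq f x = normc (f x) ^+ 2.
Proof. by rewrite /normsq; case: (f x) => a b /=; rewrite sqr_sqrtr// addr_ge0// sqr_ge0. Qed.

Lemma normc_ge0 (z : R[i]) : 0 <= normc z.
Proof. by case: z => a b; exact: sqrtr_ge0. Qed.

Lemma measurable_normsq f : cmeasurable f -> measurable_fun setT (normsq f).
Proof. by move=> [m1 m2]; apply: measurable_funD; exact: measurable_funX. Qed.

Lemma cLfun_pinftyP f : cLfun mu +oo%E f <->
  cmeasurable f /\ exists2 M : R, 0 <= M & {ae mu, forall x, normc (f x) <= M}.
Proof.
rewrite /cLfun /finite_norm unlock muT lte01; split=> -[mf].
  move=> fin; split=> //.
  have [M M0 fM] : exists2 M : R, 0 <= M &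
      (ess_sup mu (abse \o (EFin \o (fun x => normc (f x)))) <= M%:E)%E.
    case: (ess_sup mu _) fin => [r _|//|_].
      by exists `|r|; rewrite ?lee_fin ?ler_norm.
    by exists 0; rewrite ?leNye.
  exists M => //; move/ess_supP: fM; apply: filterS => x /=.
  by rewrite lee_fin ger0_norm// normc_ge0.
move=> [M M0 fM]; split=> //; apply: (@le_lt_trans _ _ M%:E); last exact: ltry.
apply/ess_supP; apply: filterS fM => x /= h.
by rewrite lee_fin ger0_norm// normc_ge0.
Qed.

Definition square_integrable f := cmeasurable f /\ (\int[mu]_x (normsq f x)%:E < +oo)%E.

Lemma cLfun2P f : cLfun mu 2%:E f <-> square_integrable f.
Proof.
have E : (\int[mu]_x (`|(normc (f x))%:E| `^ 2) = \int[mu]_x (normsq f x)%:E)%E.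
  apply: eq_integral => x _ /=; rewrite normsqE ger0_norm ?normc_ge0//.
  by rewrite (powR_mulrn 2)// normc_ge0.
rewrite /cLfun /finite_norm unlock /=; split=> -[mf h]; split=> //; last first.
  by rewrite /= E; exact: poweR_lty.
have I0 : (0 <= \int[mu]_x (normsq f x)%:E)%E.
  by apply: integral_ge0 => x _; rewrite lee_fin normsq_ge0.
move: h; rewrite /= E; case: (\int[mu]_x _)%E I0 => [r _ _|//|//]; first exact: ltry.
by rewrite poweRyr// invr_neq0.
Qed.

Lemma ae_integral_le f (M : R) : cmeasurable f -> 0 <= M ->
  {ae mu, forall x, normc (f x) <= M} -> (\int[mu]_x (normsq f x)%:E <= (M ^+ 2)%:E)%E.
Proof.
move=> mf M0 fM.
apply: (@le_trans _ _ (\int[mu]_x (cst (M ^+ 2)%:E) x)%E); last first.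
  by rewrite integral_cst// muT mule1.
apply: ae_ge0_le_integral => //.
- by move=> x _; rewrite lee_fin normsq_ge0.
- by apply/measurable_EFinP; exact: measurable_normsq.
- by move=> x _; rewrite lee_fin sqr_ge0.
- apply: filterS fM => x h _; rewrite lee_fin normsqE.
  by rewrite ler_pXn2r ?nnegrE ?normc_ge0.
Qed.

Lemma cLfun_pinfty_square f : cLfun mu +oo%E f -> square_integrable f.
Proof.
move=> /cLfun_pinftyP[mf [M M0 fM]]; split=> //.
exact: le_lt_trans (ae_integral_le mf M0 fM) (ltry _).
Qed.

End LNorms.

Section FactorFourierMeasurable.
Variables (R : realType) (omega : set_system nat) (Uomega : UltraFilter omega).
Hypothesis omega_free : forall n : nat, omega <> principal_filter n.
Variable A : nat -> compactAbGroupType.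
Variables (m : forall i, probability (borel (A i)) R) (m_haar : forall i, is_haar (m i)).
Variable mu : {measure set (generated (ultraprod Uomega A)
                          (@strongly_open omega Uomega A)) -> \bar R}.
Hypothesis mu_lim : is_ultralimit_measure m mu.

Lemma fourier_measurable_factor (f : ultraprod Uomega A -> R[i]) :
  cLfun mu +oo%E f -> fourier_measurable (ultra_sigma Uomega A) mu f ->
  exists (B : compactAbGroupType) (mB : probability (borel B) R)
     (phi : ultraprod Uomega A -> B) (h : B -> R[i]), factorization mu f mB phi h.
Proof.
have muT := ultralimit_setT mu_lim.
move=> /(cLfun_pinftyP muT)[mf [M M0 fM]] [g [mg1 mg2] fg].
(* Rational level sets of both components: countably many sets determine [g], so countably many
   characters suffice. *)
pose S (p : bool * rat) : set (ultraprod Uomega A) :=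
  if p.1 then [set x | complex.Re (g x) < ratr p.2] else [set x | complex.Im (g x) < ratr p.2].
have lt_itv (q : R) : measurable [set t : R | t < q].
  have -> : [set t : R | t < q] = `]-oo, q[%classic.
    by apply/seteqP; split=> t /=; rewrite in_itv.
  exact: measurable_itv.
have hS n : <<s @fourier_generators R _ (ultra_sigma Uomega A) >>
    (if unpickle n is Some p then S p else set0).
  case: unpickle => [[b q]|]; last exact: (@measurable0 _ (generated _ _)).
  by case: b; [have := mg1 measurableT _ (lt_itv (ratr q))|
               have := mg2 measurableT _ (lt_itv (ratr q))]; rewrite setTI.
have [chi hchi] := countable_generation_seq hS.
have [B [phi [cb [[B2 phic] phiD phis cbc cbE]]]] := character_factor_group chi omega_free.
have mphi := scontinuous_measurable phic.
have [mB [mBh mBE]] := pushforward_haar B2 muT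
  (ultralimit_translation_invariant m_haar mu_lim) mphi phiD phis.
have hT p : exists2 T, (@measurable _ (borel B)) T & S p = phi @^-1` T.
  apply: (sequence_generators_preimage cbc cbE).
  by have := hchi (pickle p); rewrite pickleK.
have [h1 [mh1 h1E]] := factor_through phis (fun q => hT (true, q)).
have [h2 [mh2 h2E]] := factor_through phis (fun q => hT (false, q)).
pose h b : R[i] := Complex (h1 b) (h2 b).
have gh x : g x = h (phi x) by rewrite /h -h1E -h2E; case: (g x).
have fh : {ae mu, forall x, f x = h (phi x)}.
  by apply: (ae_imply2 _ fg fg) => x ->; rewrite gh.
have mh : @cmeasurable R _ (borel B) h by split.
exists B, mB, phi, h; split=> //.
apply/(cLfun_pinftyP (probability_setT mB)); split=> //; exists M => //.
(* The bound on [h] can fail only on [N], whose measure is that of its preimage; the preimage lies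
   where the bound on [f] or the equality with [h] composed with [phi] fails. *)
pose N : set (borel B) := [set b | M ^+ 2 < normsq (T := borel B) h b].
have NE b : N b <-> ~ (normc (h b) <= M).
  rewrite /N /= normsqE; split=> [h0|/negP].
    by apply/negP; rewrite -ltNge -(ltr_pXn2r (ltn0Sn 1)) ?nnegrE// normc_ge0.
  by rewrite -ltNge -(ltr_pXn2r (ltn0Sn 1)) ?nnegrE// normc_ge0.
have mN : measurable N.
  have := measurable_normsq mh measurableT (measurable_itv `]M ^+ 2, +oo[).
  rewrite setTI; congr (measurable _).
  by apply/seteqP; split=> b /=; rewrite in_itv /= andbT.
exists N; split=> //; last by move=> b /= /NE.
refine (etrans (esym (mBE _ mN)) _).
have mpN : (@measurable _ (generated (ultraprod Uomega A) (@strongly_open omega Uomega A)))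
    (phi @^-1` N) by have := mphi measurableT N mN; rewrite setTI.
refine (iffLR (negligibleP _ mpN) _).
have : {ae mu, forall x, normc (h (phi x)) <= M}.
  by apply: (ae_imply2 _ fM fh) => x k1 k2; rewrite -k2.
by apply: negligibleS => x /NE.
Qed.

End FactorFourierMeasurable.

(** * Fourier coefficients *)

Section ComplexIntegral.
Variables (R : realType) (d : measure_display) (T : measurableType d).
Variable mu : {measure set T -> \bar R}.
Implicit Types f g : T -> R[i].

Definition cintegrable f :=
  mu.-integrable setT (EFin \o (fun x => complex.Re (f x))) /\
  mu.-integrable setT (EFin \o (fun x => complex.Im (f x))).

Lemma cintegrable_measurable f : cintegrable f -> cmeasurable f.
Proof.
by move=> [/integrableP[m1 _] /integrableP[m2 _]]; split; apply/measurable_EFinP.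
Qed.

Let integrable_lin (a b : R) (u v : T -> R) : mu.-integrable setT (EFin \o u) ->
  mu.-integrable setT (EFin \o v) ->
  mu.-integrable setT (EFin \o (fun x => a * u x + b * v x)) /\
  \int[mu]_x (a * u x + b * v x) = a * \int[mu]_x u x + b * \int[mu]_x v x.
Proof.
move=> iu iv.
have iau : mu.-integrable setT (EFin \o (fun x => a * u x)) by exact: (integrableZl measurableT a iu).
have ibv : mu.-integrable setT (EFin \o (fun x => b * v x)) by exact: (integrableZl measurableT b iv).
by split; [exact: (integrableD measurableT iau ibv)|rewrite RintegralD// !RintegralZl].
Qed.

Lemma cintegral_lin (c : R[i]) f g : cintegrable f -> cintegrable g ->
  cintegrable (fun x => c * f x + g x) /\
  cintegral mu (fun x => c * f x + g x) = c * cintegral mu f + cintegral mu g.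
Proof.
move=> [fr fi] [gr gi]; case: c => a b.
have [i1 e1] := integrable_lin a (- b) fr fi; have [i2 e2] := integrable_lin a b fi fr.
have [i3 e3] := integrable_lin 1 1 i1 gr; have [i4 e4] := integrable_lin 1 1 i2 gi.
have E3 x : complex.Re (Complex a b * f x + g x) =
    1 * (a * complex.Re (f x) + - b * complex.Im (f x)) + 1 * complex.Re (g x).
  by case: (f x) (g x) => p q [p' q'] /=; ring.
have E4 x : complex.Im (Complex a b * f x + g x) =
    1 * (a * complex.Im (f x) + b * complex.Re (f x)) + 1 * complex.Im (g x).
  by case: (f x) (g x) => p q [p' q'] /=; ring.
rewrite /cintegrable /cintegral (funext E3) (funext E4) e3 e4 e1 e2; split=> //.
by simpc; congr Complex; ring.
Qed.

Lemma eq_ae_cintegral f g : cmeasurable f -> cmeasurable g ->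
  {ae mu, forall x, f x = g x} -> cintegral mu f = cintegral mu g.
Proof.
move=> [fr fi] [gr gi] fg; rewrite /cintegral /Rintegral.
congr (Complex (fine _) (fine _)); apply: ae_eq_integral => //; try exact/measurable_EFinP;
  by apply: (ae_imply2 _ fg fg) => x -> _ _.
Qed.

End ComplexIntegral.

Lemma cintegral_transfer (R : realType) (d1 d2 : measure_display) (X : measurableType d1)
    (Y : measurableType d2) (mu : {measure set X -> \bar R}) (nu : {measure set Y -> \bar R})
    (phi : X -> Y) : measurable_fun setT phi ->
  (forall S, measurable S -> mu (phi @^-1` S) = nu S) ->
  forall f : Y -> R[i], cintegrable nu f -> cintegrable mu (fun x => f (phi x)) /\
  cintegral nu f = cintegral mu (fun x => f (phi x)).
Proof.
move=> mphi phinu f [fr fi]; split.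
  by split; [exact: (transfer_integrable mphi phinu fr)|exact: (transfer_integrable mphi phinu fi)].
rewrite /cintegral /Rintegral (transfer_integral mphi phinu fr).
by rewrite (transfer_integral mphi phinu fi).
Qed.

Section CharacterIntegrals.
Variables (R : realType) (G : zmodType) (E : set (set G)) (X : sigma_topology G).
Variable mu : {measure set (generated G E) -> \bar R}.
Hypotheses (muT : mu setT = 1%E) (mut : translation_invariant mu).
Hypothesis X_measurable : forall U, sopen X U -> (@measurable _ (generated G E)) U.

Local Notation character := (linear_character R X).
Local Notation cmeas := (@cmeasurable R _ (generated G E)).
Local Notation nsq := (@normsq R _ (generated G E)).

(** Translating by [a] multiplies the integral by [z]. Used for the orthogonality of characters and
    for the vanishing of coefficients at characters nontrivial on the kernel of [phi]. *)
Lemma translation_eigen_integral (F : G -> R[i]) (a : G) (z : R[i]) :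
  cintegrable mu F -> (forall x, F (a + x) = z * F x) -> z != 1 -> cintegral mu F = 0.
Proof.
move=> Fi FE z1; have [ma pa] := mut a.
have [_ h] := cintegral_transfer ma pa Fi.
have zi : cintegrable mu (fun _ : generated G E => 0 : R[i]).
  by split; exact: (integrable0 mu setT).
have [_ h2] := cintegral_lin z Fi zi.
have z0 : cintegral mu (fun _ : generated G E => 0 : R[i]) = 0.
  by rewrite /cintegral /Rintegral /= !integral0.
have h3 : cintegral mu F = z * cintegral mu F.
  rewrite {1}h -[RHS]addr0 -z0 -h2; congr (cintegral mu _).
  by apply/funext => x; rewrite addr0; exact: FE.
apply/eqP; have : (1 - z) * cintegral mu F == 0 by rewrite mulrBl mul1r -h3 subrr.
by rewrite mulf_eq0 subr_eq0 eq_sym (negbTE z1).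
Qed.

Lemma re_preimage_open (U : set R) : open U -> open [set z : R[i]^o | U (complex.Re z)].
Proof.
rewrite !openE => oU z /oU /nbhs_ballP[e /= e0 eU]; apply/nbhs_ballP.
exists e%:C%C; first by rewrite /= ltcR.
move=> w /ball_normc wz; apply: eU; rewrite /ball /= distrC.
apply: le_lt_trans wz; case: z w => a b [a' b'] /=.
by rewrite -sqrtr_sqr ler_sqrt ?addr_ge0 ?sqr_ge0// lerDl sqr_ge0.
Qed.

Lemma im_preimage_open (U : set R) : open U -> open [set z : R[i]^o | U (complex.Im z)].
Proof.
rewrite !openE => oU z /oU /nbhs_ballP[e /= e0 eU]; apply/nbhs_ballP.
exists e%:C%C; first by rewrite /= ltcR.
move=> w /ball_normc wz; apply: eU; rewrite /ball /= distrC.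
apply: le_lt_trans wz; case: z w => a b [a' b'] /=.
by rewrite -sqrtr_sqr ler_sqrt ?addr_ge0 ?sqr_ge0// lerDr sqr_ge0.
Qed.

Lemma char_measurable (chi : character) : cmeas chi.
Proof.
split; apply: measurable_fun_preimage_open => U oU; apply: X_measurable.
  exact: (@char_cont _ _ _ chi _ (re_preimage_open oU)).
exact: (@char_cont _ _ _ chi _ (im_preimage_open oU)).
Qed.

Lemma char_normsq (chi : character) x :
  complex.Re (chi x) ^+ 2 + complex.Im (chi x) ^+ 2 = 1.
Proof.
have := char_norm chi x; rewrite normr_normc => /(congr1 (@complex.Re R)) /= h.
by rewrite -[LHS]/(nsq chi x) normsqE h expr1n.
Qed.

Lemma cintegrable_mulC (f : G -> R[i]) (chi : character) :
  square_integrable mu f -> cintegrable mu (fun x => f x * (chi x)^*).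
Proof.
move=> [[fr fi] fN]; have [cr ci] := char_measurable chi.
(* Since [|t| <= 1 + t ^+ 2], this function dominates anything whose square is at most that of
   [|f|]. *)
have bi : mu.-integrable setT (EFin \o (fun x : generated G E => 1 + nsq f x)).
  apply: (integrableD measurableT (f := EFin \o (fun=> 1)) (g := EFin \o nsq f)) => //.
    apply: (bounded_integrable_fin (M := 1)) => //.
    - by rewrite muT ltry.
    - by move=> x; rewrite normr1.
  apply/integrableP; split; first by apply/measurable_EFinP; exact: measurable_normsq.
  apply: le_lt_trans fN; rewrite le_eqVlt; apply/orP; left; apply/eqP.
  by apply: eq_integral => x _ /=; rewrite ger0_norm// normsq_ge0.
have key (u : generated G E -> R) : measurable_fun setT u ->
    (forall x, u x ^+ 2 <= nsq f x) -> mu.-integrable setT (EFin \o u).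
  move=> mu' h; apply: (le_integrable measurableT _ _ bi); first exact/measurable_EFinP.
  move=> x _ /=; rewrite lee_fin.
  have n0 := normsq_ge0 (f : generated G E -> R[i]) x.
  rewrite (ger0_norm (addr_ge0 (@ler01 R) n0)).
  have := h x; rewrite -[X in X <= _ -> _]real_normK ?num_real//.
  have := normr_ge0 (u x); set t := `|u x|; set s := nsq _ _; nra.
split; apply: key.
- have -> : (fun x => complex.Re (f x * (chi x)^*)) =
     (fun x => complex.Re (f x) * complex.Re (chi x) + complex.Im (f x) * complex.Im (chi x)).
    by apply/funext => x; case: (f x) (chi x) => a b [p q] /=; ring.
  by apply: measurable_funD; exact: measurable_funM.
- move=> x; have := char_normsq chi x; rewrite /normsq.
  case: (f x) (chi x) => a b [p q] /= h.
  (* By Lagrange's identity, this square is the gap between the two sides. *)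
  rewrite -[leRHS]mulr1 -h; have := sqr_ge0 (a * q - b * p); nra.
- have -> : (fun x => complex.Im (f x * (chi x)^*)) =
     (fun x => complex.Im (f x) * complex.Re (chi x) - complex.Re (f x) * complex.Im (chi x)).
    by apply/funext => x; case: (f x) (chi x) => a b [p q] /=; ring.
  by apply: measurable_funB; exact: measurable_funM.
- move=> x; have := char_normsq chi x; rewrite /normsq.
  case: (f x) (chi x) => a b [p q] /= h.
  rewrite -[leRHS]mulr1 -h; have := sqr_ge0 (a * p + b * q); nra.
Qed.

Lemma char_square_integrable (chi : character) : square_integrable mu (chi : G -> R[i]).
Proof.
split; first exact: char_measurable.
have -> : (fun x => (nsq chi x)%:E) = cst 1%E.
  by apply/funext => x; rewrite /normsq char_normsq.
by rewrite integral_cst// mul1e muT ltry.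
Qed.

Lemma char_orthogonal (chi psi : character) : chi != psi ->
  cintegral mu (fun x => chi x * (psi x)^*) = 0.
Proof.
move=> cp; have [a ca] : exists a, chi a != psi a.
  apply: contraNP cp => /forallNP h; apply/eqP; apply: char_eqP => x.
  by have /negP/negPn/eqP := h x.
apply: (@translation_eigen_integral _ a (chi a * (psi a)^*)).
- by apply: cintegrable_mulC; exact: char_square_integrable.
- by move=> x; rewrite !charD rmorphM mulrACA.
- apply: contra_neq ca => h; rewrite -[RHS]mul1r -h -mulrA (mulrC _ (psi a)).
  by rewrite -normCK char_norm expr1n mulr1.
Qed.

(** Pythagoras: [|chi| = 1] holds pointwise, and the cross terms integrate to the components of the
    coefficient [c] itself. *)
Lemma normsq_sub_char (r : G -> R[i]) (chi : character) : square_integrable mu r ->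
  let c := fourier mu r chi in let r' := fun x => - c * chi x + r x in
  square_integrable mu r' /\
  \int[mu]_x nsq r' x =
    \int[mu]_x nsq r x - normc c ^+ 2.
Proof.
move=> sr c r'; have [[rr ri] rN] := sr.
have [cr ci] := char_measurable chi.
have [i1 i2] := cintegrable_mulC chi sr.
have iN : mu.-integrable setT (EFin \o nsq r).
  apply/integrableP; split; first by apply/measurable_EFinP; exact: measurable_normsq.
  apply: le_lt_trans rN; rewrite le_eqVlt; apply/orP; left; apply/eqP.
  by apply: eq_integral => x _ /=; rewrite ger0_norm// normsq_ge0.
case cE : c => [a b].
have NE x : nsq r' x = nsq r x +
    (- (2 * a) * complex.Re (r x * (chi x)^*) +
     (- (2 * b) * complex.Im (r x * (chi x)^*) + (a ^+ 2 + b ^+ 2))).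
  have := char_normsq chi x; rewrite /normsq /r' cE.
  case: (r x) (chi x) => p q [s t] /= h.
  have -> : a ^+ 2 + b ^+ 2 = (a ^+ 2 + b ^+ 2) * (s ^+ 2 + t ^+ 2) by rewrite h mulr1.
  ring.
have ik : mu.-integrable setT (EFin \o (fun _ : generated G E => a ^+ 2 + b ^+ 2)).
  apply: (bounded_integrable_fin (M := a ^+ 2 + b ^+ 2)) => //.
    by rewrite muT ltry.
  by move=> x; rewrite ger0_norm// addr_ge0// sqr_ge0.
have j1 : mu.-integrable setT (EFin \o (fun x => - (2 * a) * complex.Re (r x * (chi x)^*))).
  exact: (integrableZl measurableT _ i1).
have j2 : mu.-integrable setT (EFin \o (fun x => - (2 * b) * complex.Im (r x * (chi x)^*))).
  exact: (integrableZl measurableT _ i2).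
have j3 : mu.-integrable setT (EFin \o (fun x => - (2 * b) * complex.Im (r x * (chi x)^*) +
    (a ^+ 2 + b ^+ 2))) := integrableD measurableT j2 ik.
have j4 : mu.-integrable setT (EFin \o (fun x => - (2 * a) * complex.Re (r x * (chi x)^*) +
    (- (2 * b) * complex.Im (r x * (chi x)^*) + (a ^+ 2 + b ^+ 2)))) :=
  integrableD measurableT j1 j3.
have j5 := integrableD measurableT iN j4.
have iN' : mu.-integrable setT (EFin \o nsq r').
  by rewrite (funext NE); exact: j5.
split.
  split; last first.
    have /integrableP[_] := iN'; apply: le_lt_trans; rewrite le_eqVlt; apply/orP; left; apply/eqP.
    by apply: eq_integral => x _ /=; rewrite ger0_norm// normsq_ge0.
  split.
    have -> : (fun x => complex.Re (r' x)) = (fun x => (- a) * complex.Re (chi x) +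
        (b * complex.Im (chi x) + complex.Re (r x))).
      by apply/funext => x; rewrite /r' cE; case: (r x) (chi x) => p q [s t] /=; ring.
    by apply: measurable_funD; [|apply: measurable_funD => //]; exact: measurable_funM.
  have -> : (fun x => complex.Im (r' x)) = (fun x => (- a) * complex.Im (chi x) +
      (- b * complex.Re (chi x) + complex.Im (r x))).
    by apply/funext => x; rewrite /r' cE; case: (r x) (chi x) => p q [s t] /=; ring.
  by apply: measurable_funD; [|apply: measurable_funD => //]; exact: measurable_funM.
rewrite (funext NE) (RintegralD measurableT iN j4) (RintegralD measurableT j1 j3).
rewrite (RintegralD measurableT j2 ik) (RintegralZl _ measurableT i1) (RintegralZl _ measurableT i2).
have ca : \int[mu]_x complex.Re (r x * (chi x)^*) = a.
  by have := congr1 (@complex.Re R) cE.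
have cb : \int[mu]_x complex.Im (r x * (chi x)^*) = b.
  by have := congr1 (@complex.Im R) cE.
rewrite ca cb Rintegral_cst// muT /= mulr1 sqr_sqrtr ?addr_ge0 ?sqr_ge0//.
ring.
Qed.

(** Characters are subtracted one at a time; by orthogonality the remainder keeps its coefficients
    at the characters not yet treated, which is what the induction must carry. *)
Lemma bessel_seq (f : G -> R[i]) (s : seq character) : square_integrable mu f -> uniq s ->
  exists2 r : G -> R[i], square_integrable mu r &
    \int[mu]_x nsq r x + \sum_(chi <- s) normc (fourier mu f chi) ^+ 2 =
      \int[mu]_x nsq f x /\
    forall psi, psi \notin s -> fourier mu r psi = fourier mu f psi.
Proof.
move=> sf; elim: s => [_|chi s IH /= /andP[cs us]].
  by exists f => //; split=> //; rewrite big_nil addr0.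
have [r sr [rE rpsi]] := IH us; have [sr' r'E] := normsq_sub_char chi sr.
exists (fun x => - fourier mu r chi * chi x + r x) => //; split.
  by rewrite r'E big_cons (rpsi chi cs) -rE addrA subrK.
move=> psi; rewrite inE negb_or => /andP[pc ps]; rewrite -(rpsi psi ps).
have i1 := cintegrable_mulC psi (char_square_integrable chi).
have i2 := cintegrable_mulC psi sr.
have [_ h] := cintegral_lin (- fourier mu r chi) i1 i2.
rewrite {1}/fourier.
have -> : (fun x => (- fourier mu r chi * chi x + r x) * (psi x)^*) =
    (fun x => - fourier mu r chi * (chi x * (psi x)^*) + r x * (psi x)^*).
  by apply/funext => x; rewrite mulrDl mulrA.
by rewrite h char_orthogonal ?mulr0 ?add0r// eq_sym.
Qed.

Lemma bessel (f : G -> R[i]) : square_integrable mu f ->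
  square_summable (fourier mu f : character -> R[i]).
Proof.
move=> sf; rewrite /square_summable.
apply: (@le_lt_trans _ _ (\int[mu]_x nsq f x)%:E); last exact: ltry.
apply: ge_ereal_sup => _ [S [finS _] <-].
rewrite fsbig_finite//= sumEFin lee_fin.
have [r sr [<- _]] := bessel_seq sf (finmap.fset_uniq (fset_set S)).
by rewrite lerDr Rintegral_ge0// => x _; exact: normsq_ge0.
Qed.

End CharacterIntegrals.

(** * Isomorphism of functions on groups *)

Section Isomorphic.
Variable R : realType.

Lemma support_group_subgroup (G : zmodType) (u : G -> R[i]) : is_subgroup (support_group u).
Proof.
split; first by move=> H [[H0 _] _].
move=> x y ux uy H hH; have [[_ HB] _] := hH.
by apply: HB; [exact: ux|exact: uy].
Qed.

Lemma support_groupD (G : zmodType) (u : G -> R[i]) x y :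
  support_group u x -> support_group u y -> support_group u (x + y).
Proof.
move=> ux uy; have [u0 uB] := support_group_subgroup u.
by rewrite -[y]opprK; apply: (uB) => //; rewrite -sub0r; exact: uB.
Qed.

Lemma support_group_sub (G : zmodType) (u : G -> R[i]) (H : set G) :
  is_subgroup H -> (forall g, u g != 0 -> H g) -> support_group u `<=` H.
Proof. by move=> sH uH x; apply; split. Qed.

Lemma sub_support_group (G : zmodType) (u : G -> R[i]) g : u g != 0 -> support_group u g.
Proof. by move=> ug H [_ h]; exact: h. Qed.

(** Preimages and images of subgroups under [alpha] are subgroups, so each inclusion between the
    generated groups can be checked on the supports. *)
Lemma injection_isomorphic (G1 G2 : zmodType) (u : G1 -> R[i]) (v : G2 -> R[i])
    (alpha : G1 -> G2) : (forall x y, alpha (x + y) = alpha x + alpha y) ->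
  injective alpha -> (forall x, u x = v (alpha x)) ->
  (forall y, v y != 0 -> exists x, alpha x = y) -> isomorphic u v.
Proof.
move=> aD ainj uv vr; exists alpha.
have a0 : alpha 0 = 0 by apply: (addrI (alpha 0)); rewrite -aD !addr0.
have aB x y : alpha (x - y) = alpha x - alpha y.
  by apply: (addIr (alpha y)); rewrite -aD !subrK.
split=> //; split.
- apply: support_group_sub; last first.
    by move=> g ug; apply: sub_support_group; rewrite -uv.
  have [s0 sB] := support_group_subgroup v.
  by split=> [|x y /=]; rewrite ?a0 ?aB; [|exact: sB].
- by move=> x y _ _; exact: ainj.
- apply: support_group_sub; last first.
    move=> g vg; have [x xg] := vr g vg; exists x => //.
    by apply: sub_support_group; rewrite uv xg.
  have [s0 sB] := support_group_subgroup u.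
  split; first by exists 0.
  by move=> _ _ [x ux <-] [y uy <-]; exists (x - y); [exact: sB|exact: aB].
Qed.

(** Symmetry and transitivity in one step, for two transforms that are both compared with that of
    [f]. *)
Lemma isomorphic_cospan (G1 G2 G3 : zmodType) (u : G1 -> R[i]) (v : G2 -> R[i])
    (w : G3 -> R[i]) : isomorphic u w -> isomorphic v w -> isomorphic u v.
Proof.
move=> [a [[af ai asurj] aD uw]] [b [[bf bi bsurj] bD vw]].
have /choice[c hc] x : exists y, support_group u x -> support_group v y /\ b y = a x.
  have [ux|nux] := pselect (support_group u x); last by exists 0.
  by have [y vy ya] := bsurj _ (af _ ux); exists y.
have cv x : support_group u x -> support_group v (c x) by move=> /hc[].
have bc x : support_group u x -> b (c x) = a x by move=> /hc[].
exists c; split; first split.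
- by move=> x /cv.
- move=> x y; rewrite !inE => ux uy cxy; apply: ai; rewrite ?inE//.
  by rewrite -(bc x ux) -(bc y uy) cxy.
- move=> y vy; have [x ux xa] := asurj _ (bf _ vy).
  exists x => //; apply: bi; rewrite ?inE//; first exact: cv.
  by rewrite bc.
- move=> x y ux uy; have uxy := support_groupD ux uy.
  apply: bi; rewrite ?inE; [exact: cv|by apply: support_groupD; exact: cv|].
  by rewrite bc// aD// bD ?bc//; exact: cv.
- by move=> x ux; rewrite uw// vw ?bc//; exact: cv.
Qed.

End Isomorphic.

Section CharacterPullback.
Variables (R : realType) (G : zmodType) (X : sigma_topology G) (B : compactAbGroupType).
Variables (phi : G -> B) (phiD : forall x y, phi (x + y) = phi x + phi y).
Hypothesis phic : scontinuous X phi.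
Variable chi : linear_character R (top_sigma B).

Let pullD x y : chi (phi (x + y)) = chi (phi x) * chi (phi y).
Proof. by rewrite phiD charD. Qed.

Let pull_norm x : `|chi (phi x)| = 1. Proof. exact: char_norm. Qed.

Let pull_cont : scontinuous X ((fun x => chi (phi x)) : G -> R[i]^o).
Proof. by move=> V oV; apply: (phic (V := chi @^-1` V)); exact: (@char_cont _ _ _ chi). Qed.

Definition char_pull : linear_character R X := LinearCharacter pullD pull_norm pull_cont.

End CharacterPullback.

(** * Fourier transforms along a factorization *)

Section Factorization.
Variables (R : realType) (omega : set_system nat) (Uomega : UltraFilter omega).
Hypothesis omega_free : forall n : nat, omega <> principal_filter n.
Variable A : nat -> compactAbGroupType.
Variables (m : forall i, probability (borel (A i)) R) (m_haar : forall i, is_haar (m i)).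
Local Notation G := (ultraprod Uomega A).
Local Notation E := (@strongly_open omega Uomega A).
Local Notation X := (ultra_sigma Uomega A).
Variable mu : {measure set (generated G E) -> \bar R}.
Hypothesis mu_lim : is_ultralimit_measure m mu.
Variables (f : G -> R[i]) (f_Linfty : cLfun mu +oo%E f).
Variables (B : compactAbGroupType) (mB : probability (borel B) R) (phi : G -> B) (h : B -> R[i]).
Hypothesis fact : factorization mu f mB phi h.

Let muT : mu setT = 1%E := ultralimit_setT mu_lim.
Let mut : translation_invariant mu := ultralimit_translation_invariant m_haar mu_lim.
Let phiD := fact_morphism fact.
Let phic := fact_continuous fact.
Let phis := fact_surjective fact.
Let mphi : measurable_fun setT (phi : generated G E -> borel B) := scontinuous_measurable phic.
Let pull : linear_character R (top_sigma B) -> linear_character R X := char_pull phiD phic.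

(** Characters of [B] pull back to characters of the ultraproduct, and they generate the Borel sets
    of [B]; hence [phi] stays measurable for the smaller sigma-algebra. *)
Lemma factorization_fourier_measurable : fourier_measurable X mu f.
Proof.
have [[mr mi] _] := fact_Linfty fact.
exists (fun x => h (phi x)); last exact: fact_ae fact.
have mphi' : measurable_fun setT
    (phi : generated G (fourier_generators R X) -> borel B).
  have m1 : measurable_fun setT
      (phi : generated G (fourier_generators R X) -> generated B (fourier_generators R (top_sigma B))).
    apply: measurable_fun_generated => _ [chi [V [oV ->]]].
    by apply: sub_sigma_algebra; exists (pull chi), V.
  apply: (@measurable_fun_generated G B _ open) => U oU.
  have mU : (@measurable _ (generated B (fourier_generators R (top_sigma B)))) U :=
    open_fourier_measurable (fact_second_countable fact) (fact_haar fact) oU.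
  by have := m1 measurableT U mU; rewrite setTI.
by split; [exact: (measurableT_comp mr mphi')|exact: (measurableT_comp mi mphi')].
Qed.

Let f2 : square_integrable mu f. Proof. exact: cLfun_pinfty_square. Qed.

Let h2 : square_integrable mB h.
Proof. by apply: cLfun_pinfty_square (fact_Linfty fact); exact: probability_setT. Qed.

Lemma haar_square_summable (C : compactAbGroupType) (n : probability (borel C) R)
    (g : C -> R[i]) : is_haar n -> square_integrable n g -> square_summable (haar_fourier n g).
Proof.
move=> nh; apply: bessel; first exact: probability_setT.
  exact: haar_translation_invariant.
exact: open_borel.
Qed.

Lemma ultra_square_summable : square_summable (fourier mu f : linear_character R X -> R[i]).
Proof. by apply: bessel => //; exact: uopen_measurable. Qed.

Let hphi2 : square_integrable mu (fun x => h (phi x)).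
Proof.
have [[hr hi] hN] := h2; split.
  by split; [exact: (measurableT_comp hr mphi)|exact: (measurableT_comp hi mphi)].
rewrite -(transfer_ge0_integral mphi (fact_measure_preserving fact)
  (f := fun b => (normsq (h : borel B -> R[i]) b)%:E))//.
  by apply/measurable_EFinP; exact: measurable_normsq.
by move=> b; rewrite lee_fin normsq_ge0.
Qed.

Let cintegrable_mul_char (F : G -> R[i]) (chi : linear_character R X) :
  square_integrable mu F -> cintegrable mu (fun x => F x * (chi x)^*).
Proof. by apply: (cintegrable_mulC muT); exact: uopen_measurable. Qed.

Lemma fourier_factorization (chi : linear_character R X) :
  fourier mu f chi = cintegral mu (fun x => h (phi x) * (chi x)^*).
Proof.
apply: eq_ae_cintegral; [exact/cintegrable_measurable/cintegrable_mul_char..|].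
by apply: (ae_imply2 _ (fact_ae fact) (fact_ae fact)) => x ->.
Qed.

Lemma fourier_pull (chi : linear_character R (top_sigma B)) :
  haar_fourier mB h chi = fourier mu f (pull chi).
Proof.
rewrite fourier_factorization.
have hi : cintegrable mB (fun b => h b * (chi b)^*).
  apply: (cintegrable_mulC (X := top_sigma B)) => //.
    exact: probability_setT.
  exact: open_borel.
by have [_] := cintegral_transfer mphi (fact_measure_preserving fact) hi.
Qed.

Lemma fourier_support_pull (chi : linear_character R X) :
  fourier mu f chi != 0 -> exists psi, pull psi = chi.
Proof.
move=> f0.
have phi0 : phi 0 = 0 by apply: (addrI (phi 0)); rewrite -phiD !addr0.
have ker k : phi k = 0 -> chi k = 1.
  move=> k0; apply/eqP/negPn/negP => k1; move: f0.
  rewrite fourier_factorization.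
  rewrite (translation_eigen_integral mut (a := k) (z := (chi k)^*)) ?eqxx//.
  - exact: cintegrable_mul_char.
  - by move=> x; rewrite phiD k0 add0r charD rmorphM mulrCA.
  - by apply: contra_neq k1 => e; rewrite -[LHS]conjCK e rmorph1.
have phiB x y : phi (x - y) = phi x - phi y.
  by apply: (addIr (phi y)); rewrite -phiD !subrK.
have fib x y : phi x = phi y -> chi x = chi y.
  move=> xy; rewrite -(subrK y x) charD ker ?mul1r//.
  by rewrite phiB xy subrr.
have [s sE] := choice phis.
pose psi b := chi (s b).
have psiE x : psi (phi x) = chi x by apply: fib; rewrite sE.
have psiD b c : psi (b + c) = psi b * psi c.
  by rewrite -[b]sE -[c]sE -phiD !psiE charD.
have psiN b : `|psi b| = 1 by exact: char_norm.
have psiC : scontinuous (top_sigma B) (psi : B -> R[i]^o).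
  (* In terms of closed sets continuity is a statement about images under [phi], which saturation
     keeps closed. *)
  move=> V oV; rewrite -[psi @^-1` V]setCK; apply: closed_openC.
  have -> : ~` (psi @^-1` V) = phi @` (~` (chi @^-1` V)).
    apply/seteqP; split=> [b nb|_ [x nx <-]] /=; last by rewrite psiE.
    by exists (s b); [move=> vb; apply: nb|exact: sE].
  apply: image_closed => //; first exact: fact_second_countable fact.
  by rewrite setCK; exact: (@char_cont _ _ _ chi).
exists (LinearCharacter psiD psiN psiC).
by apply: char_eqP => x /=; exact: psiE.
Qed.

Lemma factorization_isomorphic :
  isomorphic (haar_fourier mB h) (fourier mu f : linear_character R X -> R[i]).
Proof.
apply: (injection_isomorphic (alpha := pull)).
- by move=> a b; apply: char_eqP => x.
- move=> a b ab; apply: char_eqP => y; have [x <-] := phis y.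
  by have := congr1 (fun c : linear_character R X => c x) ab.
- exact: fourier_pull.
- exact: fourier_support_pull.
Qed.

(** All members of the class are isomorphic to [h] through the transform of [f], so every distance
    is 0; [h] itself belongs to the class, so the set of distances is not empty. *)
Lemma factorization_distance
    (dhat : forall G1 G2 : zmodType, (G1 -> R[i]) -> (G2 -> R[i]) -> R) :
  detects_isomorphism dhat ->
  distance_to_class dhat (fourier mu f : linear_character R X -> R[i]) mB h 0.
Proof.
move=> dI; have hs := haar_square_summable (fact_haar fact) h2.
have hf := factorization_isomorphic.
apply/seteqP; split=> [s [C [n [g [[nh g2 gf] ->]]]]|s -> /=].
  have gs := haar_square_summable nh (iffLR (cLfun2P _ _) g2).
  by apply/(dI _ _ _ _ hs gs); exact: isomorphic_cospan hf gf.
exists B, mB, h; split.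
  by split; [exact: fact_haar fact|exact/cLfun2P|].
by apply/esym/(dI _ _ _ _ hs hs); exact: (isomorphic_cospan hf hf).
Qed.

End Factorization.

Theorem theorem6p5 (R : realType)
    (dhat : forall G1 G2 : zmodType, (G1 -> R[i]) -> (G2 -> R[i]) -> R)
    (dhat_iso : detects_isomorphism dhat)
    (omega : set_system nat) (Uomega : UltraFilter omega)
    (omega_nonprincipal : forall n : nat, omega <> principal_filter n)
    (A : nat -> compactAbGroupType)
    (m : forall i, probability (borel (A i)) R)
    (m_haar : forall i, is_haar (m i))
    (mu : {measure set (generated (ultraprod Uomega A)
                          (@strongly_open omega Uomega A)) -> \bar R})
    (mu_lim : is_ultralimit_measure m mu)
    (f : ultraprod Uomega A -> R[i])
    (f_Linfty : cLfun mu +oo%E f) :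
  let fhat : linear_character R (ultra_sigma Uomega A) -> R[i] :=
    fourier mu f in
  (fourier_measurable (ultra_sigma Uomega A) mu f <->
   exists (B : compactAbGroupType) (mB : probability (borel B) R)
     (phi : ultraprod Uomega A -> B) (h : B -> R[i]),
     factorization mu f mB phi h) /\
  (forall (B : compactAbGroupType) (mB : probability (borel B) R)
     (phi : ultraprod Uomega A -> B) (h : B -> R[i]),
     factorization mu f mB phi h ->
     [/\ square_summable fhat,
         square_summable (haar_fourier mB h),
         isomorphic (haar_fourier mB h) fhat &
         distance_to_class dhat fhat mB h 0]).
Proof.
move=> fhat; split.
  split; first exact: (fourier_measurable_factor omega_nonprincipal m_haar mu_lim).
  by move=> [B [mB [phi [h fact]]]]; exact: (factorization_fourier_measurable fact).
move=> B mB phi h fact; split.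
- exact: (ultra_square_summable m_haar mu_lim f_Linfty).
- apply: haar_square_summable (fact_haar fact) _.
  by apply: cLfun_pinfty_square (fact_Linfty fact); exact: probability_setT.
- exact: (factorization_isomorphic omega_nonprincipal m_haar mu_lim f_Linfty fact).
- exact: (factorization_distance omega_nonprincipal m_haar mu_lim f_Linfty fact dhat_iso).
Qed.
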